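(* Let $k\geq1$ and let $L(k)$ be either $L_k$ or $\mathcal{L}_k$. (1) $C_*(L(k))=\mathrm{Stab}(L(k))\oplus\mathrm{Pos}(L(k))$ is a direct sum of orthogonal subspaces. (2) The chains $\widehat e_I=\widehat\xi_{(I;\emptyset)}$, where $I$ runs over nonsingular $k$-partitions, form a basis of $\mathrm{Stab}(L(k))$. (3) For each nonsingular $k$-partition $I$ there is an expansion $\widehat e_I=e_I+\sum_{I'\triangleright I}\lambda_{I'}e_{I'}$, where the (strict) $k$-partitions $I'$ are singular. (4) Let $c\in\mathrm{Stab}(L(k))$ be a linear combination of singular monomials (i.e. of $e_{I}$ with $I$ a strict singular $k$-partition). Then $c=0$.
   Context: Algebras and complex. Everything is over $\mathbb{Q}$. $L_k$ (resp. $\mathcal{L}_k$) is the Lie algebra with basis $e_i$, $i\geq k$, and bracket $[e_a,e_b]=\mu(b-a)e_{a+b}$, where $\mu(z)=z$ for $L_k$ and $\mu(z)=\varepsilon_z$ for $\mathcal{L}_k$, with $\varepsilon_z\in\{-1,0,1\}$, $\varepsilon_z\equiv z\bmod 3$; $L(k)$ denotes either one. $C_q(L(k))=\bigwedge^qL(k)$ has the basis $e_I=e_{i_1}\wedge\dots\wedge e_{i_q}$, $I=(i_1,\dots,i_q)$, $k\leq i_1<\dots<i_q$; the inner product $\langle\,,\rangle$ makes this basis orthonormal. The boundary operator is $d(e_{i_1}\wedge\dots\wedge e_{i_q})=\sum_{r<s}(-1)^{r+s-1}\mu(i_s-i_r)e_{i_r+i_s}\wedge e_{i_1}\wedge\dots\widehat{e}_{i_r}\dots\widehat{e}_{i_s}\dots\wedge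 e_{i_q}$, and $\delta_k$ is its adjoint, the antiderivation with $\delta_k(e_i)=\sum_{a+b=i,\,k\leq a<b}\mu(b-a)e_a\wedge e_b$. Stable cycles. $\sigma:C_q(L(k))\to C_q(L(k))$ is the linear map $\sigma(e_{i_1}\wedge\dots\wedge e_{i_q})=e_{i_1+1}\wedge\dots\wedge e_{i_q+1}$. A chain $x$ is a stable cycle if $d(\sigma^rx)=0$ for all $r\geq0$. $\mathrm{Stab}(L(k))$ is the space of stable cycles. Partitions. A $k$-partition is $I=(i_1,\dots,i_q)$ with integers $k\leq i_1\leq\dots\leq i_q$ ($\dim I=q$, degree $\sum i_r$); strict if $i_1<\dots<i_q$; nonsingular if $i_{r+1}-i_r\geq3$ for all $r$, singular otherwise. A nonsingular $k$-partition is main if $i_q\leq 2k+3(q-1)$ when $i_1>k$ and $i_q<2k+3(q-1)$ when $i_1=k$; the empty partition is main. A $k$-partition is dense if $i_1>2k$ and $i_{r+1}-i_r=3$ for all $r$. The normal form of a nonsingular $k$-partition is the unique representation $I=I_0\cup I_1\cup\dots\cup I_m$ where $I_0$ is main, $I_1,\dots,I_m$ dense, each of maximal possible dimension (i.e. $I_0$ is the longest main initial segment, the others are the maximal blocks of consecutive remaining parts with successive differences exactly $3$). The leading parts are the minimal parts $I_a(1)$ of $I_a$, $a\geq1$. A nonsingular distinguished $k$-partition is a pair $(I;J)$, $I$ nonsingular, $J$ a subset of its leading parts. The $\xi(k)$-monomial is $\xi_{(I;J)}=\xi_{I_0}\wedge\xi_{I_1}\wedge\dots\wedge\xi_{I_m}$,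 where $\xi_{I_0}=e_{I_0}$ and, for $a\geq1$, $\xi_{I_a}=e_{I_a}$ if $I_a(1)\notin J$, $\xi_{I_a}=\delta_k(e_{I_a})$ if $I_a(1)\in J$. The $\xi(k)$-monomials form a basis of $C_*(L(k))$, under the identification of cochains with chains. $\mathrm{Pos}(L(k))$ is the span of all $\xi_{(I;J)}$ with $J\neq\emptyset$. $\{\widehat\xi_{(I;J)}\}$ is the dual basis: $\langle\widehat\xi_{(I;J)},\xi_{(I';J')}\rangle=1$ if $(I;J)=(I';J')$ and $0$ otherwise. For strict $k$-partitions $I\neq I'$ of the same dimension $q$ and the same degree, $I'\triangleright I$ means $i_1+\dots+i_r\leq i'_1+\dots+i'_r$ for $r=1,\dots,q-1$. *)

(* Defs.v *)
From HB Require Import structures.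
From mathcomp Require Import all_boot all_order all_algebra.
From mathcomp Require Import finmap.
From mathcomp Require Import monalg.
From mathcomp Require Import zify.
From Stdlib Require Import ClassicalEpsilon.

Set Implicit Arguments.
Unset Strict Implicit.
Unset Printing Implicit Defensive.

Import Order.TTheory GRing.Theory Num.Theory.
Local Open Scope ring_scope.

(* [Lwitt] stands for the algebras L_k and [Lmod3] for the algebras
   \mathcal{L}_k. *)
Variant lie_kind := Lwitt | Lmod3.

Definition eps3 (z : int) : rat :=
  if (z %% 3)%Z == 0 then 0 else if (z %% 3)%Z == 1 then 1 else -1.

Definition mu (t : lie_kind) (z : int) : rat :=
  match t with Lwitt => z%:~R | Lmod3 => eps3 z end.

(** * Partitions *)

Definition kpartition (k : nat) (I : seq nat) : bool :=
  all (leq k) I && sorted leq I.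

Definition strict (k : nat) (I : seq nat) : bool :=
  all (leq k) I && sorted ltn I.

Definition nonsingular (k : nat) (I : seq nat) : bool :=
  kpartition k I && sorted (fun a b => (a + 3 <= b)%N) I.

Definition singular (k : nat) (I : seq nat) : bool :=
  kpartition k I && ~~ nonsingular k I.

Definition main (k : nat) (I : seq nat) : bool :=
  nonsingular k I &&
  if I is i1 :: _ then
    let bound := (2 * k + 3 * (size I).-1)%N in
    if i1 == k then (last i1 I < bound)%N else (last i1 I <= bound)%N
  else true.

Definition dense (k : nat) (I : seq nat) : bool :=
  [&& kpartition k I, I != [::], (2 * k < head 0%N I)%N
    & sorted (fun a b => b == (a + 3)%N) I].

(* The normal form I = I_0 \cup I_1 \cup ... \cup I_m: [main_part k I] is I_0
   and [blocks k I] is [:: I_1; ...; I_m]. *)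
Definition main_size (k : nat) (I : seq nat) : nat :=
  (\max_(q < (size I).+1 | main k (take q I)) q)%N.

Definition main_part (k : nat) (I : seq nat) : seq nat :=
  take (main_size k I) I.

Fixpoint runs3 (s : seq nat) : seq (seq nat) :=
  if s is x :: s' then
    match runs3 s' with
    | (y :: b) :: bs =>
        if y == (x + 3)%N then (x :: y :: b) :: bs
        else [:: x] :: (y :: b) :: bs
    | _ => [:: [:: x]]
    end
  else [::].

Definition blocks (k : nat) (I : seq nat) : seq (seq nat) :=
  runs3 (drop (main_size k I) I).

Lemma nonsingular_take k q I : nonsingular k I -> nonsingular k (take q I).
Proof.
move=> /andP[/andP[/allP Ik Is] I3]; apply/andP; split; last exact: take_sorted.
by apply/andP; split; [apply/allP => x /mem_take /Ik | exact: take_sorted].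
Qed.

Lemma main_sizeP k I : main k (main_part k I).
Proof.
rewrite /main_part /main_size.
have A0 : (0 < #|[pred q : 'I_(size I).+1 | main k (take q I)]|)%N.
  by apply/card_gt0P; exists ord0; rewrite inE take0.
have [q /[!inE] mq eq_q] := eq_bigmax_cond (fun q : 'I_(size I).+1 => q : nat) A0.
suff -> : (\max_(q < (size I).+1 | main k (take q I)) q)%N = q by [].
by rewrite -eq_q; apply: eq_bigl => j; rewrite inE.
Qed.

Lemma runs3P s :
  [/\ flatten (runs3 s) = s,
      all (fun B => (B != [::]) && sorted (fun a b => b == (a + 3)%N) B)
        (runs3 s)
    & sorted (fun B C => head 0%N C != (last 0%N B + 3)%N) (runs3 s)].
Proof.
elim: s => //= x s [fs]; case: (runs3 s) fs => [|[|y b] bs] /= fs //.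
  by rewrite -fs.
move=> /andP[yb bbs] sep; rewrite -fs; case: ifP => [/eqP yx|/negbT yx] /=.
- split=> //; first by rewrite yx eqxx -yx yb bbs.
  by case: bs bbs sep {fs}.
- by split=> //; [rewrite yb bbs | rewrite yx sep].
Qed.

Lemma main_size_max k I q : (q <= size I)%N -> main k (take q I) ->
  (q <= main_size k I)%N.
Proof.
rewrite -ltnS => qI mq.
exact: (@leq_bigmax_cond _ (fun j : 'I_(size I).+1 => main k (take j I))
  (fun j => j : nat) (Ordinal qI) mq).
Qed.

Lemma rest_gt k I i : (1 <= k)%N -> nonsingular k I ->
  i \in drop (main_size k I) I -> (2 * k < i)%N.
Proof.
move=> k1 nI; set m := main_size k I.
have [mI|Im] := ltnP m (size I); last by rewrite drop_oversize.
have Is : sorted leq (drop m I).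
  by apply: drop_sorted; case/andP: nI => /andP[].
suff hm : (2 * k < nth 0%N I m)%N.
  move: Is; rewrite (drop_nth 0%N) //= => /(order_path_min leq_trans)/allP sI.
  by rewrite inE => /orP[/eqP->|/sI /(leq_trans hm)].
have : ~~ main k (take m.+1 I).
  by apply/negP => /(main_size_max mI); rewrite ltnn.
rewrite /main nonsingular_take //=; move: (mI); rewrite -/m.
case: I {Is} @m nI mI => // i1 I m nI mI _ /=.
have -> : last i1 (take m I) = nth 0%N (i1 :: I) m.
  rewrite (last_nth 0%N) size_takel //.
  by rewrite -[i1 :: take m I]/(take m.+1 (i1 :: I)) nth_take.
rewrite size_takel //; case: ifP => [/eqP ik|_]; rewrite -?leqNgt -?ltnNge.
- case: (m) => [|j] /=; last by lia.
  by rewrite ik; lia.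
- by lia.
Qed.

Lemma normal_formP k I : (1 <= k)%N -> nonsingular k I ->
  [/\ main k (main_part k I), all (dense k) (blocks k I)
    & main_part k I ++ flatten (blocks k I) = I].
Proof.
move=> k1 nI; rewrite /blocks; have [fI /allP dI _] := runs3P (drop (main_size k I) I).
split; [exact: main_sizeP | | by rewrite fI cat_take_drop].
apply/allP => B BI; have /andP[B0 B3] := dI _ BI.
have Bgt i : i \in B -> (2 * k < i)%N.
  by move=> iB; apply: (rest_gt k1 nI); rewrite -fI; apply/flattenP; exists B.
rewrite /dense B0 B3 andbT Bgt /= ?andbT; last first.
  by case: (B) B0 => // b B' _; rewrite mem_head.
apply/andP; split; first by apply/allP => i /Bgt; lia.
by apply: sub_sorted B3 => a b /eqP->; rewrite leq_addr.
Qed.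

Definition leading (k : nat) (I : seq nat) : seq nat :=
  [seq head 0%N B | B <- blocks k I].

Definition distinguished (k : nat) (p : seq nat * {fset nat}) : bool :=
  nonsingular k p.1 && (p.2 `<=` [fset i in leading k p.1])%fset.

Definition dominates (I' I : seq nat) : Prop :=
  [/\ I' != I, size I' = size I, sumn I' = sumn I
    & forall r : nat, (1 <= r)%N -> (r < size I)%N ->
        (sumn (take r I) <= sumn (take r I'))%N].

(** * Chains *)

Notation strict_part k := {I : seq nat | strict k I}.

(* C_*(L(k)) is the free vector space over Q on the strict k-partitions. It is
   the same space for both kinds of algebra. *)
Notation chain k := {malg rat[strict_part k]}.

(* For a sequence [s] of integers >= k, not necessarily increasing, [e k s] is
   the exterior monomial e_{s_1} /\ ... /\ e_{s_q}: the sorted monomial with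
   the sign of the sorting permutation, and 0 if [s] has a repeated entry
   (since then [sort leq s] is not strict). *)
Definition inversions (s : seq nat) : nat :=
  (\sum_(0 <= j < size s) \sum_(0 <= i < j) (nth 0 s j < nth 0 s i))%N.

Definition e (k : nat) (s : seq nat) : chain k :=
  if insub (sort leq s) is Some K then
    << (-1) ^+ inversions s *g (K : strict_part k) >>
  else 0.

Definition linear_extension (k : nat) (f : seq nat -> chain k) (x : chain k) :
    chain k :=
  \sum_(I <- msupp x) x@_I *: f (sval I).

Definition wedge (k : nat) (x y : chain k) : chain k :=
  linear_extension (fun I => linear_extension (fun J => e k (I ++ J)) y) x.

Definition inner (k : nat) (x y : chain k) : rat :=
  \sum_(I <- msupp x) x@_I * y@_I.

(* Positions [r < s] are counted from 0 here, whence the sign (-1)^(r+s+1). *)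
Definition boundary (k : nat) (t : lie_kind) : chain k -> chain k :=
  linear_extension (fun I =>
    \sum_(0 <= s < size I) \sum_(0 <= r < s)
      let a := nth 0%N I r in let b := nth 0%N I s in
      ((-1) ^+ (r + s).+1 * mu t (b%:Z - a%:Z)) *:
      e k ((a + b)%N ::
           take r I ++ drop r.+1 (take s I) ++ drop s.+1 I)).

Definition delta_gen (k : nat) (t : lie_kind) (i : nat) : chain k :=
  \sum_(k <= a < i | (a < i - a)%N)
    mu t ((i - a)%N%:Z - a%:Z) *: e k [:: a; (i - a)%N].

Definition delta (k : nat) (t : lie_kind) : chain k -> chain k :=
  linear_extension (fun I =>
    \sum_(0 <= r < size I)
      (-1) ^+ r *: wedge (e k (take r I))
                     (wedge (delta_gen k t (nth 0%N I r)) (e k (drop r.+1 I)))).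

Definition shift (k : nat) : chain k -> chain k :=
  linear_extension (fun I => e k (map succn I)).

Definition Stab (k : nat) (t : lie_kind) (x : chain k) : Prop :=
  forall r : nat, boundary t (iter r (@shift k) x) = 0.

(** * Linear algebra *)

Definition in_span (V : lmodType rat) (T : choiceType) (D : T -> Prop)
    (v : T -> V) (x : V) : Prop :=
  exists (s : seq T) (c : T -> rat),
    (forall i, i \in s -> D i) /\ x = \sum_(i <- s) c i *: v i.

Definition lin_indep (V : lmodType rat) (T : choiceType) (D : T -> Prop)
    (v : T -> V) : Prop :=
  forall (s : seq T) (c : T -> rat),
    uniq s -> (forall i, i \in s -> D i) ->
    \sum_(i <- s) c i *: v i = 0 -> forall i, i \in s -> c i = 0.

Definition family_basis (V : lmodType rat) (T : choiceType) (D : T -> Prop)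
    (v : T -> V) (W : V -> Prop) : Prop :=
  lin_indep D v /\ (forall x, W x <-> in_span D v x).

Definition subspace (V : lmodType rat) (W : V -> Prop) : Prop :=
  W 0 /\ forall (a : rat) (x y : V), W x -> W y -> W (a *: x + y).

Definition direct_sum (V : lmodType rat) (U W : V -> Prop) : Prop :=
  [/\ subspace U, subspace W,
      forall x, exists u w, [/\ U u, W w & x = u + w]
    & forall x, U x -> W x -> x = 0].

Definition orthogonal_subspaces (k : nat) (U W : chain k -> Prop) : Prop :=
  forall u w, U u -> W w -> inner u w = 0.

(** * The xi-monomials and their dual basis *)

Definition xi_block (k : nat) (t : lie_kind) (J : {fset nat}) (B : seq nat) :
    chain k :=
  if head 0%N B \in J then delta t (e k B) else e k B.

Definition xi (k : nat) (t : lie_kind) (p : seq nat * {fset nat}) : chain k :=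
  foldl (@wedge k) (e k (main_part k p.1))
    [seq xi_block k t p.2 B | B <- blocks k p.1].

Definition Pos (k : nat) (t : lie_kind) : chain k -> Prop :=
  in_span (fun p => distinguished k p && (p.2 != fset0)) (xi k t).

Definition is_dual (k : nat) (t : lie_kind) (p : seq nat * {fset nat})
    (x : chain k) : Prop :=
  forall p', distinguished k p' -> inner x (xi k t p') = (p == p')%:R.

(* The xi-monomials form a basis of the chains and are homogeneous for degree
   and dimension, with finite-dimensional homogeneous components; hence for
   distinguished [p] exactly one chain satisfies [is_dual t p]. *)
Definition xi_dual (k : nat) (t : lie_kind) (p : seq nat * {fset nat}) :
    chain k :=
  epsilon (inhabits 0) (is_dual t p).

Definition e_hat (k : nat) (t : lie_kind) (I : seq nat) : chain k :=
  xi_dual k t (I, fset0).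

(* Main.v *)
Require Import Defs.
From HB Require Import structures.
From mathcomp Require Import all_boot all_order all_algebra.
From mathcomp Require Import finmap.
From mathcomp Require Import monalg.
From mathcomp Require Import zify ring lra.
From mathcomp Require fingroup perm mpoly.
From Stdlib Require Import Classical ClassicalEpsilon FunctionalExtensionality.

Set Implicit Arguments.
Unset Strict Implicit.
Unset Printing Implicit Defensive.

Import Order.TTheory GRing.Theory Num.Theory.
Local Open Scope ring_scope.

(* Write a chain f through its coefficient function F s = <f, e_s>, an
   antisymmetric function of the sequence s.  Stability of f means that f is
   orthogonal to every delta(e_m) /\ e_s: applied to sigma^r f with r large, the
   adjoint of d isolates one such product, and conversely d is a sum of them.
   Hence Stab is orthogonal to Pos.

   The xi-monomials span.  If F <> 0, among the products delta(e_{m_1}) /\ ...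
   /\ delta(e_{m_j}) /\ e_s not orthogonal to f take one with j maximal and then
   with s and the m's together maximal for the order that compares the greatest
   differing letters.  Identities between such products force all letters to
   differ by at least 3 and every m to start a dense block, and in the expansion
   of <f, xi_(I;J)> for the resulting pair (I;J) all terms have the same sign,
   so that f is not orthogonal to xi_(I;J).

   Stable chains exist.  The coefficients of h(z) prod_{i<j} (z_j - z_i)^3, resp.
   h(z) prod_{i<j} (z_j^3 - z_i^3), with h a symmetric monomial sum, are those of
   a stable chain whose least monomial for dominance is any prescribed
   nonsingular one; eliminating the other nonsingular monomials gives e_hat_I.

   A chain orthogonal to Pos then differs from a combination of the e_hat_I by a
   chain orthogonal to all xi-monomials, hence is stable; orthogonal projection
   to the finite-dimensional graded pieces of Pos yields the decomposition. *)

(** The number 3 in [nonsingular] counts free parameters. For fixed d, a weight c gives a relation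
    between the products e_i /\ delta(e_(d-i)), and c can be prescribed at three consecutive indices
    x, x + 1, x + 2 unless these add up to d. So a letter and a mark at distance below 3 can be
    rewritten through more spread pairs, while at distance 3 two products are exchanged up to a
    negative factor. All relations preserve the sum of the two indices, and spreading a pair raises
    the sum of the powers of 2: hence the order on words. The negative factor cancels the
    alternating sign of the antiderivation, so that no determinant of pairings has to be computed.
    The excluded sum d = 3(x + 1) is responsible for the shape of the main part: the letters k, k +
    1, k + 2 with the marks 2k + 3, 2k + 2, 2k + 1 escape the rewriting, and this yields the
    separate bound for i_1 = k. On the polynomial side the same 3 is the degree of each factor: the
    least exponent of the product is (0, 3, 6, ...), and adding the nondecreasing exponent of h
    gives precisely the sequences with gaps at least 3. *)

Definition mm (t : lie_kind) (a b : nat) : rat := mu t (b%:Z - a%:Z).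

Lemma mm_witt a b : mm Lwitt a b = b%:R - a%:R.
Proof. by rewrite /mm /= intrD intrN. Qed.

Lemma mod3P x : [\/ (x %% 3 = 0)%N, (x %% 3 = 1)%N | (x %% 3 = 2)%N].
Proof.
have : (x %% 3 < 3)%N by rewrite ltn_pmod.
by case: (x %% 3)%N => [|[|[|//]]] _; [constructor 1|constructor 2|constructor 3].
Qed.

Lemma mm_mod3 a b : mm Lmod3 a b =
  (if (b %% 3 == a %% 3)%N then 0 else if (b %% 3 == (a %% 3).+1 %% 3)%N then 1 else -1).
Proof.
rewrite /mm /= /eps3.
have -> : ((b%:Z - a%:Z) %% 3)%Z = (((b %% 3) + 3 - a %% 3) %% 3)%N%:Z by lia.
by case: (mod3P a) => ->; case: (mod3P b) => ->.
Qed.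

Lemma mmC t a b : mm t b a = - mm t a b.
Proof.
case: t; first by rewrite !mm_witt opprB.
by rewrite !mm_mod3; case: (mod3P a) => ->; case: (mod3P b) => ->; rewrite /= ?oppr0 ?opprK.
Qed.

Lemma mm_id t a : mm t a a = 0.
Proof. by have := mmC t a a; lra. Qed.

(** Differences 1 and 2 are nonzero both in Q and modulo 3; at difference 3 the constant of [Lmod3]
    vanishes. *)
Lemma mm_neq0 t a b : (a < b)%N -> (b <= a + 2)%N -> mm t a b != 0.
Proof.
move=> ab ba; case: t.
  by rewrite mm_witt subr_eq0 eqr_nat gtn_eqF.
have h : (b %% 3 <> a %% 3)%N by lia.
by move: h; rewrite mm_mod3; case: (mod3P a) => ->; case: (mod3P b) => ->.
Qed.

(** * Antisymmetric functions and their pairing with delta *)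

(* For such weights the sum of [c i] times e_i /\ delta(e_(d-i)) vanishes: the
   coefficient of e_i /\ e_a /\ e_b is the left-hand side. *)
Definition adm (t : lie_kind) (d : nat) (c : nat -> rat) : Prop :=
  forall i a b, (i + a + b)%N = d ->
    c i * mm t a b + c a * mm t b i + c b * mm t i a = 0.

(** For [Lwitt] the condition says that the points of the graph of c over i, a, b are collinear
    whenever i + a + b = d. A line meets the graph of a cubic in points whose abscissas have a fixed
    sum, here d; affine weights satisfy the condition trivially. *)
Lemma adm_cubic d u v w :
  adm Lwitt d (fun i => u * (i%:R ^+ 2 * (d%:R - i%:R)) + v * i%:R + w).
Proof. by move=> i a b <-; rewrite !mm_witt !natrD; ring. Qed.

(** Three residues with nonzero sum modulo 3 are two equal ones and a different one. The constant of
    the equal pair is 0, and the other two terms cancel because the weight depends on the residue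
    only. *)
Lemma adm_mod3 d (p : nat -> rat) : (d %% 3 != 0)%N ->
  adm Lmod3 d (fun i => p (i %% 3)%N).
Proof.
move=> d3 i a b e; have h : ((i %% 3 + a %% 3 + b %% 3) %% 3 = d %% 3)%N by lia.
move: d3 h; rewrite !mm_mod3.
by case: (mod3P i) => ->; case: (mod3P a) => ->; case: (mod3P b) => -> /= h e';
  try (by rewrite -e' in h); ring.
Qed.

(** Residues with sum 0 are all equal, when every constant is 0, or all distinct, when the three
    constants coincide. The condition is then that the weights at i, a, b add up to 0, as 3i - d, 3a
    - d, 3b - d do. *)
Lemma adm_mod30 d (p : nat -> rat) u : (d %% 3 = 0)%N -> p 0%N + p 1%N + p 2%N = 0 ->
  adm Lmod3 d (fun i => p (i %% 3)%N + u * (3 * i%:R - d%:R)).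
Proof.
move=> d3 p0 i a b e; have h : ((i %% 3 + a %% 3 + b %% 3) %% 3 = 0)%N by lia.
have -> : d%:R = i%:R + a%:R + b%:R :> rat by rewrite -e !natrD.
move: h; rewrite !mm_mod3.
have E : p 2%N = - p 0%N - p 1%N by lra.
by case: (mod3P i) => ->; case: (mod3P a) => ->; case: (mod3P b) => -> //= _;
  rewrite ?E; ring.
Qed.

(** The excluded d is the sum of x, x + 1, x + 2: in that case the condition on this very triple
    ties the three values together. *)
Lemma adm_three t d x (j : nat) : (d != 3 * x.+1)%N -> (j < 3)%N ->
  exists c, [/\ adm t d c, c (x + j)%N != 0 &
    forall j', (j' < 3)%N -> j' != j -> c (x + j')%N = 0].
Proof.
move=> dx j3; have dx' : 3 * (x%:R + 1) - d%:R != 0 :> rat.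
  by rewrite subr_eq0 natr1 -natrM eqr_nat eq_sym.
case: t.
(* The cubic with roots p and q; the third root is d - p - q since the roots sum to d. *)
- pose cc (p q : rat) := (fun i : nat => 1 * (i%:R ^+ 2 * (d%:R - i%:R)) +
     (- (p * q + (p + q) * (d%:R - p - q))) * i%:R + p * q * (d%:R - p - q)).
  have ccE p q i : cc p q i = - (i%:R - p) * (i%:R - q) * (i%:R - (d%:R - p - q)).
    by rewrite /cc; ring.
  have hc p q : adm Lwitt d (cc p q) by apply: adm_cubic.
  case: j j3 => [|[|[|//]]] _.
  + exists (cc (x%:R + 1) (x%:R + 2)); split=> //.
      rewrite ccE addn0 (_ : _ * _ * _ = - 2 * (3 * (x%:R + 1) - d%:R)); last by ring.
      by rewrite mulf_neq0.
    by case=> [|[|[|//]]] _ // _; rewrite ccE natrD; ring.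
  + exists (cc x%:R (x%:R + 2)); split=> //.
      rewrite ccE (_ : _ * _ * _ = (3 * (x%:R + 1) - d%:R)) //; rewrite natrD; ring.
    by case=> [|[|[|//]]] _ // _; rewrite ccE natrD; ring.
  + exists (cc x%:R (x%:R + 1)); split=> //.
      rewrite ccE (_ : _ * _ * _ = - 2 * (3 * (x%:R + 1) - d%:R)); first by rewrite mulf_neq0.
      by rewrite natrD; ring.
    by case=> [|[|[|//]]] _ // _; rewrite ccE natrD; ring.
- have h3 j' : (j' < 3)%N -> j' != j -> ((x + j') %% 3 == (x + j) %% 3)%N = false.
    by move=> ? ?; apply/eqP; lia.
  have [d3|d3] := boolP (d %% 3 == 0)%N; last first.
    exists (fun i => (fun r => (r == (x + j) %% 3)%N%:R) (i %% 3)%N); split.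
    + exact: (@adm_mod3 d (fun r => (r == (x + j) %% 3)%N%:R)).
    + by rewrite /= eqxx oner_neq0.
    + by move=> j' /h3 h /h /= ->.
  pose L (i : nat) : rat := 3 * i%:R - d%:R.
  (* S is the sum of L over the three points. The residue part [y] cancels L at two of them and
     makes the total S at the third, so its own sum is 0. *)
  pose S := 3 * (3 * (x%:R + 1) - d%:R) : rat.
  pose y r := if r == ((x + j) %% 3)%N then S - L (x + j)%N else
     if r == (x %% 3)%N then - L x else
     if r == (x.+1 %% 3)%N then - L x.+1 else - L x.+2.
  exists (fun i => y (i %% 3)%N + 1 * (3 * i%:R - d%:R)); split.
  + apply: (@adm_mod30 d y 1); first exact/eqP.
    have e1 : (x.+1 %% 3 = (x %% 3).+1 %% 3)%N by lia.
    have ej : ((x + j) %% 3 = (x %% 3 + j) %% 3)%N by lia.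
    rewrite /y ej e1.
    by case: j j3 {h3 y ej} => [|[|[|//]]] _; case: (mod3P x) => -> /=;
      rewrite ?addn0 ?addn1 ?addn2 /S /L -?natr1; ring.
  + rewrite /y eqxx mul1r (_ : _ + _ = S); last by rewrite /S /L; ring.
    by rewrite /S mulf_neq0.
  + move=> j' j'3 jj; rewrite /y h3 // mul1r.
    have [->|[->|->]] : (j' = 0 \/ j' = 1 \/ j' = 2)%N by lia.
    * by rewrite addn0 eqxx /L addNr.
    * rewrite addn1 eqxx (_ : (_ == _) = false); last by apply/eqP; lia.
      by rewrite /L addNr.
    * rewrite addn2 (_ : (_ == _) = false); last by apply/eqP; lia.
      rewrite (_ : (_ == _) = false); last by apply/eqP; lia.
      by rewrite /L addNr.
Qed.

(** For [Lwitt] take the roots x + 1 and x + 2: the bound on d puts the third root d - 2x - 3 below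
    x, so the cubic has one sign at x and x + 3. For [Lmod3] these two points share their
    residue. *)
Lemma adm_four t d x : (d < 3 * x.+1)%N ->
  exists c, [/\ adm t d c, 0 < c x, 0 < c (x + 3)%N, c x.+1 = 0 & c x.+2 = 0].
Proof.
move=> dx; have dx' : d%:R < 3 * (x%:R + 1) :> rat by rewrite natr1 -natrM ltr_nat.
case: t.
- pose p : rat := x%:R + 1; pose q : rat := x%:R + 2.
  have := @adm_cubic d (-1) (p * q + (p + q) * (d%:R - p - q)) (- p * q * (d%:R - p - q)).
  set c := (fun i : nat => _).
  have ccE i : c i = (i%:R - p) * (i%:R - q) * (i%:R - (d%:R - p - q)).
    by rewrite /c; ring.
  move=> hc; exists c; split=> //.
  + by rewrite ccE (_ : _ * _ = 2 * (3 * (x%:R + 1) - d%:R)) ?/p ?/q; [lra | ring].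
  + rewrite ccE natrD (_ : _ * _ = 2 * (3 * (x%:R + 2) - d%:R)) ?/p ?/q; [lra | ring].
  + by rewrite ccE -natr1 /p; ring.
  + by rewrite ccE -!natr1 /q; ring.
- have [d3|d3] := boolP (d %% 3 == 0)%N; last first.
    exists (fun i => (fun r => (r == x %% 3)%N%:R) (i %% 3)%N); split.
    + exact: (@adm_mod3 d (fun r => (r == x %% 3)%N%:R)).
    + by rewrite /= eqxx.
    + by rewrite /= modnDr eqxx.
    + by rewrite /= (_ : (_ == _) = false) //; apply/eqP; lia.
    + by rewrite /= (_ : (_ == _) = false) //; apply/eqP; lia.
  pose L (i : nat) : rat := 3 * i%:R - d%:R.
  pose y r := if r == (x %% 3)%N then L x.+1 + L x.+2 else
     if r == (x.+1 %% 3)%N then - L x.+1 else - L x.+2.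
  exists (fun i => y (i %% 3)%N + 1 * (3 * i%:R - d%:R)); split.
  + apply: (@adm_mod30 d y 1); first exact/eqP.
    have e1 : (x.+1 %% 3 = (x %% 3).+1 %% 3)%N by lia.
    rewrite /y e1.
    by case: (mod3P x) => -> /=; ring.
  + by rewrite /y eqxx /L -!natr1; lra.
  + by rewrite /y modnDr eqxx /L natrD -!natr1; lra.
  + rewrite /y eqxx (_ : (_ == _) = false); last by apply/eqP; lia.
    by rewrite /L mul1r addNr.
  + rewrite /y (_ : (_ == _) = false); last by apply/eqP; lia.
    rewrite (_ : (_ == _) = false); last by apply/eqP; lia.
    by rewrite /L mul1r addNr.
Qed.

(** Extension by 0 to letters below [k] allows sums over all pairs of naturals, without reference to
    [k]. *)
Definition alt (k : nat) (F : seq nat -> rat) : Prop :=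
  (forall A x y B, F (A ++ x :: y :: B) = - F (A ++ y :: x :: B))
  /\ (forall s, has (fun x => x < k)%N s -> F s = 0).

Section Alt.
Variable k : nat.
Implicit Types (F G : seq nat -> rat) (s A B : seq nat).

Lemma alt_cons F x : alt k F -> alt k (fun s => F (x :: s)).
Proof.
move=> aF; split=> [A y z B'|s h]; first by rewrite -!cat_cons; apply: (proj1 aF).
by apply: (proj2 aF); rewrite /= h orbT.
Qed.

Lemma alt_swap F x y s : alt k F -> F (x :: y :: s) = - F (y :: x :: s).
Proof. by case=> aF _; rewrite (aF [::]). Qed.

Lemma alt_low F s : alt k F -> has (fun x => x < k)%N s -> F s = 0.
Proof. by case=> _; apply. Qed.

Lemma alt_front F A x B : alt k F -> F (A ++ x :: B) = (-1) ^+ size A * F (x :: A ++ B).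
Proof.
elim: A F => [|y A IH] F aF /=; first by rewrite expr0 mul1r.
by rewrite (IH _ (alt_cons y aF)) alt_swap // exprS mulrN mulN1r mulNr.
Qed.

Lemma alt_perm F s s' : alt k F -> perm_eq s s' -> F s = F s' \/ F s = - F s'.
Proof.
move=> aF; elim: s s' F aF => [|x s IH] s' F aF pe.
  by move: pe; rewrite perm_sym => /perm_nilP ->; left.
have : x \in s' by rewrite -(perm_mem pe) mem_head.
move=> xs'; case/splitPr: xs' pe => A B pe.
have pe' : perm_eq s (A ++ B).
  by rewrite -(perm_cons x); apply: perm_trans pe _; rewrite perm_catC /= perm_cons perm_catC.
have aF' : alt k (fun s => F (x :: s)).
  split=> [A' y z B'|s1 h]; first by rewrite -!cat_cons; apply: (proj1 aF).
  by apply: (proj2 aF); rewrite /= h orbT.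
rewrite (alt_front _ _ _ aF) -signr_odd.
case: (IH _ _ aF' pe') => ->; case: (odd _); rewrite ?expr0 ?expr1 ?mul1r ?mulN1r ?opprK; auto.
Qed.

Lemma alt_perm0 F s s' : alt k F -> perm_eq s s' -> (F s == 0) = (F s' == 0).
Proof. by move=> aF /(alt_perm aF)[->|->]; rewrite ?oppr_eq0. Qed.

Lemma alt_uniq F s : alt k F -> ~~ uniq s -> F s = 0.
Proof.
move=> aF us; have [x [s' pe]] : exists x s', perm_eq s (x :: x :: s').
  elim: s us => //= x s IH; rewrite negb_and negbK => /orP[xs|/IH [y [s' pe]]].
    by exists x, (rem x s); rewrite perm_cons perm_to_rem.
  exists y, (x :: s'); apply: (@perm_trans _ (x :: y :: y :: s')); first by rewrite perm_cons.
  by rewrite -[x :: y :: _]/([:: x] ++ [:: y; y] ++ s') perm_catCA.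
apply/eqP; rewrite (alt_perm0 aF pe); apply/eqP.
by have := alt_swap x x s' aF; lra.
Qed.

Lemma alt_catr F B : alt k F -> alt k (fun s => F (s ++ B)).
Proof.
move=> aF; split=> [A x y B'|s h]; first by rewrite -!catA /=; apply: (proj1 aF).
by apply: (proj2 aF); rewrite has_cat h.
Qed.

End Alt.

(* If [F s] is <f, e_s>, then [Y t m F s] is 2 <f, delta(e_m) /\ e_s>: each
   unordered pair {a, b} is counted twice. *)
Definition Y (t : lie_kind) (m : nat) (F : seq nat -> rat) (s : seq nat) : rat :=
  \sum_(a < m.+1) \sum_(b < m.+1) (a + b == m)%N%:R * mm t a b * F [:: (a : nat), (b : nat) & s].

Lemma sum_wide (V : nmodType) m n (H : nat -> V) : (m <= n)%N ->
  (forall i, (m <= i)%N -> H i = 0) -> \sum_(i < m) H i = \sum_(i < n) H i.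
Proof.
move=> mn H0; rewrite (big_ord_widen n H mn) big_mkcond.
by apply: eq_bigr => i _; case: ltnP => // /H0.
Qed.

Lemma Y_wide t m n F s : (m < n)%N ->
  Y t m F s = \sum_(a < n) \sum_(b < n) (a + b == m)%N%:R * mm t a b * F [:: (a : nat), (b : nat) & s].
Proof.
move=> mn; rewrite /Y.
transitivity (\sum_(a < m.+1) \sum_(b < n) (a + b == m)%N%:R * mm t a b * F [:: (a : nat), (b : nat) & s]).
  apply: eq_bigr => a _.
  apply: (@sum_wide _ m.+1 n (fun b => (a + b == m)%N%:R * mm t a b * F [:: (a : nat), b & s])) => // b mb.
  by rewrite (_ : (_ == _) = false) ?mul0r //; apply/eqP; lia.
apply: (@sum_wide _ m.+1 n (fun a => \sum_(b < n) (a + b == m)%N%:R * mm t a b * F [:: a, (b : nat) & s])) => // a ma.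
apply: big1 => b _.
by rewrite (_ : (_ == _) = false) ?mul0r //; apply/eqP; lia.
Qed.

Lemma sum_ind (V : pzRingType) n i (H : nat -> V) : (i < n)%N ->
  (forall j, (j < n)%N -> j != i -> H j = 0) -> \sum_(j < n) H j = H i.
Proof.
move=> ni H0; rewrite (bigD1 (Ordinal ni)) //= big1 ?addr0 // => j ji.
by apply: H0; rewrite // -val_eqE in ji *.
Qed.

Lemma Y_single t m F s : Y t m F s = \sum_(a < m.+1) mm t a (m - a)%N * F [:: (a : nat), (m - a)%N & s].
Proof.
apply: eq_bigr => a _.
rewrite (@sum_ind _ m.+1 (m - a)%N (fun b => (a + b == m)%N%:R * mm t a b * F [:: (a : nat), b & s])).
- by rewrite (_ : (_ == _)%N = true) ?mul1r //; apply/eqP; have := ltn_ord a; lia.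
- by have := ltn_ord a; lia.
- move=> b bm ba; rewrite (_ : (_ == _)%N = false) ?mul0r //; apply/eqP; have := ltn_ord a.
  by move/eqP: ba; lia.
Qed.

(** * Relations between a letter and a mark *)

Section Y.
Variables (t : lie_kind) (k : nat).
Implicit Types (F G : seq nat -> rat) (s A B : seq nat).

Lemma Y_ext m F G s : (forall s, F s = G s) -> Y t m F s = Y t m G s.
Proof. by move=> h; apply: eq_bigr => a _; apply: eq_bigr => b _; rewrite h. Qed.

Lemma alt_Y m F : alt k F -> alt k (Y t m F).
Proof.
move=> aF; split=> [A x y B|s h]; rewrite /Y.
  rewrite -sumrN; apply: eq_bigr => a _; rewrite -sumrN; apply: eq_bigr => b _.
  by rewrite -!cat_cons (proj1 aF) mulrN.
rewrite big1 // => a _; rewrite big1 // => b _.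
by rewrite (alt_low aF) ?mulr0 //= h !orbT.
Qed.

(** Two distinct letters that are at least k add up to at least 2k + 1, so delta(e_m) = 0. *)
Lemma Y_low m F s : alt k F -> (m <= 2 * k)%N -> Y t m F s = 0.
Proof.
move=> aF mk; rewrite Y_single big1 // => a _.
have [ak|ak] := ltnP a k; first by rewrite (alt_low aF) ?mulr0 //= ak.
have [bk|bk] := ltnP (m - a)%N k; first by rewrite (alt_low aF) ?mulr0 //= bk orbT.
have -> : (m - a)%N = a by have := ltn_ord a; lia.
by rewrite mm_id mul0r.
Qed.

(** The factors delta(e_m) have exterior degree 2 and therefore commute. *)
Lemma Y_comm m n F s : alt k F -> Y t m (Y t n F) s = Y t n (Y t m F) s.
Proof.
move=> aF.
have E m' n' : Y t m' (Y t n' F) s =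
  \sum_(a < m'.+1) \sum_(b < m'.+1) \sum_(c < n'.+1) \sum_(d < n'.+1)
   ((a + b == m')%N%:R * mm t a b * ((c + d == n')%N%:R * mm t c d * F [:: (c : nat), (d : nat), (a : nat), (b : nat) & s])).
  apply: eq_bigr => a _; apply: eq_bigr => b _; rewrite mulr_sumr.
  by apply: eq_bigr => c _; rewrite mulr_sumr.
rewrite !E pair_big [RHS]pair_big /=.
under eq_bigr do rewrite pair_big /=.
under [RHS]eq_bigr do rewrite pair_big /=.
rewrite exchange_big /=; apply: eq_bigr => -[c d] _; apply: eq_bigr => -[a b] _ /=.
rewrite (_ : F [:: (c : nat), _, _, _ & s] = F [:: (a : nat), (b : nat), (c : nat), (d : nat) & s]).
  by ring.
rewrite -[LHS]/(F ([:: (c : nat); (d : nat)] ++ (a : nat) :: (b : nat) :: s)).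
rewrite (alt_front _ _ _ aF) /= sqrrN mul1r.
rewrite -[LHS]/(F ([:: (a : nat); (c : nat); (d : nat)] ++ (b : nat) :: s)).
rewrite (alt_front _ _ _ aF) /= (alt_swap _ _ _ aF).
by rewrite !exprS expr0; ring.
Qed.

(** Since j - i <= 2, the sum for delta(e_(i+j)) contains, besides {i, j}, only more spread pairs
    and possibly two equal letters, which contribute 0. The coefficient of {i, j} is nonzero. *)
Lemma R1_pair i j F s : alt k F -> (i < j)%N -> (j <= i + 2)%N -> Y t (i + j) F s = 0 ->
  (forall a b, (a + b = i + j)%N -> (a < i)%N -> F [:: a, b & s] = 0) -> F [:: i, j & s] = 0.
Proof.
move=> aF ij ji Y0 far.
have far' a b : (a + b = i + j)%N -> (b < i)%N -> F [:: a, b & s] = 0.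
  by move=> ab bi; rewrite (alt_swap _ _ _ aF) far ?oppr0 // addnC.
move: Y0; rewrite Y_single.
have i1 : (i < (i + j).+1)%N by lia.
have j1 : (j < (i + j).+1)%N by lia.
rewrite (bigD1 (Ordinal i1)) // (bigD1 (Ordinal j1)) /=; last by rewrite -val_eqE /= gtn_eqF.
rewrite big1 ?addr0; last first.
  move=> a /andP[ai aj]; rewrite -!val_eqE /= in ai aj; have aD := ltn_ord a.
  have [ali|ial] := ltnP a i; first by rewrite far ?mulr0 //; lia.
  have [bi|ib] := ltnP (i + j - a)%N i; first by rewrite far' ?mulr0 //; lia.
  have -> : (i + j - a)%N = a by lia.
  by rewrite mm_id mul0r.
rewrite addKn addnK (mmC t i j) (alt_swap j i s aF) mulrNN -mulr2n => /eqP.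
by rewrite mulrn_eq0 /= mulf_eq0 (negPf (mm_neq0 t ij ji)) => /eqP.
Qed.

Lemma cyc3 n (H : nat -> nat -> nat -> rat) :
  \sum_(i < n) \sum_(a < n) \sum_(b < n) H i a b = \sum_(i < n) \sum_(a < n) \sum_(b < n) H a b i.
Proof.
by rewrite [RHS]exchange_big /=; apply: eq_bigr => a _; rewrite exchange_big.
Qed.

Definition rel2 (d : nat) (u : nat -> rat) : Prop :=
  forall c, adm t d c -> \sum_(i < d.+1) c i * u i = 0.

(** A term on e_i /\ e_a /\ e_b is unchanged when the three letters rotate. Adding the three rotated
    forms of the sum collects the weights into the left-hand side of [adm]. *)
Lemma rel2_Y d G s : alt k G -> rel2 d (fun i => Y t (d - i) G (i :: s)).
Proof.
move=> aG c hc.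
pose T i a b := (i + a + b == d)%N%:R * G [:: a, b, i & s].
have TC i a b : T i a b = T a b i.
  rewrite /T (_ : (a + b + i)%N = (i + a + b)%N); last by lia.
  by rewrite (alt_swap a b _ aG) -[[:: b, a, i & s]]/([:: b] ++ a :: i :: s)
    (proj1 aG) /= opprK (alt_swap b i _ aG) -[[:: i, b, a & s]]/([:: i] ++ b :: a :: s)
    (proj1 aG) /= opprK.
have E : \sum_(i < d.+1) c i * Y t (d - i) G ((i : nat) :: s) =
  \sum_(i < d.+1) \sum_(a < d.+1) \sum_(b < d.+1) c i * mm t a b * T i a b.
  apply: eq_bigr => i _; rewrite (@Y_wide _ _ d.+1); last by lia.
  rewrite mulr_sumr; apply: eq_bigr => a _; rewrite mulr_sumr; apply: eq_bigr => b _.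
  rewrite /T (_ : (a + b == d - i)%N = (i + a + b == d)%N); last by apply/eqP/eqP; have := ltn_ord i; lia.
  by ring.
have : 3 * (\sum_(i < d.+1) c i * Y t (d - i) G ((i : nat) :: s)) = 0.
  have E1 := E; rewrite (cyc3 _ (fun i a b => c i * mm t a b * T i a b)) in E1.
  have E2 := E1; rewrite (cyc3 _ (fun i a b => c a * mm t b i * T a b i)) in E2.
  rewrite (_ : 3 * _ = \sum_(i < d.+1) c i * Y t (d - i) G ((i : nat) :: s) +
    \sum_(i < d.+1) c i * Y t (d - i) G ((i : nat) :: s) + \sum_(i < d.+1) c i * Y t (d - i) G ((i : nat) :: s)); last by ring.
  rewrite [X in X + _ + _]E [X in _ + X + _]E1 [X in _ + X]E2 -!big_split /=.
  rewrite big1 // => i _; rewrite -!big_split /= big1 // => a _; rewrite -!big_split /= big1 // => b _.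
  rewrite -(TC i a b) (TC b i a) -!mulrDl. rewrite /T /=.
  have [/eqP e|_] := boolP (i + a + b == d)%N; last by rewrite /= mul0r mulr0.
  by rewrite hc ?mul0r.
by move/eqP; rewrite mulf_eq0 /= => /eqP.
Qed.

(** A weight vanishing at two points of the window isolates the term at the third. *)
Lemma rel2_three d u x : rel2 d u -> (d != 3 * x.+1)%N ->
  (forall i, (i <= d)%N -> (i < x)%N || (x + 2 < i)%N -> u i = 0) -> forall i, (i <= d)%N -> u i = 0.
Proof.
move=> ru dx supp i id.
have [ix|ix] := boolP ((i < x)%N || (x + 2 < i)%N); first exact: supp.
have [j [j3 ij]] : exists j, (j < 3)%N /\ i = (x + j)%N by exists (i - x)%N; lia.
subst i.
have [c [hc cj c0]] := adm_three t dx j3.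
have := ru c hc; rewrite (@sum_ind _ d.+1 (x + j)%N (fun i => c i * u i)).
- by move/eqP; rewrite mulf_eq0 (negPf cj) => /eqP.
- by lia.
- move=> i' i'd /eqP i'j; have [i'x|i'x] := boolP ((i' < x)%N || (x + 2 < i')%N).
    by rewrite supp ?mulr0.
  have -> : i' = (x + (i' - x))%N by lia.
  by rewrite c0 ?mul0r //; [lia | apply/eqP; lia].
Qed.

(** The weight of [adm_four] leaves only the two ends of the window, both with positive weight. The
    sign of v is what later makes the terms of a pairing add up. *)
Lemma rel2_four d u x : rel2 d u -> (d < 3 * x.+1)%N -> (x + 3 <= d)%N ->
  (forall i, (i <= d)%N -> (i < x)%N || (x + 3 < i)%N -> u i = 0) ->
  exists v : rat, v < 0 /\ u (x + 3)%N = v * u x.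
Proof.
move=> ru dx xd supp; have [c [hc c1 c2 c3 c4]] := adm_four t dx.
have := ru c hc.
have xd1 : (x < d.+1)%N by lia.
have xd2 : (x + 3 < d.+1)%N by lia.
rewrite (bigD1 (Ordinal xd1)) // (bigD1 (Ordinal xd2)) /=; last by rewrite -val_eqE /=; lia.
rewrite big1 ?addr0; last first.
  move=> i /andP[]; rewrite -!val_eqE /= => i1 i2.
  have [i'x|i'x] := boolP ((i < x)%N || (x + 3 < i)%N).
    by rewrite supp ?mulr0 //; have := ltn_ord i; lia.
  have [->|->] : (i = x.+1 :> nat \/ i = x.+2 :> nat) by lia.
    by rewrite c3 mul0r.
  by rewrite c4 mul0r.
move=> e; exists (- (c x / c (x + 3)%N)); split; first by rewrite oppr_lt0 divr_gt0.
apply: (mulfI (lt0r_neq0 c2)).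
have -> : c (x + 3)%N * (- (c x / c (x + 3)%N) * u x) = - (c x * u x).
  by field; rewrite lt0r_neq0.
by move/eqP: e; rewrite addrC addr_eq0 => /eqP.
Qed.

End Y.

(* Comparing [code] compares sets of letters by their greatest differing
   element. *)
Definition code (s : seq nat) : nat := \sum_(x <- s) 2 ^ x.

Lemma code_cons x s : code (x :: s) = (2 ^ x + code s)%N.
Proof. by rewrite /code big_cons. Qed.

Lemma code_cat s s' : code (s ++ s') = (code s + code s')%N.
Proof. by rewrite /code big_cat. Qed.

Lemma code_perm s s' : perm_eq s s' -> code s = code s'.
Proof. by move=> p; rewrite /code (perm_big _ p). Qed.

Lemma code_lt n s : uniq s -> all (fun x => x < n)%N s -> (code s < 2 ^ n)%N.
Proof.
elim: n s => [|n IH] s us ls.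
  by case: s us ls => // _ _; rewrite /code big_nil.
have [ns|ns] := boolP (n \in s).
  rewrite (code_perm (perm_to_rem ns)) code_cons expnS mul2n -addnn ltn_add2l IH ?rem_uniq //.
  apply/allP => x; rewrite (rem_filter _ us) mem_filter => /andP[/= xn /(allP ls)].
  by rewrite ltnS leq_eqVlt (negPf xn).
apply: leq_trans (IH s us _) _; last by rewrite leq_exp2l.
by apply/allP => x xs; have := allP ls _ xs; rewrite ltnS leq_eqVlt => /orP[/eqP e|//]; rewrite -e xs in ns.
Qed.

Lemma exists_max (P : nat -> Prop) B : (exists n, P n) -> (forall n, P n -> (n <= B)%N) ->
  exists n, P n /\ forall m, P m -> (m <= n)%N.
Proof.
elim: B => [|B IH] [n Pn] PB.
  by exists n; split=> // m /PB; rewrite leqn0 => /eqP->.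
have [PB1|PB1] := classic (P B.+1); first by exists B.+1.
apply: IH; first by exists n.
by move=> m Pm; have := PB _ Pm; rewrite leq_eqVlt => /orP[/eqP e|//]; rewrite e in Pm.
Qed.

Lemma exists_min (P : nat -> Prop) : (exists n, P n) ->
  exists n, P n /\ forall m, P m -> (n <= m)%N.
Proof.
case=> n Pn; elim: n {-2}n (leqnn n) Pn => [|N IH] n nN Pn.
  by exists n; split=> // m _; move: nN; rewrite leqn0 => /eqP->.
have [[m [Pm mn]]|h] := classic (exists m, P m /\ (m < n)%N).
  by apply: (IH m) => //; lia.
by exists n; split=> // m Pm; rewrite leqNgt; apply/negP => mn; apply: h; exists m.
Qed.

(** * Letters below the smallest mark *)

Section Boundary.
Variables (t : lie_kind) (k : nat).
Implicit Types (F G H : seq nat -> rat) (s : seq nat).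

Lemma alt_rcons F x s : alt k F -> (F (s ++ [:: x]) == 0) = (F (x :: s) == 0).
Proof. by move=> aF; apply: (alt_perm0 aF); rewrite perm_catC. Qed.

Lemma alt_mem F p x : alt k F -> (exists s, [/\ size s = p.+1, x \in s & F s != 0]) ->
  exists s, size s = p /\ F (s ++ [:: x]) != 0.
Proof.
move=> aF [s [sz xs Fs]]; exists (rem x s); split; first by rewrite size_rem // sz.
by rewrite alt_rcons // -(alt_perm0 aF (perm_to_rem xs)).
Qed.

(** As L is the largest letter that occurs, any pair more spread than {x, L} contains a letter
    beyond L, and [R1_pair] applies. *)
Lemma top_gap H L p : alt k H -> (forall n s, Y t n H s = 0) ->
  (forall s, size s = p.+1 -> has (fun x => L < x)%N s -> H s = 0) ->
  forall s, size s = p -> has (leq (L - 2)) s -> H (s ++ [:: L]) = 0.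
Proof.
move=> aH Y0 far s sz /hasP[x xs Lx].
apply/eqP; rewrite alt_rcons //.
have pe : perm_eq (L :: s) [:: x, L & rem x s].
  apply: (@perm_trans _ (L :: x :: rem x s)); first by rewrite perm_cons perm_to_rem.
  by rewrite -[L :: x :: _]/([:: L] ++ [:: x] ++ rem x s) perm_catCA.
have szr : size (rem x s) = p.-1 by rewrite size_rem ?sz.
have p0 : (0 < p)%N by rewrite -sz; case: (s) xs.
rewrite (alt_perm0 aH pe); apply/eqP.
have [xL|Lx'] := ltnP L x; first by apply: far; rewrite /= ?xL ?szr //; lia.
have [xL|xL] := eqVneq x L.
  by apply: (alt_uniq aH); rewrite xL /= mem_head.
apply: (R1_pair aH _ _ (Y0 _ _)); [lia | lia |] => a b ab ax.
have Lb : (L < b)%N by lia.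
by apply: far; rewrite /= ?Lb ?orbT // szr; lia.
Qed.

(** Splitting off the largest letter lowers the bound for the others by at least 3, and the last
    letter left is at least k. *)
Lemma letters_bound p H B : (0 < k)%N -> alt k H -> (forall n s, Y t n H s = 0) ->
  (forall s, size s = p.+1 -> has (leq B) s -> H s = 0) ->
  (exists s, size s = p.+1 /\ H s != 0) -> (k + 3 * p.+1 <= B + 2)%N.
Proof.
move=> k0; elim: p H B => [|p IH] H B aH Y0 far [s [sz Hs]].
  case: s sz Hs => [|x []] // _ Hs.
  have xk : (k <= x)%N.
    by rewrite leqNgt; apply: contraNN Hs => xk; rewrite (alt_low aH) //= xk.
  have xB : (x < B)%N.
    by rewrite ltnNge; apply: contraNN Hs => xB; rewrite far //= xB.
  by lia.
pose P (x : nat) := exists s, [/\ size s = p.+2, x \in s & H s != 0].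
have [L [PL maxL]] : exists L, P L /\ forall x, P x -> (x <= L)%N.
  apply: (@exists_max P B); first by case: s sz Hs => // x s sz Hs; exists x, (x :: s); rewrite mem_head.
  move=> x [s' [sz' xs' Hs']]; rewrite leqNgt; apply: contraNN Hs' => Bx.
  by rewrite far //; apply/hasP; exists x => //; exact: ltnW.
have [s1 [sz1 Hs1]] := alt_mem aH PL.
have LB : (L < B)%N.
  rewrite ltnNge; apply: contraNN Hs1 => BL; rewrite far ?size_cat ?sz1 ?addn1 //.
  by rewrite has_cat /= BL orbT.
have farL s' : size s' = p.+2 -> has (fun x => L < x)%N s' -> H s' = 0.
  move=> sz' /hasP[x xs' Lx]; apply/eqP; apply: contraTT Lx => Hs'.
  by rewrite -leqNgt; apply: maxL; exists s'.
have := IH (fun s => H (s ++ [:: L])) (L - 2)%N (alt_catr _ aH) (fun n s => Y0 n (s ++ [:: L]))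
  (top_gap aH Y0 farL) (ex_intro _ s1 (conj sz1 Hs1)).
by lia.
Qed.

(* Applied to the letters below the smallest mark, this shows that no mark lies
   in the main part: the bound 2k + 3p of a main partition is attained only if
   [k] occurs among the letters, which the definition of main excludes. *)
Lemma boundary_letter p G B : (0 < k)%N -> alt k G -> (forall n m s, Y t n (Y t m G) s = 0) ->
  (forall m s, size s = p -> has (leq B) s -> Y t m G s = 0) ->
  (forall m s, size s = p -> (2 * k + 3 * p < m)%N -> Y t m G s = 0) ->
  (exists m s, size s = p /\ Y t m G s != 0) ->
  [/\ (0 < p)%N, (k + 3 * p <= B)%N,
      exists s, size s = p /\ Y t (2 * k + 3 * p) G s != 0 &
      forall s, size s = p -> Y t (2 * k + 3 * p) G s != 0 ->
        (forall s', size s' = p -> Y t (2 * k + 3 * p) G s' != 0 -> (code s' <= code s)%N) ->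
        k \in s].
Proof.
move=> k0; elim: p G B => [|p IH] G B aG YY far top [m0 [s0 [sz0 Ys0]]].
  exfalso; move/negP: Ys0; apply; rewrite muln0 addn0 in top.
  have [mk|mk] := leqP m0 (2 * k); first by rewrite (Y_low _ _ aG).
  by rewrite top.
have aY m : alt k (Y t m G) by exact: alt_Y.
have klow m i s : size s = p -> (i < k)%N -> Y t m G (i :: s) = 0.
  by move=> _ ik; rewrite (alt_low (aY m)) //= ik.
pose P (x : nat) := exists m s, [/\ size s = p.+1, x \in s & Y t m G s != 0].
have [L [[m1 PL] maxL]] : exists L, P L /\ forall x, P x -> (x <= L)%N.
  apply: (@exists_max P B).
    by case: s0 sz0 Ys0 => // x s sz Hs; exists x, m0, (x :: s); rewrite mem_head.
  move=> x [m [s' [sz' xs' Hs']]]; rewrite leqNgt; apply: contraNN Hs' => Bx.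
  by rewrite far //; apply/hasP; exists x => //; exact: ltnW.
have [s1 [sz1 Hs1]] := alt_mem (aY m1) PL.
have LB : (L < B)%N.
  rewrite ltnNge; apply: contraNN Hs1 => BL; rewrite far ?size_cat ?sz1 ?addn1 //.
  by rewrite has_cat /= BL orbT.
have farL m s' : size s' = p.+1 -> has (fun x => L < x)%N s' -> Y t m G s' = 0.
  move=> sz' /hasP[x xs' Lx]; apply/eqP; apply: contraTT Lx => Hs'.
  by rewrite -leqNgt; apply: maxL; exists m, s'.
have farL1 m i s : size s = p -> (L < i)%N -> Y t m G (i :: s) = 0.
  by move=> sz Li; apply: farL; rewrite /= ?sz ?Li.
have Lk : (k <= L)%N.
  rewrite leqNgt; apply: contraNN Hs1 => Lk; rewrite (alt_low (aY m1)) //.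
  by rewrite has_cat /= Lk orbT.
have weak : (k + 3 * p.+1 <= L + 3)%N.
  suff : (k + 3 * p.+1 <= L.+1 + 2)%N by lia.
  apply: (@letters_bound p (Y t m1 G) L.+1 k0 (aY m1) (fun n s => YY n m1 s) (@farL m1)).
  by exists (s1 ++ [:: L]); rewrite size_cat sz1 addn1.
have rel s (d : nat) : rel2 t d (fun i => Y t (d - i) G (i :: s)) by exact: (@rel2_Y t k d G s aG).
case: p IH far top sz0 P PL maxL sz1 farL farL1 klow weak => [|p] IH far top sz0 P PL maxL sz1 farL farL1 klow weak.
  case: s1 sz1 Hs1 => // _ /= Hs1.
  have m1k : (2 * k < m1)%N.
    by rewrite ltnNge; apply: contraNN Hs1 => mk; rewrite (Y_low _ _ aG).
  have m1K : (m1 <= 2 * k + 3)%N.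
    by rewrite leqNgt; apply: contraNN Hs1 => mk; rewrite top //; lia.
  have win d x : (d != 3 * x.+1)%N ->
     (forall i, (i <= d)%N -> (i < x)%N || (x + 2 < i)%N -> [|| i < k, L < i | 2 * k + 3 < d - i]%N) ->
     forall i, (i <= d)%N -> Y t (d - i) G [:: i] = 0.
    move=> dx h; apply: (rel2_three (rel _ _) dx) => i id ix.
    case/or3P: (h i id ix) => hi; first exact: klow.
      exact: farL1.
    by rewrite top //; lia.
  have dE : (m1 = L + m1 - L)%N by rewrite addKn.
  (* The window has to contain L, so it starts at L - 2 or L - 1; the only configuration that
     defeats both choices has sum L + m1 = 3k + 3. *)
  have Lk2 : L = k.+2 /\ m1 = (2 * k).+1.
    have [//|ne] := classic (L = k.+2 /\ m1 = (2 * k).+1).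
    exfalso; move/negP: Hs1; apply; rewrite dE; apply/eqP.
    have [e|e] := eqVneq (L + m1)%N (3 * (L - 2).+1)%N; last first.
      by apply: (win _ (L - 2)%N) => // [i|]; lia.
    by apply: (win _ (L - 1)%N) => // [|i|]; lia.
  case: Lk2 => L2 m1E.
  have Yk : Y t (2 * k + 3) G [:: k] != 0.
    apply/negP => /eqP Yk0; move/negP: Hs1; apply; rewrite dE; apply/eqP.
    have := @rel2_three t (L + m1)%N _ k.+1 (rel [::] _) _ _ L (leq_addr _ _); apply; first by lia.
    move=> i iLm ix; have [->|[hi|[hi|hi]]] : i = k \/ (i < k)%N \/ (L < i)%N \/ (2 * k + 3 < L + m1 - i)%N by lia.
    - by rewrite (_ : (L + m1 - k)%N = (2 * k + 3)%N) //; lia.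
    - exact: klow.
    - exact: farL1.
    - by rewrite top //; lia.
  split=> //; first by lia.
    by exists [:: k]; rewrite muln1.
  move=> s ssz; rewrite muln1; case: s ssz => [|i []] // _ Yi _; rewrite inE eq_sym.
  have [//|ik] := eqVneq i k; exfalso; move/negP: Yi; apply; apply/eqP.
  have [ki|ki] := ltnP i k; first exact: klow.
  (* The sum i + 2k + 3 equals the excluded value 3(i + 1) only for i = k; for other i the window
     starting at i forces the product to vanish. *)
  rewrite [X in Y t X](_ : _ = i + (2 * k + 3) - i)%N; last by lia.
  by apply: (win _ i) => // [|j|]; lia.
have [mtop mtopE] : exists mt, mt = (2 * k + 3 * p.+2)%N by eexists.
rewrite -mtopE in top *.
(* Letters above L and marks above [mtop] do not occur, so for m > mtop - 3 the relation involves
   only three consecutive letters. If L + m is the excluded sum, [weak] allows the window to start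
   at L - 1. Hence splitting off L lowers the bound on the marks by 3, as the induction requires. *)
have F3 m s : size s = p.+1 -> (mtop < m + 3)%N -> Y t m G (L :: s) = 0.
  move=> sz hm; have [mt|mt] := ltnP mtop m; first by rewrite top //= sz.
  rewrite [X in Y t X](_ : _ = L + m - L)%N; last by lia.
  have van i : (i <= L + m)%N -> (L < i)%N \/ (mtop < L + m - i)%N -> Y t (L + m - i) G (i :: s) = 0.
    by move=> _ [hi|hi]; [exact: farL1 | rewrite top //= sz].
  have [e|e] := eqVneq (L + m)%N (3 * (L - 2).+1)%N; last first.
    apply: (@rel2_three t (L + m)%N _ (L - 2) (rel s _)); [lia | | lia].
    by move=> i iLm ix; apply: van => //; lia.
  apply: (@rel2_three t (L + m)%N _ (L - 1) (rel s _)); [lia | | lia].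
  by move=> i iLm ix; apply: van => //; lia.
have := IH (fun s => G (s ++ [:: L])) (L - 2)%N (alt_catr _ aG) (fun n m s => YY n m (s ++ [:: L])).
have YL m s : Y t m (fun s => G (s ++ [:: L])) s = Y t m G (s ++ [:: L]) by [].
case.
- move=> m s sz h; rewrite YL; exact: (top_gap (aY m) (fun n s => YY n m s) (@farL m)).
- move=> m s sz hm; rewrite YL; apply/eqP; rewrite (alt_rcons _ _ (aY m)); apply/eqP.
  by apply: F3 => //; lia.
- by exists m1, s1.
move=> _ LB' [s2 [sz2 Ys2]] IHmax.
have [m' m'E] : exists m', m' = (2 * k + 3 * p.+1)%N by eexists.
rewrite -m'E in Ys2 IHmax.
(* The exchange of (L, mtop - 3) with (L - 3, mtop) carries the extreme mark of the shorter word to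
   that of the full word. *)
have F4 s : size s = p.+1 -> (Y t m' G (L :: s) == 0) = (Y t mtop G ((L - 3)%N :: s) == 0).
  move=> sz; have [||i iLm ix|v [v0 e]] := @rel2_four t (L + m')%N _ (L - 3) (rel s _); [lia | lia | | ].
    have [hi|hi] : (L < i)%N \/ (mtop < L + m' - i)%N by lia.
      exact: farL1.
    by rewrite top //= sz.
  move: e; rewrite (_ : (L + m' - (L - 3 + 3))%N = m'); last by lia.
  rewrite (_ : (L - 3 + 3)%N = L); last by lia.
  rewrite (_ : (L + m' - (L - 3))%N = mtop); last by lia.
  by move=> ->; rewrite mulf_eq0 (negPf (ltr0_neq0 v0)).
have nz s : size s = p.+1 -> (Y t m' (fun s => G (s ++ [:: L])) s == 0) = (Y t mtop G ((L - 3)%N :: s) == 0).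
  by move=> sz; rewrite YL (alt_rcons _ _ (aY m')) F4.
split=> //; first by lia.
  by exists ((L - 3)%N :: s2); rewrite /= sz2 -nz.
move=> s sz Ys smax.
have us : uniq s by apply: contraNT Ys => us; rewrite (alt_uniq (aY mtop)).
have ls : all (fun x => x <= L - 3)%N s.
  apply/allP => x xs; rewrite leqNgt; apply: contraNN Ys => Lx.
  rewrite (alt_perm0 (aY mtop) (perm_to_rem xs)); apply/eqP.
  have szr : size (rem x s) = p.+1 by rewrite size_rem // sz.
  rewrite [X in Y t X](_ : _ = x + mtop - x)%N; last by lia.
  have [xL|xL] := ltnP L x; first exact: farL1.
  have van i : (i <= x + mtop)%N -> (L < i)%N \/ (mtop < x + mtop - i)%N ->
      Y t (x + mtop - i) G (i :: rem x s) = 0.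
    by move=> _ [hi|hi]; [exact: farL1 | rewrite top //= szr].
  have [e|e] := eqVneq (x + mtop)%N (3 * (L - 2).+1)%N; last first.
    apply: (@rel2_three t (x + mtop)%N _ (L - 2) (rel _ _)); [lia | | lia].
    by move=> i iLm ix; apply: van => //; lia.
  apply: (@rel2_three t (x + mtop)%N _ (L - 1) (rel _ _)); [lia | | lia].
  by move=> i iLm ix; apply: van => //; lia.
(* Otherwise all letters of s lie below L - 3, and s has a smaller code than the word made of L - 3
   and s2. *)
have Ls : (L - 3)%N \in s.
  apply/negPn/negP => Ls; have : (code s < 2 ^ (L - 3))%N.
    apply: code_lt => //; apply/allP => x xs; have := allP ls _ xs.
    by rewrite leq_eqVlt => /orP[/eqP e|//]; rewrite -e xs in Ls.
  have := smax ((L - 3)%N :: s2); rewrite /= sz2 -nz // => /(_ erefl Ys2).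
  by rewrite code_cons; lia.
rewrite (perm_mem (perm_to_rem Ls)) inE; apply/orP; right.
have szr : size (rem (L - 3)%N s) = p.+1 by rewrite size_rem // sz.
apply: IHmax => //; first by rewrite nz // -(alt_perm0 (aY mtop) (perm_to_rem Ls)).
move=> s' sz' Ys'; have := smax ((L - 3)%N :: s').
rewrite /= sz' -nz // => /(_ erefl Ys').
by rewrite (code_perm (perm_to_rem Ls)) !code_cons leq_add2l.
Qed.

End Boundary.

(* The analogue of [adm] for sums of delta(e_m) /\ delta(e_(d-m)). *)
Definition adm4 (t : lie_kind) (d : nat) (c : nat -> rat) : Prop :=
  forall x y z w, (x + y + z + w)%N = d ->
    c (x + y)%N * (mm t x y * mm t z w) =
    c (x + z)%N * (mm t x z * mm t y w) + c (x + w)%N * (mm t x w * mm t z y).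

(** The constant weight gives the three-term Pluecker relation for the differences of four numbers.
    The quadratic weight is symmetric under m -> d - m, in keeping with two commuting factors. *)
Lemma adm4_quadratic d u v :
  adm4 Lwitt d (fun m => u * (2 * m%:R - d%:R) ^+ 2 + v).
Proof. by move=> x y z w <-; rewrite !mm_witt !natrD; ring. Qed.

(** In the window |2i - d| <= 3 the numbers 2i - d have the parity of d, so their squares are 0 and
    4, or 1 and 9; [o] is the square not attained at m. For [Lmod3], two points of the window share
    a residue only if they are the two ends of four, and these are exchanged by i -> d - i. *)
Lemma adm4_weight t d m : (m <= d)%N -> (d <= 2 * m + 3)%N -> (2 * m <= d + 3)%N ->
  exists c, [/\ adm4 t d c, c m != 0, c (d - m)%N = c m &
   forall i, (i <= d)%N -> (d <= 2 * i + 3)%N -> (2 * i <= d + 3)%N -> i != m -> i != (d - m)%N -> c i = 0].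
Proof.
move=> md m1 m2; case: t.
  pose D (i : nat) : rat := (2 * i%:R - d%:R) ^+ 2.
  pose o : rat := if (D m == 0) then 4 else if D m == 4 then 0 else if D m == 1 then 9 else 1.
  have DE i : (d <= 2 * i + 3)%N -> (2 * i <= d + 3)%N -> 
     exists j : nat, [/\ D i = j%:R, (j \in [:: 0; 4; 1; 9])%N & ((d = 2 * i + 0 /\ j = 0) \/ (d = 2 * i + 2 /\ j = 4) \/ (d + 2 = 2 * i /\ j = 4) \/ (d = 2 * i + 1 /\ j = 1) \/ (d + 1 = 2 * i /\ j = 1) \/ (d = 2 * i + 3 /\ j = 9) \/ (d + 3 = 2 * i /\ j = 9))%N].
    move=> h1 h2.
    have: (d = 2 * i + 0 \/ d = 2 * i + 2 \/ d + 2 = 2 * i \/ d = 2 * i + 1 \/ d + 1 = 2 * i \/ d = 2 * i + 3 \/ d + 3 = 2 * i)%N by lia.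
    have dR e1 e2 : (d + e1 = 2 * i + e2)%N -> D i = (e1%:R - e2%:R) ^+ 2.
      move=> e; have : (d + e1)%N%:R = (2 * i + e2)%N%:R :> rat by rewrite e.
      by rewrite natrD natrD natrM /D => e'; congr (_ ^+ 2); lra.
    move=> [e|[e|[e|[e|[e|[e|e]]]]]].
    - by exists 0%N; split; [rewrite (dR 0%N 0%N) //; lia | by [] | left].
    - by exists 4%N; split; [rewrite (dR 0%N 2%N) //; lia | by [] | right; left].
    - by exists 4%N; split; [rewrite (dR 2%N 0%N) //; lia | by [] | do 2 right; left].
    - by exists 1%N; split; [rewrite (dR 0%N 1%N) //; lia | by [] | do 3 right; left].
    - by exists 1%N; split; [rewrite (dR 1%N 0%N) //; lia | by [] | do 4 right; left].
    - by exists 9%N; split; [rewrite (dR 0%N 3%N) //; lia | by [] | do 5 right; left].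
    - by exists 9%N; split; [rewrite (dR 3%N 0%N) //; lia | by [] | do 6 right].
  exists (fun i => 1 * D i - o); split.
  - exact: adm4_quadratic.
  - rewrite mul1r /o; have [j [-> jin _]] := DE m m1 m2.
    by move: jin; rewrite !inE => /or4P[] /eqP->.
  - rewrite !mul1r; congr (_ - _); rewrite /D natrB //; ring.
  - move=> i id i1 i2 im idm; rewrite mul1r /o.
    have [j [-> _ ji]] := DE m m1 m2; have [j' [-> _ ji']] := DE i i1 i2.
    have : (j = 0 /\ j' = 4 \/ j = 4 /\ j' = 0 \/ j = 1 /\ j' = 9 \/ j = 9 /\ j' = 1)%N by lia.
    by move=> [[-> ->]|[[-> ->]|[[-> ->]|[-> ->]]]].
pose r := (m %% 3)%N; pose r' := ((d - m) %% 3)%N.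
exists (fun i => (i %% 3 == r)%N%:R + (i %% 3 == r')%N%:R); split.
- move=> x y z w e.
  have h : ((x %% 3 + y %% 3 + z %% 3 + w %% 3) %% 3 = (r + r') %% 3)%N by rewrite /r /r'; lia.
  have r3 : (r < 3)%N by rewrite ltn_pmod.
  have r3' : (r' < 3)%N by rewrite ltn_pmod.
  rewrite !mm_mod3 -(modnDm x y) -(modnDm x z) -(modnDm x w).
  move: r r' r3 r3' h => [|[|[|//]]] [|[|[|//]]] _ _;
    case: (mod3P x) => ->; case: (mod3P y) => ->; case: (mod3P z) => ->; case: (mod3P w) => -> //.
- by rewrite eqxx; case: ((m %% 3)%N == r').
- by rewrite addrC /r /r' !eqxx eq_sym.
- move=> i id i1 i2 im idm; rewrite (_ : (i %% 3 == r)%N = false); last by apply/eqP; rewrite /r; lia.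
  by rewrite (_ : (i %% 3 == r')%N = false) ?addr0 //; apply/eqP; rewrite /r'; lia.
Qed.

(** * Relations between two marks *)

Section Quad.
Variables (t : lie_kind) (k : nat).
Implicit Types (F G : seq nat -> rat) (s : seq nat).

Lemma quad_swap1 n (H : nat -> nat -> nat -> nat -> rat) :
  \sum_(x < n) \sum_(y < n) \sum_(z < n) \sum_(w < n) H x y z w =
  \sum_(x < n) \sum_(y < n) \sum_(z < n) \sum_(w < n) H x z y w.
Proof. by apply: eq_bigr => x _; rewrite exchange_big. Qed.

Lemma quad_swap2 n (H : nat -> nat -> nat -> nat -> rat) :
  \sum_(x < n) \sum_(y < n) \sum_(z < n) \sum_(w < n) H x y z w =
  \sum_(x < n) \sum_(y < n) \sum_(z < n) \sum_(w < n) H x w z y.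
Proof.
apply: eq_bigr => x _; rewrite exchange_big [RHS]exchange_big /=.
by apply: eq_bigr => z _; rewrite exchange_big.
Qed.

Lemma alt_perm_swap24 F x y z w s : alt k F -> F [:: x, y, z, w & s] = - F [:: x, w, z, y & s].
Proof.
move=> aF; rewrite -[[:: x, y, z, w & s]]/([:: x] ++ y :: z :: w :: s) (proj1 aF) /=.
rewrite -[[:: x, z, y, w & s]]/([:: x; z] ++ y :: w :: s) (proj1 aF) /=.
by rewrite -[[:: x, z, w, y & s]]/([:: x] ++ z :: w :: y :: s) (proj1 aF) /= opprK.
Qed.

Lemma alt_perm_swap14 F x y z w s : alt k F -> F [:: x, y, z, w & s] = - F [:: w, y, z, x & s].
Proof.
move=> aF; rewrite (alt_swap x y _ aF) (alt_perm_swap24 _ _ _ _ _ aF) opprK.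
by rewrite (alt_swap y w _ aF).
Qed.

(** Four letters split into two pairs in three ways. Tripling the sum brings the three splittings
    together; antisymmetry supplies the signs with which they appear in [adm4]. *)
Lemma YY_weight d c G s : alt k G -> adm4 t d c ->
  \sum_(m < d.+1) c m * Y t m (Y t (d - m) G) s = 0.
Proof.
move=> aG hc.
pose T x y z w := (x + y + z + w == d)%N%:R * G [:: z, w, x, y & s].
have E : \sum_(m < d.+1) c m * Y t m (Y t (d - m) G) s =
  \sum_(x < d.+1) \sum_(y < d.+1) \sum_(z < d.+1) \sum_(w < d.+1)
     c (x + y)%N * (mm t x y * mm t z w) * T x y z w.
  transitivity (\sum_(m < d.+1) \sum_(x < d.+1) \sum_(y < d.+1) (x + y == m)%N%:R *
     (c (x + y)%N * mm t x y * \sum_(z < d.+1) \sum_(w < d.+1) mm t z w * T x y z w)).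
    apply: eq_bigr => m _; rewrite (@Y_wide _ m d.+1) // mulr_sumr.
    apply: eq_bigr => x _; rewrite mulr_sumr; apply: eq_bigr => y _.
    have [/eqP xym|_] := boolP (x + y == m)%N; last by rewrite /= !mul0r mulr0.
    rewrite -xym.
    rewrite !mulr1n !mul1r -mulrA; congr (_ * (_ * _)).
    rewrite (@Y_wide _ _ d.+1); last by have := ltn_ord m; lia.
    apply: eq_bigr => z _; apply: eq_bigr => w _; rewrite /T.
    rewrite (_ : (z + w == d - (x + y))%N = (x + y + z + w == d)%N); first by ring.
    by apply/eqP/eqP; have := ltn_ord m; lia.
  rewrite exchange_big; apply: eq_bigr => x _.
  rewrite exchange_big; apply: eq_bigr => y _ /=.
  have [xy|xy] := leqP (x + y) d; last first.
    rewrite big1; last first.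
      by move=> m _; rewrite (_ : (_ == _) = false) ?mul0r //; apply/eqP; have := ltn_ord m; lia.
    rewrite big1 // => z _; rewrite big1 // => w _.
    by rewrite /T (_ : (_ == _) = false) ?mul0r ?mulr0 //; apply/eqP; lia.
  rewrite (@sum_ind _ d.+1 (x + y)%N (fun m => (x + y == m)%N%:R * _)) //; last first.
    by move=> m _ /negPf mxy; rewrite eq_sym mxy mul0r.
  rewrite eqxx mul1r mulr_sumr; apply: eq_bigr => z _; rewrite mulr_sumr; apply: eq_bigr => w _.
  by ring.
have T1 x y z w : T x z y w = - T x y z w.
  rewrite /T (_ : (x + z + y + w)%N = (x + y + z + w)%N); last by lia.
  by rewrite (alt_perm_swap14 y w x z s aG) mulrN.
have T2 x y z w : T x w z y = - T x y z w.
  rewrite /T (_ : (x + w + z + y)%N = (x + y + z + w)%N); last by lia.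
  by rewrite (alt_perm_swap24 z y x w s aG) mulrN.
have : 3 * \sum_(m < d.+1) c m * Y t m (Y t (d - m) G) s = 0.
  pose K x y z w := c (x + y)%N * (mm t x y * mm t z w) * T x y z w.
  have E1 := etrans E (quad_swap1 d.+1 K).
  have E2 := etrans E (quad_swap2 d.+1 K).
  move: E E1 E2; set S := LHS => E E1 E2.
  rewrite (_ : 3 * S = S + S + S); last by ring.
  rewrite [X in X + _ + _]E [X in _ + X + _]E1 [X in _ + X]E2 -!big_split /=.
  rewrite big1 // => x _; rewrite -!big_split /= big1 // => y _; rewrite -!big_split /= big1 // => z _.
  rewrite -!big_split /= big1 // => w _.
  rewrite /K (T1 x y z w) (T2 x y z w) /T /=; have [/eqP e|_] := boolP (x + y + z + w == d)%N; last by rewrite /= !(mul0r, oppr0, mulr0) !addr0.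
  by rewrite (hc _ _ _ _ e); ring.
by move/eqP; rewrite mulf_eq0 /= => /eqP.
Qed.

(** Only the window |2m - d| <= 3 remains, and there a weight isolates m together with d - m, which
    gives the same product because the factors commute. *)
Lemma YY_gap d G s : alt k G ->
  (forall m, (m <= d)%N -> (d + 3 < 2 * m)%N -> Y t m (Y t (d - m) G) s = 0) ->
  forall m, (m <= d)%N -> Y t m (Y t (d - m) G) s = 0.
Proof.
move=> aG far m md; pose V i := Y t i (Y t (d - i) G) s.
have VC i : (i <= d)%N -> V (d - i)%N = V i.
  by move=> id; rewrite /V (Y_comm _ _ _ _ aG) subKn.
rewrite -/(V m); have far' i : (i <= d)%N -> (2 * i + 3 < d)%N -> V i = 0.
  by move=> id i3; rewrite -VC //; apply: far; lia.
have [m1|m1] := ltnP (2 * m + 3) d; first exact: far'.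
have [m2|m2] := ltnP (d + 3) (2 * m); first exact: far.
have [c [hc cm cdm c0]] := adm4_weight t md m1 m2.
have c0' i : (i <= d)%N -> i != m -> i != (d - m)%N -> c i * V i = 0.
  move=> id im idm.
  have [i1|i1] := ltnP (2 * i + 3) d; first by rewrite far' ?mulr0.
  have [i2|i2] := ltnP (d + 3) (2 * i); first by rewrite /V far ?mulr0.
  by rewrite c0 ?mul0r.
have md1 : (m < d.+1)%N by [].
have := YY_weight s aG hc; rewrite (bigD1 (Ordinal md1)) //=.
have [e|ne] := eqVneq m (d - m)%N.
  rewrite big1 ?addr0; first by move/eqP; rewrite mulf_eq0 (negPf cm) => /eqP.
  move=> i im; rewrite -val_eqE /= in im; apply: c0' => //; last by rewrite -e.
  by have := ltn_ord i; lia.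
have dm1 : (d - m < d.+1)%N by lia.
rewrite (bigD1 (Ordinal dm1)) /=; last by rewrite -val_eqE /= eq_sym.
rewrite big1 ?addr0; last first.
  move=> i /andP[im idm]; rewrite -!val_eqE /= in im idm; apply: c0' => //.
  by have := ltn_ord i; lia.
rewrite -!/(V _) VC // cdm -mulr2n => /eqP.
by rewrite mulrn_eq0 /= mulf_eq0 (negPf cm) => /eqP.
Qed.
End Quad.

(** * Maximal words *)

(* A word is a product of the delta(e_m), m in [ms], with e_s. *)
Definition Phi (t : lie_kind) (F : seq nat -> rat) (ms : seq nat) : seq nat -> rat :=
  foldr (Y t) F ms.

(** The relations keep the sum of two indices, so this is why their remaining, more spread terms
    count as larger words. *)
Lemma two_pow_spread a b x y : (a + b = x + y)%N -> (maxn x y < maxn a b)%N ->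
  (2 ^ x + 2 ^ y < 2 ^ a + 2 ^ b)%N.
Proof.
move=> e h.
have key u v x' y' : (x' < u)%N -> (y' < u)%N -> (2 ^ x' + 2 ^ y' < 2 ^ u + 2 ^ v)%N.
  move=> xu yu; have : (2 ^ x' <= 2 ^ u.-1)%N by rewrite leq_exp2l //; lia.
  have : (2 ^ y' <= 2 ^ u.-1)%N by rewrite leq_exp2l //; lia.
  have : (2 ^ u = 2 * 2 ^ u.-1)%N by rewrite -expnS; congr (2 ^ _)%N; lia.
  have : (0 < 2 ^ v)%N by rewrite expn_gt0.
  lia.
have [ab|ab] := leqP a b; first by rewrite addnC [X in (_ < X)%N]addnC; apply: key; lia.
by apply: key; lia.
Qed.

Lemma code_le n s : all (fun x => x <= n)%N s -> (code s <= size s * 2 ^ n)%N.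
Proof.
elim: s => [|x s IH] /=; first by rewrite /code big_nil.
move=> /andP[xn sn]; rewrite code_cons mulSn; apply: leq_add; last exact: IH.
by rewrite leq_exp2l.
Qed.

Section Words.
Variables (t : lie_kind) (k : nat).
Implicit Types (F G : seq nat -> rat) (s ms : seq nat).

Lemma alt_Phi F ms : alt k F -> alt k (Phi t F ms).
Proof. by move=> aF; elim: ms => //= m ms; apply: alt_Y. Qed.

Lemma Phi_perm F ms ms' : alt k F -> perm_eq ms ms' -> Phi t F ms = Phi t F ms'.
Proof.
move=> aF.
have front m A B : Phi t F (A ++ m :: B) = Phi t F (m :: A ++ B).
  elim: A => //= x A ->; apply: functional_extensionality => s.
  by rewrite -/(Phi t F _) /= (Y_comm _ _ _ _ (alt_Phi _ aF)).
elim: ms ms' => [|m ms IH] ms' pe; first by move: pe; rewrite perm_sym => /perm_nilP ->.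
have mms' : m \in ms' by rewrite -(perm_mem pe) mem_head.
case/splitPr: mms' pe => A B pe; rewrite front /=; congr (Y t m _).
apply: IH; rewrite -(perm_cons m); apply: perm_trans pe _.
by rewrite -[m :: B]/([:: m] ++ B) perm_catCA.
Qed.

Lemma Y_nonzero m F s : Y t m F s != 0 -> exists x y, (x + y = m)%N /\ F [:: x, y & s] != 0.
Proof.
move=> h; apply: NNPP => n; move/negP: h; apply; rewrite /Y big1 // => x _; rewrite big1 // => y _.
have [/eqP e|_] := boolP (x + y == m)%N; last by rewrite /= !mul0r.
have [->|Fn] := eqVneq (F [:: (x : nat), (y : nat) & s]) 0; first by rewrite mulr0.
by exfalso; apply: n; exists x, y.
Qed.

Lemma Phi_bound F D ms s : (forall s, F s != 0 -> (size s <= D)%N /\ (sumn s <= D)%N) ->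
  Phi t F ms s != 0 -> (size s + 2 * size ms <= D)%N /\ (sumn s + sumn ms <= D)%N.
Proof.
move=> hF; elim: ms s => [|m ms IH] s /=; first by rewrite muln0 !addn0; apply: hF.
by move=> /Y_nonzero[x [y [<- /IH]]] /=; lia.
Qed.

Lemma perm_nz F s s' : alt k F -> perm_eq s s' -> F s != 0 -> F s' != 0.
Proof. by move=> aF /(alt_perm0 aF) ->. Qed.

Lemma leq_sumn x s : x \in s -> (x <= sumn s)%N.
Proof. by elim: s => //= y s IH; rewrite inE => /orP[/eqP->|/IH]; lia. Qed.

Section Maximal.
Variables (F : seq nat -> rat) (D : nat) (s ms : seq nat).
Hypothesis k0 : (0 < k)%N.
Hypothesis aF : alt k F.
Hypothesis hF : forall s, F s != 0 -> (size s <= D)%N /\ (sumn s <= D)%N.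
Hypothesis Wn : Phi t F ms s != 0.
Hypothesis jmax : forall ms' s', (size ms < size ms')%N -> Phi t F ms' s' = 0.
Hypothesis cmax : forall ms' s', size ms' = size ms -> Phi t F ms' s' != 0 ->
  (code s' + code ms' <= code s + code ms)%N.
Hypothesis smin : forall ms' s', size ms' = size ms -> Phi t F ms' s' != 0 ->
  (code s' + code ms' = code s + code ms)%N -> (sumn ms <= sumn ms')%N.

Let aP ms' := alt_Phi ms' aF.

Lemma word_perm s' ms' : perm_eq s s' -> perm_eq ms ms' -> Phi t F ms' s' != 0.
Proof. by move=> ps pm; rewrite -(Phi_perm aF pm); apply: perm_nz ps Wn. Qed.

Lemma word_zero s' ms' : size ms' = size ms -> (code s + code ms < code s' + code ms')%N ->
  Phi t F ms' s' = 0.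
Proof. by move=> sz h; apply/eqP; apply: contraTT h => n; rewrite -leqNgt; apply: cmax. Qed.

Lemma word_uniq : uniq s.
Proof. by apply: contraNT Wn => us; rewrite (alt_uniq (aP ms)). Qed.

(** Replacing e_x /\ e_y by delta(e_(x+y)) would give a word with one more mark, excluded by [jmax];
    the more spread pairs are excluded by [cmax]. *)
Lemma word_ee x y : x \in s -> y \in s -> (x < y)%N -> (x + 3 <= y)%N.
Proof.
move=> xs ys xy; rewrite leqNgt; apply/negP => yx.
have yr : y \in rem x s.
  by rewrite (rem_filter _ word_uniq) mem_filter ys andbT /=; lia.
have pe : perm_eq s [:: x, y & rem y (rem x s)].
  by rewrite (permPl (perm_to_rem xs)) perm_cons perm_to_rem.
move/negP: (word_perm pe (perm_refl ms)); apply; apply/eqP.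
apply: (@R1_pair t k x y (Phi t F ms) _ (aP ms) xy); [lia | |].
  by apply: (@jmax ((x + y)%N :: ms)).
move=> a b ab ax; apply: word_zero => //.
have := @two_pow_spread a b x y ab; rewrite (code_perm pe) !code_cons; lia.
Qed.

(** A letter and a mark at distance at most 2 lie in a window of three consecutive values around
    half their sum. Outside it the words have larger code, so the window relation makes the word
    itself vanish. *)
Lemma word_em x m : x \in s -> m \in ms -> (x + 3 <= m)%N || (m + 3 <= x)%N.
Proof.
move=> xs mm'; apply/negPn/negP => h.
have ps := perm_to_rem xs; have pm := perm_to_rem mm'.
move/negP: (word_perm ps pm); apply; apply/eqP => /=.
have kx : (0 < x)%N.
  apply: leq_trans k0 _; rewrite leqNgt; apply: contraNN Wn => xk.
  by rewrite (alt_low (aP ms)) //; apply/hasP; exists x.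
have far i : (i <= x + m)%N -> (maxn x m < maxn i (x + m - i))%N ->
    Phi t F ((x + m - i)%N :: rem m ms) (i :: rem x s) = 0.
  move=> ixm h'; apply: word_zero; first by rewrite /= size_rem //; case: (ms) mm'.
  have := @two_pow_spread i (x + m - i)%N x m; rewrite (code_perm ps) (code_perm pm) !code_cons.
  lia.
have r := @rel2_Y t k (x + m)%N _ (rem x s) (aP (rem m ms)).
rewrite [X in Y t X](_ : m = x + m - x)%N; last by lia.
apply: (@rel2_three t (x + m)%N _ ((x + m - 1) %/ 2)%N r); [lia | | lia].
by move=> i ixm ix; apply: far => //; lia.
Qed.

Lemma word_mm m ms' : perm_eq ms (m :: ms') -> forall m', m' \in ms' -> (m + 4 <= m')%N || (m' + 4 <= m)%N.
Proof.
move=> pm m' mm'; apply/negPn/negP => h.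
have pm' : perm_eq ms [:: m, m' & rem m' ms'].
  by rewrite (permPl pm) perm_cons perm_to_rem.
move/negP: (word_perm (perm_refl s) pm'); apply; apply/eqP => /=.
have sz := perm_size pm'.
have := @YY_gap t k (m + m')%N _ s (aP (rem m' ms')).
rewrite -/(Phi t F (rem m' ms')) => /(_ _ m); rewrite addKn; apply; last by lia.
move=> i im h'; apply: (@word_zero s [:: i, (m + m' - i)%N & rem m' ms']) => //.
have := @two_pow_spread i (m + m' - i)%N m m'; rewrite (code_perm pm') !code_cons.
lia.
Qed.

(** The exchange of [rel2_four] would move the mark from x + 3 to x. The word stays nonzero and
    keeps its code, but the sum of its marks drops, against [smin]. *)
Lemma word_shift x : x \in s -> (x + 3)%N \notin ms.
Proof.
move=> xs; apply/negP => mm'.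
have ps := perm_to_rem xs; have pm := perm_to_rem mm'.
have W' := word_perm ps pm.
have kx : (0 < x)%N.
  apply: leq_trans k0 _; rewrite leqNgt; apply: contraNN Wn => xk.
  by rewrite (alt_low (aP ms)) //; apply/hasP; exists x.
have sz : (size (rem (x + 3)%N ms)).+1 = size ms by rewrite size_rem //; case: (ms) mm'.
have far i : (i <= x + (x + 3))%N -> (maxn x (x + 3) < maxn i (x + (x + 3) - i))%N ->
    Phi t F ((x + (x + 3) - i)%N :: rem (x + 3)%N ms) (i :: rem x s) = 0.
  move=> ixm h'; apply: word_zero => //.
  have := @two_pow_spread i (x + (x + 3) - i)%N x (x + 3)%N; rewrite (code_perm ps) (code_perm pm) !code_cons.
  lia.
have r := @rel2_Y t k (x + (x + 3))%N _ (rem x s) (aP (rem (x + 3)%N ms)).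
have [||i ixm ix|v [v0]] := @rel2_four t (x + (x + 3))%N _ x r; [lia | lia | by apply: far; lia |].
rewrite addnK addKn => e.
have W2 : Phi t F (x :: rem (x + 3)%N ms) ((x + 3)%N :: rem x s) != 0.
  by rewrite /= e mulf_neq0 // ltr0_neq0.
have := smin _ W2; rewrite (code_perm ps) (code_perm pm) !code_cons (perm_sumn pm) /= sz.
by lia.
Qed.

Lemma word_low x : x \in s ++ ms -> (k <= x)%N.
Proof.
rewrite mem_cat leqNgt => /orP[xs|xm]; apply: contraNN Wn => xk.
  by rewrite (alt_low (aP ms)) //; apply/hasP; exists x.
by rewrite (Phi_perm aF (perm_to_rem xm)) /= (Y_low _ _ (aP _)) //; lia.
Qed.

End Maximal.
End Words.

(** * The distinguished partition of a maximal word *)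

Lemma runs3_head s x : x \in s ->
  x \in [seq head 0%N B | B <- runs3 s] \/ exists2 y, y \in s & x = (y + 3)%N.
Proof.
elim: s => //= z s IH; rewrite inE => /orP[/eqP->|xs].
  by left; case: (runs3 s) => [|[|y b] bs] /=; rewrite ?mem_head //; case: ifP; rewrite /= mem_head.
case: (IH xs) => [|[y ys ->]]; last by right; exists y => //; rewrite inE ys orbT.
have [_ al _] := runs3P s; case: (runs3 s) al => [|[|y b] bs] //= _.
rewrite inE => xb; case: ifP => /= yz; last by left; rewrite !inE xb orbT.
case/orP: xb => [/eqP->|xb]; last by left; rewrite inE xb orbT.
by right; exists z; rewrite ?mem_head //; exact/eqP.
Qed.

Definition gap3 (a b : nat) : bool := (a + 3 <= b)%N.

Lemma gap3_sort (s : seq nat) : uniq s ->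
  (forall x y, x \in s -> y \in s -> (x < y)%N -> (x + 3 <= y)%N) -> sorted gap3 (sort leq s).
Proof.
move=> us h; have : sorted ltn (sort leq s).
  by rewrite ltn_sorted_uniq_leq sort_uniq us (sort_sorted leq_total).
apply: (@sub_in_sorted _ [in s]) => [x y xs ys xy|]; first exact: h.
by apply/allP => x; rewrite mem_sort.
Qed.

Lemma gap3_nth s i j : sorted gap3 s -> (i + j < size s)%N ->
  (nth 0 s i + 3 * j <= nth 0 s (i + j))%N.
Proof.
move=> /(sortedP 0%N) h; elim: j => [|j IH] ij; first by rewrite muln0 !addn0.
have ij' : ((i + j).+1 < size s)%N by rewrite -addnS.
have := h _ ij'; have := IH (ltnW ij'); rewrite /gap3 (addnS i j); lia.
Qed.

(** Parts grow by at least 3, so the bound on the last part of the main part descends to the part in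
    position [size A]. *)
Lemma main_bound k A m B : main k (main_part k (A ++ m :: B)) -> nonsingular k (A ++ m :: B) ->
  (size A < main_size k (A ++ m :: B))%N ->
  (m <= 2 * k + 3 * size A)%N /\ (k \in A -> (m < 2 * k + 3 * size A)%N).
Proof.
set M := A ++ m :: B; set q := main_size k M => mM nM Aq.
have sM : sorted gap3 (main_part k M).
  by apply: take_sorted; case/andP: nM.
have qM : (q <= size M)%N.
  rewrite /q /main_size; apply/bigmax_leqP => i _; exact: (ltn_ord i).
have szI : size (main_part k M) = q by rewrite size_takel.
have qE : (size A + (q - (size A).+1) = q.-1)%N by lia.
have h : (m + 3 * (q - (size A).+1) <= nth 0%N (main_part k M) q.-1)%N.
  rewrite -qE; have e : m = nth 0%N (main_part k M) (size A).
    by rewrite nth_take // nth_cat ltnn subnn.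
  by rewrite {1}e; apply: gap3_nth => //; rewrite szI qE; lia.
have kmin x : x \in M -> (k <= x)%N.
  by case/andP: nM => /andP[/allP h' _] _; apply: h'.
have hM : forall x I', main_part k M = x :: I' -> x = head 0%N M.
  by move=> x I' e; rewrite -[M in RHS](cat_take_drop q) -/(main_part k M) e.
move: mM; rewrite /main; case e: (main_part k M) => [|x I'].
  by rewrite e /= in szI; lia.
have sI : size I' = q.-1 by rewrite -szI e.
have lE : last x I' = nth 0%N (main_part k M) q.-1 by rewrite e (last_nth 0%N) sI.
rewrite /= sI lE => /andP[_]; case: ifP => [xk|xk] hb; split.
- lia.
- by move=> _; lia.
- lia.
move=> kA; have : x != k by rewrite xk.
have -> : x = head 0%N M by apply: hM e.
have : (head 0 M <= k)%N.
  have sl : sorted leq M by case/andP: nM => /andP[].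
  have kM : k \in M by rewrite mem_cat kA.
  case: (M) sl kM => //= y M' /(order_path_min leq_trans)/allP pl.
  by rewrite inE => /orP[/eqP->|/pl].
have : (k <= head 0 M)%N by apply: kmin; rewrite /M; case: (A) => [|? ?] /=; rewrite mem_head.
by move=> h1 h2 /eqP; lia.
Qed.

Section Core.
Variables (t : lie_kind) (k : nat).
Hypothesis k0 : (0 < k)%N.
Implicit Types (F G : seq nat -> rat) (s ms : seq nat).

Definition maximal_word F s ms :=
  [/\ Phi t F ms s != 0,
      forall ms' s', (size ms < size ms')%N -> Phi t F ms' s' = 0,
      forall ms' s', size ms' = size ms -> Phi t F ms' s' != 0 ->
        (code s' + code ms' <= code s + code ms)%N &
      forall ms' s', size ms' = size ms -> Phi t F ms' s' != 0 ->
        (code s' + code ms' = code s + code ms)%N -> (sumn ms <= sumn ms')%N].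

(** Each mark stands for two letters with the same sum, so [D] bounds the letters and marks of every
    nonzero word and the extremal choices can be made. *)
Lemma maximal_word_exists F D : alt k F ->
  (forall s, F s != 0 -> (size s <= D)%N /\ (sumn s <= D)%N) ->
  (exists s, F s != 0) -> exists s ms, maximal_word F s ms.
Proof.
move=> aF hF [s0 Fs0].
have bnd := @Phi_bound t F D _ _ hF.
have [j [[s1 [ms1 [sz1 W1]]] jmax]] : exists j, (exists s ms, size ms = j /\ Phi t F ms s != 0) /\
    forall j', (exists s ms, size ms = j' /\ Phi t F ms s != 0) -> (j' <= j)%N.
  apply: (@exists_max (fun j => exists s ms, size ms = j /\ Phi t F ms s != 0) D).
    by exists 0%N, s0, [::].
  by move=> n [s [ms [<- /bnd[]]]]; lia.
have [c [[s2 [ms2 [sz2 W2 c2]]] cmax]] : exists c : nat, (exists s ms, [/\ size ms = j, Phi t F ms s != 0 & (code s + code ms = c)%N]) /\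
    forall c', (exists s ms, [/\ size ms = j, Phi t F ms s != 0 & (code s + code ms = c')%N]) -> (c' <= c)%N.
  apply: (@exists_max (fun c : nat => exists s ms, [/\ size ms = j, Phi t F ms s != 0 & (code s + code ms = c)%N]) (D * 2 ^ D + D * 2 ^ D)).
    by exists (code s1 + code ms1)%N, s1, ms1.
  move=> n [s [ms [_ /bnd[b1 b2] <-]]].
  have le s' : (size s' <= D)%N -> (sumn s' <= D)%N -> (code s' <= D * 2 ^ D)%N.
    move=> z1 z2; apply: leq_trans (@code_le D s' _) _; last by rewrite leq_mul2r z1 orbT.
    by apply/allP => x /leq_sumn xs; apply: leq_trans xs z2.
  by apply: leq_add; apply: le; lia.
have [m [[s3 [ms3 [sz3 W3 c3 m3]]] mmin]] :
    exists m : nat, (exists s ms, [/\ size ms = j, Phi t F ms s != 0, (code s + code ms = c)%N & sumn ms = m]) /\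
    forall m', (exists s ms, [/\ size ms = j, Phi t F ms s != 0, (code s + code ms = c)%N & sumn ms = m']) -> (m <= m')%N.
  apply: (@exists_min (fun m : nat => exists s ms, [/\ size ms = j, Phi t F ms s != 0, (code s + code ms = c)%N & sumn ms = m])).
  by exists (sumn ms2), s2, ms2.
exists s3, ms3; split=> //; rewrite ?c3 ?m3 ?sz3.
- move=> ms' s' h; apply/eqP; apply: contraTT h => W'; rewrite -leqNgt.
  by apply: jmax; exists s', ms'.
- by move=> ms' s' sz' W'; apply: cmax; exists s', ms'.
- by move=> ms' s' sz' W' c'; apply: mmin; exists s', ms'.
Qed.

Section Max.
Variables (F : seq nat -> rat) (D : nat) (s ms : seq nat).
Hypothesis aF : alt k F.
Hypothesis hF : forall s, F s != 0 -> (size s <= D)%N /\ (sumn s <= D)%N.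
Hypothesis wmax : maximal_word F s ms.

Let Wn : Phi t F ms s != 0. Proof. by case: wmax. Qed.
Let jmax : forall ms' s', (size ms < size ms')%N -> Phi t F ms' s' = 0. Proof. by case: wmax. Qed.
Let cmax : forall ms' s', size ms' = size ms -> Phi t F ms' s' != 0 ->
        (code s' + code ms' <= code s + code ms)%N. Proof. by case: wmax. Qed.
Let smin : forall ms' s', size ms' = size ms -> Phi t F ms' s' != 0 ->
        (code s' + code ms' = code s + code ms)%N -> (sumn ms <= sumn ms')%N. Proof. by case: wmax. Qed.

Let us : uniq s := word_uniq aF Wn.
Let M := sort leq (s ++ ms).

Lemma max_marks_uniq : uniq ms.
Proof.
have h := word_mm k0 aF Wn cmax.
have aux ms1 ms2 : perm_eq ms (ms1 ++ ms2) -> uniq ms2.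
  elim: ms2 ms1 => //= m ms2 IH ms1 pe; apply/andP; split; last first.
    by apply: (IH (rcons ms1 m)); rewrite cat_rcons.
  apply/negP => m2; have pe' : perm_eq ms (m :: ms1 ++ ms2).
    by rewrite (permPl pe) -[m :: ms2]/([:: m] ++ ms2) perm_catCA.
  have := h m (ms1 ++ ms2) pe' m; rewrite mem_cat m2 orbT => /(_ isT); lia.
exact: (aux [::]).
Qed.

Lemma max_uniq : uniq (s ++ ms).
Proof.
rewrite cat_uniq us max_marks_uniq andbT /=; apply/hasPn => m mm' /=.
by apply/negP => xs; have := word_em k0 aF Wn cmax xs mm'; lia.
Qed.

Lemma max_gap x y : x \in s ++ ms -> y \in s ++ ms -> (x < y)%N -> (x + 3 <= y)%N.
Proof.
rewrite !mem_cat => /orP[xs|xm] /orP[ys|ym] xy.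
- exact: (word_ee k0 aF Wn jmax cmax).
- by have := word_em k0 aF Wn cmax xs ym; lia.
- by have := word_em k0 aF Wn cmax ys xm; lia.
- have yr : y \in rem x ms by rewrite (rem_filter _ max_marks_uniq) mem_filter ym andbT /=; lia.
  by have := word_mm k0 aF Wn cmax (perm_to_rem xm) yr; lia.
Qed.

Lemma max_nonsingular : nonsingular k M.
Proof.
rewrite /nonsingular /kpartition (sort_sorted leq_total) andbT.
have -> : sorted (fun a b => (a + 3 <= b)%N) M by apply: gap3_sort; [exact: max_uniq | exact: max_gap].
by rewrite andbT; apply/allP => x; rewrite mem_sort; apply: (word_low k0 aF Wn).
Qed.

Lemma mem_take_lt (I : seq nat) q m x : sorted ltn I -> x \in I -> (x < m)%N -> m \in take q I -> x \in take q I.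
Proof.
move=> sI xI xm mI; move: xI; rewrite -{1}(cat_take_drop q I) mem_cat => /orP[//|xd].
move: sI; rewrite -{1}(cat_take_drop q I) (sorted_pairwise ltn_trans) pairwise_cat.
case/andP => /allrelP h _; have := h m x mI xd; lia.
Qed.

(** It suffices to treat the smallest mark m1, because the main part is an initial segment. If m1
    lay in it, the p letters below m1 would give m1 <= 2k + 3p, strictly if k is among them;
    [boundary_letter] contradicts this. *)
Lemma max_not_main m : m \in ms -> m \notin main_part k M.
Proof.
move=> mm0; apply/negP => mI0.
have sM : sorted ltn M.
  by rewrite ltn_sorted_uniq_leq sort_uniq max_uniq (sort_sorted leq_total).
have [m1 [m1m m1min]] : exists m1, m1 \in ms /\ forall m', m' \in ms -> (m1 <= m')%N.
  by apply: (@exists_min (fun m => m \in ms)); exists m.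
have m1I : m1 \in main_part k M.
  have := m1min _ mm0; rewrite leq_eqVlt => /orP[/eqP-> //|lt].
  by apply: (mem_take_lt sM _ lt mI0); rewrite mem_sort mem_cat m1m orbT.
pose sL := [seq x <- s | (x < m1)%N]; pose sH := [seq x <- s | ~~ (x < m1)%N].
have ps : perm_eq s (sL ++ sH) by rewrite perm_sym; apply/permPl; apply: perm_filterC.
have pm := perm_to_rem m1m.
have W1 := word_perm aF Wn ps pm.
have m1s : m1 \notin s.
  by apply/negP => xs; have := word_em k0 aF Wn cmax xs m1m; lia.
have szs : forall A B, M = A ++ m1 :: B -> size A = size sL /\ {subset sL <= A}.
  move=> A B eM.
  have := sM; rewrite eM (sorted_pairwise ltn_trans) pairwise_cat allrel_consr /=.
  case/and3P => /andP[/allP Am _] _ /andP[/allP Bm _].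
  have AE : [seq x <- M | (x < m1)%N] = A.
    rewrite eM filter_cat /= ltnn.
    have /all_filterP -> : all (fun x => x < m1)%N A by apply/allP.
    suff -> : [seq x <- B | (x < m1)%N] = [::] by rewrite cats0.
    by apply/eqP; rewrite -(negbK (_ == _)) -has_filter; apply/hasPn => x /Bm; rewrite -leqNgt; apply: ltnW.
  have pA : perm_eq A sL.
    rewrite -AE /sL; apply: (@perm_trans _ [seq x <- s ++ ms | (x < m1)%N]).
      by apply: perm_filter; rewrite perm_sort.
    rewrite filter_cat (_ : [seq x <- ms | (x < m1)%N] = [::]) ?cats0 //.
    by apply/eqP; rewrite -(negbK (_ == _)) -has_filter; apply/hasPn => x /m1min; rewrite -leqNgt.
  by split; [exact: perm_size | move=> x; rewrite (perm_mem pA)].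
have bound : (m1 <= 2 * k + 3 * size sL)%N /\ (k \in sL -> (m1 < 2 * k + 3 * size sL)%N).
  have m1M : m1 \in M by rewrite mem_sort mem_cat m1m orbT.
  have nM := max_nonsingular; have mM := main_sizeP k M.
  have uM : uniq M by rewrite sort_uniq max_uniq.
  case/splitPr: {-1}M / m1M (erefl M) => A B eM.
  have [<- sub] := szs A B eM.
  have [b1 b2] : (m1 <= 2 * k + 3 * size A)%N /\ (k \in A -> (m1 < 2 * k + 3 * size A)%N).
    apply: (@main_bound k A m1 B); rewrite -eM //.
    move: m1I uM; rewrite /main_part {1 3}eM cat_uniq => m1I /and3P[_ /= /norP[m1A _] _].
    rewrite eM ltnNge; apply/negP => qA; move: m1I; rewrite eM takel_cat // => /mem_take.
    by rewrite (negPf m1A).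
  by split=> // /sub; apply: b2.
(* All other marks and all letters that are not below m1 are frozen; the variable part is the word
   of letters below m1. *)
pose G s1 := Phi t F (rem m1 ms) (s1 ++ sH).
have szm : (size (rem m1 ms)).+1 = size ms by rewrite size_rem //; case: (ms) m1m.
have YG m' s1 : Y t m' G s1 = Phi t F (m' :: rem m1 ms) (s1 ++ sH) by [].
have lt_top s1 m' : Y t m' G s1 != 0 -> (code s1 + 2 ^ m' <= code sL + 2 ^ m1)%N.
  rewrite YG => W'; have := cmax _ W'; rewrite /= => /(_ szm).
  by rewrite (code_perm ps) (code_perm pm) !code_cat !code_cons; clear; lia.
have codeL : (code sL < 2 ^ m1)%N.
  by apply: code_lt; [rewrite filter_uniq | apply: filter_all].
(* The letters below m1 have total code less than 2^m1, so a mark beyond m1 would exceed the maximal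
   code. *)
have le_top s1 m' : Y t m' G s1 != 0 -> (m' <= m1)%N.
  move=> /lt_top h; rewrite -ltnS -(@ltn_exp2l 2) // expnS; move: h codeL; clear; lia.
have [] := @boundary_letter t k (size sL) G D.+1 k0 (alt_catr _ (alt_Phi t _ aF)).
- by move=> n m' s1; apply: (@jmax (n :: m' :: rem m1 ms)); rewrite /= -szm.
- move=> m' s1 _ /hasP[x xs Dx]; apply/eqP; apply: contraTT Dx => W'.
  rewrite -ltnNge ltnS; have [_] := @Phi_bound t F D (m' :: rem m1 ms) (s1 ++ sH) hF W'; rewrite sumn_cat.
  by move: (leq_sumn xs); clear; lia.
- move=> m' s1 _ hm'; apply/eqP; apply: contraTT hm' => W'.
  by rewrite -leqNgt; apply: leq_trans (le_top _ _ W') _; case: bound.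
- by exists m1, sL; split=> //; rewrite YG.
move=> _ _ [s2 [sz2 W2]] kin.
have m1E : m1 = (2 * k + 3 * size sL)%N.
  by apply/eqP; rewrite eqn_leq (le_top _ _ W2) andbT; case: bound.
have kL : k \in sL.
  apply: kin => //; rewrite -m1E ?YG //.
  by move=> s' _ /lt_top; clear; lia.
by case: bound => _ /(_ kL); rewrite -m1E ltnn.
Qed.

(** A mark m that does not start its block is preceded by m - 3. A letter there contradicts
    [word_shift], a mark there contradicts [word_mm]. *)
Lemma max_leading : {subset ms <= leading k M}.
Proof.
move=> m mm0; have mM : m \in M by rewrite mem_sort mem_cat mm0 orbT.
have : m \in drop (main_size k M) M.
  have := max_not_main mm0; rewrite /main_part; move: mM.
  by rewrite -{1}(cat_take_drop (main_size k M) M) mem_cat => /orP[->|].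
move=> /runs3_head[//|[y yd mE]].
have : y \in s ++ ms by rewrite -(mem_sort leq); apply: mem_drop yd.
rewrite mem_cat => /orP[ys|ym].
  by have := word_shift k0 aF Wn cmax smin ys; rewrite -mE mm0.
have yr : y \in rem m ms.
  by rewrite (rem_filter _ max_marks_uniq) mem_filter ym andbT /=; lia.
by have := word_mm k0 aF Wn cmax (perm_to_rem mm0) yr; lia.
Qed.
End Max.
End Core.

(** * Xi-monomials span the chains *)

(* Up to a power of 2 this is <f, e_A /\ xi_(B_1) /\ ... /\ xi_(B_m)>. *)
Fixpoint pairing (t : lie_kind) (J : pred nat) (F : seq nat -> rat) (A : seq nat) (bs : seq (seq nat)) : rat :=
  if bs is B :: bs' then
    if J (head 0%N B) then
      \sum_(r < size B) (-1) ^+ r *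
        pairing t J (Y t (nth 0%N B r) F) (A ++ take r B ++ drop r.+1 B) bs'
    else pairing t J F (A ++ B) bs'
  else F A.

Definition unmarked (J : pred nat) (bs : seq (seq nat)) : seq nat :=
  flatten [seq (if J (head 0%N B) then behead B else B) | B <- bs].

Definition marked (J : pred nat) (bs : seq (seq nat)) : seq nat :=
  [seq head 0%N B | B <- bs & J (head 0%N B)].

Definition step3 (a b : nat) : bool := (b == a + 3)%N.

Section Pairing.
Variables (t : lie_kind) (k : nat) (J : pred nat).
Hypothesis k0 : (0 < k)%N.

Lemma step3_nth B r : sorted step3 B -> (r.+1 < size B)%N -> nth 0%N B r.+1 = (nth 0%N B r + 3)%N.
Proof. by move=> /(sortedP 0%N) h /h /eqP. Qed.

Lemma code_block (B : seq nat) r : (r < size B)%N ->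
  code B = (code (take r B ++ drop r.+1 B) + 2 ^ nth 0%N B r)%N.
Proof.
move=> rB; rewrite -{1}(cat_take_drop r B) (drop_nth 0%N rB) !code_cat code_cons; lia.
Qed.

(* Exchanging consecutive letters b, b + 3 between the marked and the unmarked
   part multiplies the pairing by a negative factor, which the sign of the
   antiderivation compensates; hence all terms of the expansion agree in sign. *)
Lemma pairing_pos bs F A : alt k F ->
  all (fun B => (B != [::]) && sorted step3 B) bs -> all (leq 1) (flatten bs) ->
  (forall s' ms', size ms' = size (marked J bs) -> Phi t F ms' s' != 0 ->
     (code s' + code ms' <= code (A ++ flatten bs))%N) ->
  Phi t F (marked J bs) (A ++ unmarked J bs) != 0 ->
  0 < pairing t J F A bs * Phi t F (marked J bs) (A ++ unmarked J bs).
Proof.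
elim: bs F A => [|B bs IH] F A aF /=.
  by move=> _ _ _; rewrite cats0 => h; rewrite -expr2 exprn_even_gt0.
move=> /andP[/andP[B0 B3] bs3] pos; rewrite /marked /unmarked /=.
have posbs : all (leq 1) (flatten bs) by move: pos; rewrite all_cat => /andP[].
case: ifP => JB /= cmax W; last first.
  rewrite -/(unmarked J bs) catA in W *; apply: IH => //.
  by move=> s' ms' sz W'; rewrite -catA; apply: cmax.
rewrite -/(marked J bs) -/(unmarked J bs) in cmax W *.
pose z r := Phi t F (nth 0%N B r :: marked J bs) (A ++ (take r B ++ drop r.+1 B) ++ unmarked J bs).
have W0 : Phi t F (head 0%N B :: marked J bs) (A ++ behead B ++ unmarked J bs) = z 0%N.
  by rewrite /z take0 drop1 nth0.
rewrite -[Y _ _ _ _]/(Phi t F (head 0%N B :: marked J bs) _) W0.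
have z0 : z 0%N != 0 by rewrite -W0.
(* Passing from z r to z (r + 1) moves the mark from b to b + 3 within the block, at the price of
   the negative factor of [rel2_four]; the signs from moving the letter to the front agree. *)
have zS r : (r.+1 < size B)%N -> exists v : rat, v < 0 /\ z r = v * z r.+1.
  move=> rB; pose b := nth 0%N B r.
  pose L := A ++ take r B; pose R := drop r.+2 B ++ unmarked J bs.
  have rB' : (r < size B)%N by apply: ltnW.
  have bS : nth 0%N B r.+1 = (b + 3)%N by apply: step3_nth.
  have zr : z r = (-1) ^+ size L * Phi t F (b :: marked J bs) ((b + 3)%N :: L ++ R).
    rewrite /z (drop_nth 0%N rB) bS -!catA catA -/L cat_cons.
    by rewrite (alt_front _ _ _ (alt_Phi t _ aF)) /L -!catA.
  have zr1 : z r.+1 = (-1) ^+ size L * Phi t F ((b + 3)%N :: marked J bs) (b :: L ++ R).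
    rewrite /z (take_nth 0%N rB') bS -cats1 -!catA catA -/L -/b cat1s.
    by rewrite (alt_front _ _ _ (alt_Phi t _ aF)) /L -!catA.
  have b0 : (0 < b)%N.
    by apply: (allP pos); rewrite mem_cat mem_nth.
  have r2 := @rel2_Y t k (b + (b + 3))%N _ (L ++ R) (alt_Phi t (marked J bs) aF).
  have far i : (i <= b + (b + 3))%N -> (maxn b (b + 3) < maxn i (b + (b + 3) - i))%N ->
      Y t (b + (b + 3) - i) (Phi t F (marked J bs)) (i :: L ++ R) = 0.
    move=> id h'; apply/eqP; apply: contraTT h' => W'; rewrite -leqNgt leqNgt; apply/negP => h'.
    have cB : code B = (code (take r B) + 2 ^ b + 2 ^ (b + 3) + code (drop r.+2 B))%N.
      by rewrite -{1}(cat_take_drop r B) (drop_nth 0%N rB') (drop_nth 0%N rB) bS !code_cat !code_cons -/b !addnA.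
    have cU : (code (marked J bs) + code (unmarked J bs) = code (flatten bs))%N.
      rewrite /marked /unmarked; elim: (bs) bs3 => [|C cs IHc] /=; first by rewrite /code !big_nil.
      move=> /andP[/andP[C0 _] cs3]; rewrite !code_cat -(IHc cs3).
      case: ifP => _ /=; last by lia.
      by case: C C0 => // c C _ /=; rewrite !code_cons; lia.
    have e1 : (i + (b + (b + 3) - i) = b + (b + 3))%N by lia.
    have lt := two_pow_spread e1 h'.
    have := cmax (i :: L ++ R) ((b + (b + 3) - i)%N :: marked J bs) erefl W'.
    rewrite !code_cons !code_cat cB -cU; move: lt.
    by move: (2 ^ i)%N (2 ^ b)%N (2 ^ (b + 3))%N (2 ^ (b + (b + 3) - i))%N => *; lia.
  have [||i id ib|v [v0]] := @rel2_four t (b + (b + 3))%N _ b r2; [lia | lia | by apply: far; lia | ].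
  rewrite addnK addKn => e; exists v; split=> //.
  by rewrite zr zr1 /= e; ring.
have zsgn r : (r < size B)%N -> 0 < (-1) ^+ r * z r * z 0%N.
  elim: r => [|r IHr] rB; first by rewrite expr0 mul1r -expr2 exprn_even_gt0.
  have [v [v0 e]] := zS r rB; have := IHr (ltnW rB); rewrite e exprS mulN1r.
  move: ((-1) ^+ r : rat) => c; rewrite (_ : c * _ * _ = (- v) * (- c * z r.+1 * z 0%N)); last by ring.
  by rewrite pmulr_rgt0 // oppr_gt0.
have IHz (r : 'I_(size B)) : 0 < pairing t J (Y t (nth 0%N B r) F) (A ++ take r B ++ drop r.+1 B) bs * z r.
  have phiE ms' : Phi t (Y t (nth 0%N B r) F) ms' = Phi t F (nth 0%N B r :: ms').
    rewrite -(@Phi_perm t k F (rcons ms' (nth 0%N B r))) ?perm_rcons //.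
    by rewrite /Phi foldr_rcons.
  have zr0 : z r != 0.
    by have := zsgn r (ltn_ord r); apply: contraTneq => ->; rewrite mulr0 mul0r ltxx.
  pose A' := A ++ take r B ++ drop r.+1 B.
  have zE : z r = Phi t (Y t (nth 0%N B r) F) (marked J bs) (A' ++ unmarked J bs).
    by rewrite phiE /z /A' -!catA.
  rewrite zE -/A'; apply: IH => //; first exact: alt_Y.
    move=> s' ms' sz; rewrite phiE => W'.
    have := cmax s' (nth 0%N B r :: ms'); rewrite /= sz => /(_ erefl W').
    rewrite /A' !code_cat (code_block (ltn_ord r)) code_cons !code_cat. move: (2 ^ nth 0 B r)%N (code s') (code ms') (code A) (code (take r B)) (code (drop r.+1 B)) (code (flatten bs)); clear; by move=> *; lia.
  by rewrite -zE.
rewrite mulr_suml; case: (B) B0 z0 zsgn IHz => // b B' _ z0 zsgn IHz.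
(* The term r = 0 is strictly positive and the others are nonnegative: the sign of the r-th pairing
   is that of z r, and (-1)^r z r has the sign of z 0. *)
apply: (@lt_le_trans _ _ ((-1) ^+ (ord0 : 'I_(size (b :: B'))) * pairing t J (Y t (nth 0%N (b :: B') 0) F) (A ++ take 0 (b :: B') ++ drop 1 (b :: B')) bs * z 0%N)).
  by rewrite expr0 mul1r; apply: (IHz ord0).
rewrite (bigD1 ord0) //= lerDl sumr_ge0 // => r _; apply: ltW.
have h1 := zsgn r (ltn_ord r); have h2 := IHz r.
have zr0 : z r != 0 by apply: contraTneq h1 => ->; rewrite mulr0 mul0r ltxx.
have : 0 < (z r ^+ 2)^-1 by rewrite invr_gt0 exprn_even_gt0.
move=> h3; have := mulr_gt0 (mulr_gt0 h1 h2) h3.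
move: (pairing _ _ _ _ _) ((-1) ^+ r : rat) => P c.
by have -> : c * z r * z 0%N * (P * z r) / z r ^+ 2 = c * P * z 0%N by field.
Qed.
End Pairing.

Lemma filter_heads (J : pred nat) (bs : seq (seq nat)) :
  all (fun B => B != [::]) bs -> uniq (flatten bs) ->
  (forall x, x \in flatten bs -> J x -> x \in [seq head 0%N B | B <- bs]) ->
  [seq x <- flatten bs | ~~ J x] = unmarked J bs /\ [seq x <- flatten bs | J x] = marked J bs.
Proof.
elim: bs => //= -[//|b B] bs IH /= bs0; rewrite mem_cat cat_uniq negb_or.
move=> /andP[/andP[bB bfl] /and3P[uB /hasPn dis ubs]] Jh.
have dis' x : x \in B -> x \notin flatten bs.
  by move=> xB; apply/negP => /dis /=; rewrite xB.
have headin (cs : seq (seq nat)) x : all (fun B => B != [::]) cs -> x \in [seq head 0%N B | B <- cs] -> x \in flatten cs.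
  elim: cs => //= -[//|c C] cs IHc /= cs0; rewrite !inE mem_cat => /orP[->//|/(IHc cs0) ->].
  by rewrite !orbT.
have JB x : x \in B -> J x = false.
  move=> xB; apply/negP => Jx; have := Jh x; rewrite !inE mem_cat xB orbT /= => /(_ isT Jx).
  by case/orP => [/eqP e|/(headin _ _ bs0)]; [rewrite -e xB in bB | apply/negP; exact: dis'].
have [] := IH bs0 ubs.
  move=> x xbs Jx; have := Jh x; rewrite !inE mem_cat xbs !orbT => /(_ isT Jx) /orP[/eqP e|//].
  by rewrite -e xbs in bfl.
rewrite !filter_cat /unmarked /marked /= => -> ->.
have -> : [seq x <- B | ~~ J x] = B.
  by apply/all_filterP/allP => x /JB ->.
have -> : [seq x <- B | J x] = [::].
  by apply/eqP; rewrite -(negbK (_ == _)) -has_filter; apply/hasPn => x /JB ->.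
by case: (J b).
Qed.

Lemma pairing_nonzero t k F D : (0 < k)%N -> alt k F ->
  (forall s, F s != 0 -> (size s <= D)%N /\ (sumn s <= D)%N) ->
  (exists s, F s != 0) ->
  exists p : seq nat * {fset nat}, distinguished k p /\
    pairing t [in p.2] F (main_part k p.1) (blocks k p.1) != 0.
Proof.
move=> k0 aF hF Fn; have [s [ms wmax]] := maximal_word_exists t k0 aF hF Fn.
have nM := max_nonsingular k0 aF wmax; have uM := max_uniq k0 aF wmax.
have lM := max_leading k0 aF hF wmax; have mI0 := max_not_main k0 aF hF wmax.
set M := sort leq (s ++ ms) in nM lM mI0.
pose J := [fset m in ms]%fset.
have JE m : (m \in J) = (m \in ms) by rewrite !inE.
exists (M, J); split.
  rewrite /distinguished nM /=; apply/fsubsetP => m; rewrite JE => /lM.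
  by rewrite !inE.
have [mI dI catM] := normal_formP k0 nM.
have [fl al _] := runs3P (drop (main_size k M) M).
rewrite -/(blocks k M) in fl al.
have ubl : uniq (flatten (blocks k M)).
  by rewrite fl; apply: drop_uniq; rewrite sort_uniq.
have [] := @filter_heads [in J] (blocks k M) _ ubl.
- by apply: sub_all al => B /andP[].
- by move=> x _; rewrite /= JE => /lM.
move=> eU eH.
have pM : perm_eq M (s ++ ms) by rewrite perm_sort.
have mI' : all (fun x => x \notin J) (main_part k M).
  by apply/allP => x xI; rewrite JE; apply: contraL xI => /mI0.
have JI : [seq x <- main_part k M | x \in J] = [::].
  by apply/eqP; rewrite -(negbK (_ == _)) -has_filter; apply/hasPn => x /(allP mI').
have dsm x : x \in s -> x \notin ms.
  by move: uM; rewrite cat_uniq => /and3P[_ /hasPn h _] xs; apply/negP => /h; rewrite /= xs.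
have ps : perm_eq (main_part k M ++ unmarked [in J] (blocks k M)) s.
  rewrite -eU; have /all_filterP <- := mI'; rewrite -filter_cat catM.
  rewrite (permPl (perm_filter _ pM)) filter_cat.
  have /all_filterP -> : all (fun x => x \notin J) s by apply/allP => x /dsm; rewrite JE.
  rewrite (_ : [seq x <- ms | x \notin J] = [::]) ?cats0 //.
  by apply/eqP; rewrite -(negbK (_ == _)) -has_filter; apply/hasPn => x xm; rewrite JE xm.
have pm : perm_eq (marked [in J] (blocks k M)) ms.
  rewrite -eH -[X in perm_eq X _]/([::] ++ _) -{1}JI -filter_cat catM.
  rewrite (permPl (perm_filter _ pM)) filter_cat.
  have /all_filterP -> : all (fun x => x \in J) ms by apply/allP => x xm; rewrite JE.
  rewrite (_ : [seq x <- s | x \in J] = [::]) //.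
  by apply/eqP; rewrite -(negbK (_ == _)) -has_filter; apply/hasPn => x /dsm; rewrite JE.
case: wmax => Wn jmax cmax _.
have W' : Phi t F (marked [in J] (blocks k M)) (main_part k M ++ unmarked [in J] (blocks k M)) != 0.
  rewrite (@Phi_perm t k F _ ms) //.
  by rewrite (alt_perm0 (alt_Phi t ms aF) ps).
have pos : all (leq 1) (flatten (blocks k M)).
  apply/allP => x; rewrite fl => /mem_drop; rewrite mem_sort => /(word_low k0 aF Wn).
  exact: leq_trans.
have : 0 < pairing t [in J] F (main_part k M) (blocks k M) *
    Phi t F (marked [in J] (blocks k M)) (main_part k M ++ unmarked [in J] (blocks k M)).
  apply: (pairing_pos k0 aF al pos _ W').
  move=> s' ms' sz W2; rewrite catM (code_perm pM) code_cat; apply: cmax => //.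
  by rewrite sz (perm_size pm).
by apply: contraTneq => ->; rewrite mul0r ltxx.
Qed.

(** * Chains and their coefficient functions *)

Section Chains.
Variable k : nat.
Implicit Types (x y z : chain k) (s : seq nat) (f : seq nat -> chain k).

Lemma linear_extension_wide f x (D : {fset strict_part k}) : (msupp x `<=` D)%fset ->
  linear_extension f x = \sum_(I <- D) x@_I *: f (sval I).
Proof.
move=> xD; rewrite /linear_extension (big_fset_incl _ xD) // => I _ /mcoeff_outdom ->.
by rewrite scale0r.
Qed.

Lemma linear_extensionP f a x y :
  linear_extension f (a *: x + y) = a *: linear_extension f x + linear_extension f y.
Proof.
pose D := (msupp x `|` msupp y)%fset.
have xD : (msupp x `<=` D)%fset by apply: fsubsetUl.
have yD : (msupp y `<=` D)%fset by apply: fsubsetUr.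
have zD : (msupp (a *: x + y) `<=` D)%fset.
  apply: fsubset_trans (msuppD_le _ _) _; apply: fsetSU; exact: msuppZ_le.
rewrite (linear_extension_wide _ xD) (linear_extension_wide _ yD) (linear_extension_wide _ zD).
rewrite scaler_sumr -big_split /=; apply: eq_bigr => I _.
by rewrite mcoeffD mcoeffZ scalerDl scalerA.
Qed.

HB.instance Definition _ f := GRing.isLinear.Build rat (chain k) (chain k) *:%R
  (linear_extension f) (linear_extensionP f).

Lemma linear_extensionU f c (K : strict_part k) :
  linear_extension f << c *g K >> = c *: f (sval K).
Proof.
by rewrite (linear_extension_wide _ (msuppU_le)) big_seq_fset1 mcoeffUU.
Qed.

Lemma eq_linear_extension f g x : (forall I, strict k I -> f I = g I) ->
  linear_extension f x = linear_extension g x.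
Proof. by move=> fg; apply: eq_bigr => I _; rewrite fg // (valP I). Qed.

Lemma inner_wide x y (D : {fset strict_part k}) : (msupp x `<=` D)%fset ->
  inner x y = \sum_(I <- D) x@_I * y@_I.
Proof.
move=> xD; rewrite /inner (big_fset_incl _ xD) // => I _ /mcoeff_outdom ->.
by rewrite mul0r.
Qed.

Lemma innerC x y : inner x y = inner y x.
Proof.
rewrite (inner_wide _ (fsubsetUl _ (msupp y))) (inner_wide _ (fsubsetUr (msupp x) _)).
by apply: eq_bigr => I _; rewrite mulrC.
Qed.

Lemma inner_is_linear x : linear_for *%R (inner x).
Proof.
move=> a y z; rewrite /inner mulr_sumr -big_split /=; apply: eq_bigr => I _.
by rewrite mcoeffD mcoeffZ mulrDr mulrCA.
Qed.

HB.instance Definition _ x := GRing.isLinear.Build rat (chain k) rat *%R (inner x) (inner_is_linear x).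

Lemma innerPl a x y z : inner (a *: x + y) z = a * inner x z + inner y z.
Proof. by rewrite innerC linearP /= innerC [inner z y]innerC. Qed.

Lemma inner0l z : inner 0 z = 0. Proof. by rewrite innerC linear0. Qed.
Lemma innerBl x y z : inner (x - y) z = inner x z - inner y z.
Proof. by rewrite addrC -scaleN1r innerPl mulN1r addrC. Qed.
Lemma innerZl a x z : inner (a *: x) z = a * inner x z.
Proof. by rewrite -[_ *: _]addr0 innerPl inner0l addr0. Qed.
Lemma inner_suml (T : Type) (r : seq T) (P : pred T) (F : T -> chain k) z :
  inner (\sum_(i <- r | P i) F i) z = \sum_(i <- r | P i) inner (F i) z.
Proof. by rewrite innerC linear_sum; apply: eq_bigr => i _; rewrite innerC. Qed.

Lemma innerU x c (K : strict_part k) : inner x << c *g K >> = x@_K * c.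
Proof.
rewrite innerC (inner_wide _ (msuppU_le)) big_seq_fset1 mcoeffUU; exact: mulrC.
Qed.

Lemma inner_eq0 x : inner x x = 0 -> x = 0.
Proof.
move=> h; apply/malgP => K; rewrite mcoeff0; case: msuppP => // Kx.
move/eqP: h; rewrite /inner psumr_eq0 => [|I _]; last by rewrite -expr2 sqr_ge0.
by move=> /allP /(_ K Kx) /=; rewrite mulf_eq0 orbb => /eqP.
Qed.

Lemma inversions_cons a s : inversions (a :: s) = (count (fun b => b < a) s + inversions s)%N.
Proof.
rewrite /inversions /= big_nat_recl // big_nil add0n.
under eq_bigr do rewrite big_nat_recl //=.
rewrite big_split /=; congr (_ + _)%N.
rewrite -sum1_count [RHS]big_mkcond [RHS](big_nth 0%N) /=.
by apply: eq_bigr => j _; case: (_ < _)%N.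
Qed.

Lemma strict_uniq s : strict k s -> uniq s.
Proof. by case/andP => _; apply: sorted_uniq; [exact: ltn_trans | exact: ltnn]. Qed.

Lemma strict_sortP s : strict k (sort leq s) = all (leq k) s && uniq s.
Proof.
rewrite /strict all_sort; congr (_ && _).
by rewrite ltn_sorted_uniq_leq sort_uniq (sort_sorted leq_total) andbT.
Qed.

Lemma e_zero s : ~~ (all (leq k) s && uniq s) -> e k s = 0.
Proof. by move=> h; rewrite /e insubF //; apply/negbTE; rewrite strict_sortP. Qed.

Lemma e_perm_swap A a b B : e k (A ++ a :: b :: B) = - e k (A ++ b :: a :: B).
Proof.
have pe : perm_eq (A ++ a :: b :: B) (A ++ b :: a :: B).
  by rewrite perm_cat2l -[a :: b :: B]/([:: a] ++ [:: b] ++ B) perm_catCA.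
have [h|h] := boolP (all (leq k) (A ++ a :: b :: B) && uniq (A ++ a :: b :: B)); last first.
  rewrite !e_zero ?oppr0 //; move: h; apply: contra => /andP[h1 h2].
  by rewrite (perm_all _ pe) h1 (perm_uniq pe).
have ab : a != b.
  apply: contraL h => /eqP ->; rewrite negb_and; apply/orP; right.
  by rewrite cat_uniq /= mem_head /= !andbF.
have ss : sort leq (A ++ a :: b :: B) = sort leq (A ++ b :: a :: B).
  by apply/(perm_sortP leq_total leq_trans anti_leq).
have inv : (-1) ^+ inversions (A ++ a :: b :: B) = - (-1) ^+ inversions (A ++ b :: a :: B) :> rat.
  elim: A {h pe ss} => [|c A IH] /=.
    rewrite !inversions_cons /= !exprD; case: ltngtP ab => [lt|lt|->]; rewrite ?eqxx // => _.
      by rewrite expr1 expr0; ring.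
    by rewrite expr1 expr0; ring.
  rewrite !inversions_cons !exprD IH mulrN; congr (- (_ * _)); congr (_ ^+ _).
  by rewrite !count_cat /=; congr (_ + _)%N; rewrite addnCA.
rewrite /e ss; case: insubP => [K _ _|_]; last by rewrite oppr0.
by rewrite inv monalgUN.
Qed.
End Chains.

(** Reduces identities between antisymmetric functions to strict sequences, where the coefficients
    of a chain live. *)
Lemma alt_ext k F G : alt k F -> alt k G -> (forall s, strict k s -> F s = G s) -> forall s, F s = G s.
Proof.
move=> aF aG FG s; pose H s := F s - G s.
have aH : alt k H.
  split=> [A x y B|s' h]; rewrite /H.
    by rewrite (proj1 aF) (proj1 aG) opprB opprK addrC.
  by rewrite (proj2 aF) ?(proj2 aG) ?subrr.
suff : H s = 0 by move/eqP; rewrite subr_eq0 => /eqP.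
have [us|us] := boolP (uniq s); last exact: alt_uniq aH us.
have [ls|ls] := boolP (all (leq k) s); last first.
  apply: (alt_low aH); move: ls; rewrite -has_predC; apply: sub_has => x /=.
  by rewrite ltnNge.
apply/eqP; rewrite -(alt_perm0 aH (s := sort leq s)) ?perm_sort //.
by rewrite /H FG ?subrr // strict_sortP ls.
Qed.

Section Chains.
Variable k : nat.
Implicit Types (x y z : chain k) (s : seq nat).

Definition cf x (s : seq nat) : rat := inner x (e k s).

Lemma e_strict (K : strict_part k) : e k (sval K) = << K >>.
Proof.
case: K => s hs /=; rewrite /e.
have sl : sorted leq s by case/andP: hs => _; apply: sub_sorted => a b; apply: ltnW.
have ss : sort leq s = s by apply: sorted_sort => //; exact: leq_trans.
have -> : inversions s = 0%N.
  elim: s sl {hs ss} => [|a s IH] sl; first by rewrite /inversions /= big_nil.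
  rewrite inversions_cons IH ?(path_sorted sl) // addn0.
  apply/eqP; rewrite -leqn0 leqNgt -has_count; apply/hasPn => b bs.
  by rewrite -leqNgt; apply: (allP (order_path_min leq_trans sl)).
rewrite expr0; case: insubP => [K _ eK|]; last by rewrite ss hs.
by congr (<< 1 *g _ >>); apply: val_inj; rewrite eK ss.
Qed.

Lemma cf_strict x (K : strict_part k) : cf x (sval K) = x@_K.
Proof. by rewrite /cf e_strict innerU mulr1. Qed.

Lemma alt_cf x : alt k (cf x).
Proof.
split=> [A a b B|s h]; rewrite /cf; first by rewrite e_perm_swap linearN.
rewrite e_zero ?linear0 // negb_and; apply/orP; left.
rewrite -has_predC; apply: sub_has h => a /=; by rewrite ltnNge.
Qed.

Lemma cf_inj x y : (forall s, cf x s = cf y s) -> x = y.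
Proof. by move=> h; apply/malgP => K; rewrite -!cf_strict. Qed.

Lemma cf_bound x : exists D, forall s, cf x s != 0 -> (size s <= D)%N /\ (sumn s <= D)%N.
Proof.
exists (\sum_(K <- msupp x) (size (sval K) + sumn (sval K)))%N => s.
have [h|h] := boolP (all (leq k) s && uniq s); last by rewrite /cf e_zero // linear0 eqxx.
have sK : strict k (sort leq s) by rewrite strict_sortP.
rewrite -(alt_perm0 (alt_cf x) (s := sort leq s)) ?perm_sort //.
rewrite -[sort leq s]/(sval (exist (fun s => strict k s) _ sK)) cf_strict mcoeff_neq0 => Kx.
rewrite (big_rem _ Kx) /= size_sort (perm_sumn (s2 := s)) ?perm_sort //; lia.
Qed.

Definition altv (f : seq nat -> chain k) : Prop :=
  (forall A a b B, f (A ++ a :: b :: B) = - f (A ++ b :: a :: B))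
  /\ (forall s, has (fun a => a < k)%N s -> f s = 0).

(** The extension only consults f on strict partitions; antisymmetry lets it be evaluated on an
    unsorted monomial as well. *)
Lemma linear_extension_e f s : altv f -> linear_extension f (e k s) = f s.
Proof.
case=> f1 f2; apply: cf_inj => s'; rewrite /cf.
move: s; apply: (@alt_ext k).
- split=> [A a b B|s h]; first by rewrite e_perm_swap linearN -!scaleN1r innerZl mulN1r.
  rewrite e_zero ?linear0 ?inner0l // negb_and; apply/orP; left.
  by rewrite -has_predC; apply: sub_has h => a /=; rewrite ltnNge.
- split=> [A a b B|s h]; first by rewrite f1 -scaleN1r innerZl mulN1r.
  by rewrite f2 ?inner0l.
move=> s sK; rewrite -[s]/(sval (exist (fun s => strict k s) _ sK)) e_strict.
by rewrite linear_extensionU scale1r.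
Qed.

Lemma wedge_e A B : wedge (e k A) (e k B) = e k (A ++ B).
Proof.
have h I : linear_extension (fun J => e k (I ++ J)) (e k B) = e k (I ++ B).
  apply: linear_extension_e; split=> [A' a b B'|s hs].
    by rewrite !catA; apply: e_perm_swap.
  rewrite e_zero // negb_and; apply/orP; left.
  by rewrite -has_predC has_cat; apply/orP; right; apply: sub_has hs => a /=; rewrite ltnNge.
rewrite /wedge (eq_linear_extension (g := fun I => e k (I ++ B))) //.
apply: linear_extension_e; split=> [A' a b B'|s hs].
  by rewrite -!catA; apply: e_perm_swap.
rewrite e_zero // negb_and; apply/orP; left.
by rewrite -has_predC has_cat; apply/orP; left; apply: sub_has hs => a /=; rewrite ltnNge.
Qed.

Lemma wedge_linear_r x a y z : wedge x (a *: y + z) = a *: wedge x y + wedge x z.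
Proof.
have E y' : wedge x y' = \sum_(I <- msupp x) x@_I *: linear_extension (fun J => e k (sval I ++ J)) y' by [].
rewrite !E scaler_sumr -big_split /=; apply: eq_bigr => I _.
by rewrite linearP /= scalerDr !scalerA mulrC.
Qed.

HB.instance Definition _ x := GRing.isLinear.Build rat (chain k) (chain k) *:%R (wedge x) (wedge_linear_r x).

Lemma wedge_linear_l z a x y : wedge (a *: x + y) z = a *: wedge x z + wedge y z.
Proof. exact: linearP. Qed.

Lemma foldl_wedge_linear Xs a x y :
  foldl (@wedge k) (a *: x + y) Xs = a *: foldl (@wedge k) x Xs + foldl (@wedge k) y Xs.
Proof. by elim: Xs x y => //= X Xs IH x y; rewrite wedge_linear_l IH. Qed.

(** The arguments are exchanged so that linearity in the initial chain can be declared. *)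
Definition foldw Xs x := foldl (@wedge k) x Xs.

Lemma foldw_linear Xs a x y : foldw Xs (a *: x + y) = a *: foldw Xs x + foldw Xs y.
Proof. exact: foldl_wedge_linear. Qed.

HB.instance Definition _ Xs := GRing.isLinear.Build rat (chain k) (chain k) *:%R (foldw Xs) (foldw_linear Xs).

End Chains.

(** * Pairing of chains with xi-monomials *)

Section PairChain.
Variables (k : nat) (t : lie_kind).
Implicit Types (F G : seq nat -> rat).

Lemma Y_linear (I : Type) (r : seq I) (c : I -> rat) (G : I -> seq nat -> rat) m s :
  Y t m (fun s => \sum_(i <- r) c i * G i s) s = \sum_(i <- r) c i * Y t m (G i) s.
Proof.
rewrite /Y; under eq_bigr do under eq_bigr do rewrite mulr_sumr.
under eq_bigr do rewrite exchange_big.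
rewrite exchange_big /=; apply: eq_bigr => i _; rewrite mulr_sumr; apply: eq_bigr => a _.
by rewrite mulr_sumr; apply: eq_bigr => b _; rewrite mulrCA.
Qed.

Lemma alt_sum (I : Type) (r : seq I) (c : I -> rat) (G : I -> seq nat -> rat) :
  (forall i, alt k (G i)) -> alt k (fun s => \sum_(i <- r) c i * G i s).
Proof.
move=> aG; split=> [A a b B|s h].
  by rewrite -sumrN; apply: eq_bigr => i _; rewrite (proj1 (aG i)) mulrN.
by rewrite big1 // => i _; rewrite (proj2 (aG i)) ?mulr0.
Qed.

Lemma alt_pairing J bs F : alt k F -> alt k (fun A => pairing t J F A bs).
Proof.
elim: bs F => //= B bs IH F aF; case: (J _); last exact: (alt_catr B (IH _ aF)).
apply: (@alt_sum 'I_(size B) (index_enum _) (fun r => (-1) ^+ (r : nat))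
  (fun r A => pairing t J (Y t (nth 0%N B r) F) (A ++ take r B ++ drop r.+1 B) bs)) => r.
by apply: (alt_catr _ (IH _ (alt_Y t _ aF))).
Qed.

Lemma pairing_Y J bs m F A : alt k F ->
  pairing t J (Y t m F) A bs = Y t m (fun A => pairing t J F A bs) A.
Proof.
elim: bs F A => //= B bs IH F A aF; case: (J _); last exact: IH.
rewrite (@Y_linear 'I_(size B) _ _ (fun r A => pairing t J (Y t (nth 0%N B r) F) (A ++ take r B ++ drop r.+1 B) bs)).
apply: eq_bigr => r _; congr (_ * _).
have -> : Y t (nth 0%N B r) (Y t m F) = Y t m (Y t (nth 0%N B r) F).
  by apply: functional_extensionality => s; apply: Y_comm aF.
by rewrite IH //; exact: alt_Y.
Qed.

(** The reflection a -> m - a matches the two halves of [Y], and a middle term with two equal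
    letters is 0. The inserted pair has even degree, so its position is immaterial. *)
Lemma half_Y G m A B : alt k G ->
  \sum_(k <= a < m | (a < m - a)%N) mm t a (m - a) * G (A ++ [:: a; (m - a)%N] ++ B)
   = Y t m G (A ++ B) / 2.
Proof.
move=> aG; pose T a := mm t a (m - a) * G [:: a, (m - a)%N & A ++ B].
have GT a : mm t a (m - a) * G (A ++ [:: a; (m - a)%N] ++ B) = T a.
  rewrite /T /=; congr (_ * _); rewrite (alt_front _ _ _ aG).
  by rewrite (alt_front _ _ _ (alt_cons a aG)) mulrA -expr2 sqrr_sign mul1r.
under eq_bigr do rewrite GT.
have Tsym a : (a <= m)%N -> T (m - a)%N = T a.
  by move=> am; rewrite /T subKn // mmC (alt_swap _ _ _ aG) mulrNN.
have T0 a : (a < k)%N -> T a = 0.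
  by move=> ak; rewrite /T (alt_low aG) ?mulr0 //= ak.
have -> : Y t m G (A ++ B) = \sum_(a < m.+1) T a by rewrite Y_single.
have -> : \sum_(k <= a < m | (a < m - a)%N) T a = \sum_(a < m.+1 | (a < m - a)%N) T a.
  rewrite big_mkcond -(big_mkord (fun a => (a < m - a)%N) T) [RHS]big_mkcond /=.
  have [km|mk] := leqP k m.
    rewrite [RHS](@big_cat_nat _ _ _ k) //=; last by apply: ltnW.
    rewrite [X in _ = X + _]big_nat_cond [X in _ = X + _]big1 ?add0r; last first.
      by move=> a /andP[/andP[_ ak] _]; rewrite T0 // if_same.
    by rewrite big_nat_recr //= subnn ltn0 addr0.
  rewrite big_geq; last by apply: ltnW.
  rewrite big_nat_cond big1 // => a /andP[/andP[_ am] _].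
  by rewrite T0 ?if_same //; lia.
rewrite [X in X / 2](bigID (fun a : 'I_m.+1 => (a < m - a)%N)) /=.
have -> : \sum_(a < m.+1 | ~~ (a < m - a)%N) T a = \sum_(a < m.+1 | (a < m - a)%N) T a.
  rewrite (bigID (fun a : 'I_m.+1 => (m - a < a)%N)) /= addrC big1 ?add0r; last first.
    move=> a /andP[h1 h2]; have am := ltn_ord a.
    by rewrite /T (_ : (m - a)%N = a) ?mm_id ?mul0r //; lia.
  rewrite (reindex_inj rev_ord_inj) /=; apply: eq_big => a.
    by rewrite subSS; have := ltn_ord a; lia.
  by move=> _; rewrite subSS Tsym // -ltnS.
by field.
Qed.

Lemma wedge_sumr (T : Type) (r : seq T) (P : pred T) (X : T -> chain k) y :
  wedge y (\sum_(i <- r | P i) X i) = \sum_(i <- r | P i) wedge y (X i).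
Proof. exact: linear_sum. Qed.

Lemma wedgeZr (c : rat) (x y : chain k) : wedge x (c *: y) = c *: wedge x y.
Proof. exact: linearZ. Qed.

Lemma wedge_mid (T : Type) (r : seq T) (P : pred T) (c : T -> rat) (X : T -> chain k) x y z :
  wedge x (wedge y (wedge (\sum_(i <- r | P i) c i *: X i) z)) =
  \sum_(i <- r | P i) c i *: wedge x (wedge y (wedge (X i) z)).
Proof.
have -> : wedge (\sum_(i <- r | P i) c i *: X i) z = \sum_(i <- r | P i) wedge (c i *: X i) z.
  exact: linear_sum.
rewrite (wedge_sumr r P _ y) (wedge_sumr r P _ x); apply: eq_bigr => i _.
by have -> : wedge (c i *: X i) z = c i *: wedge (X i) z by [exact: linearZ]; rewrite (wedgeZr _ y) (wedgeZr _ x).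
Qed.

#[local] Opaque e wedge.

Lemma wedge_e4 (A B C D : seq nat) :
  wedge (e k A) (wedge (e k B) (wedge (e k C) (e k D))) = e k ((A ++ B) ++ C ++ D).
Proof.
apply: etrans (congr1 (fun w => wedge (e k A) (wedge (e k B) w)) (wedge_e k C D)) _.
apply: etrans (congr1 (wedge (e k A)) (wedge_e k B (C ++ D))) _.
by apply: etrans (wedge_e k A (B ++ C ++ D)) _; rewrite catA.
Qed.

Lemma inner_foldw_sum (T : Type) (r : seq T) (P : pred T) (X : T -> chain k) f Xs :
  inner f (foldw Xs (\sum_(i <- r | P i) X i)) = \sum_(i <- r | P i) inner f (foldw Xs (X i)).
Proof. by rewrite (linear_sum (foldw Xs)) (linear_sum (inner f)). Qed.

Lemma inner_foldwZ c (x f : chain k) Xs : inner f (foldw Xs (c *: x)) = c * inner f (foldw Xs x).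
Proof. by rewrite linearZ; exact: linearZ. Qed.

(** Each marked block carries one delta, which is transferred to the coefficient function as [Y] and
    leaves a factor 1/2. *)
Lemma pair_chain (f : chain k) (J : {fset nat}) bs A :
  all (strict k) bs ->
  inner f (foldw [seq xi_block k t J B | B <- bs] (e k A)) =
  pairing t [in J] (cf f) A bs / 2 ^+ size (marked [in J] bs).
Proof.
elim: bs A => [|B bs IH] A; first by rewrite expr0 divr1.
case/andP=> sB sbs.
pose w := wedge (e k A) (xi_block k t J B).
have -> : foldw [seq xi_block k t J B | B <- B :: bs] (e k A) =
  foldw [seq xi_block k t J B | B <- bs] w by [].
have -> : pairing t [in J] (cf f) A (B :: bs) = if head 0%N B \in J then
      \sum_(r < size B) (-1) ^+ r *
        pairing t [in J] (Y t (nth 0%N B r) (cf f)) (A ++ take r B ++ drop r.+1 B) bs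
    else pairing t [in J] (cf f) (A ++ B) bs by [].
have -> : marked [in J] (B :: bs) =
  if head 0%N B \in J then head 0%N B :: marked [in J] bs else marked [in J] bs.
  by rewrite /marked /=; case: ifP.
have wE : w = wedge (e k A) (if head 0%N B \in J then delta t (e k B) else e k B) by [].
clearbody w; case: ifP wE => JB ->; last by rewrite wedge_e; apply: IH.
have -> : wedge (e k A) (delta t (e k B)) = \sum_(r < size B) (-1) ^+ r *:
   \sum_(k <= a < nth 0%N B r | (a < nth 0%N B r - a)%N)
     mm t a (nth 0%N B r - a) *: e k ((A ++ take r B) ++ [:: a; (nth 0%N B r - a)%N] ++ drop r.+1 B).
  rewrite -[e k B]/(e k (sval (exist (fun s => strict k s) _ sB))) e_strict /delta linear_extensionU scale1r /=.
  rewrite big_mkord wedge_sumr; apply: eq_bigr => r _; rewrite wedgeZr; congr (_ *: _).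
  rewrite /delta_gen; apply: etrans (wedge_mid _ _ _ _ _ _ _) _.
  by apply: eq_bigr => a _; congr (_ *: _); exact: wedge_e4.
rewrite inner_foldw_sum mulr_suml; apply: eq_bigr => r _.
rewrite inner_foldwZ -!mulrA; congr (_ * _).
rewrite inner_foldw_sum.
under eq_bigr do rewrite inner_foldwZ IH // mulrA.
rewrite -mulr_suml (half_Y _ _ _ (alt_pairing [in J] bs (alt_cf f))).
rewrite -pairing_Y ?catA; last exact: alt_cf.
by rewrite exprS invfM mulrA.
Qed.

End PairChain.

Lemma blocks_strict k I : (1 <= k)%N -> nonsingular k I -> all (strict k) (blocks k I).
Proof.
move=> k1 nI; have [_ dI _] := normal_formP k1 nI.
apply: sub_all dI => B /and4P[/andP[kB _] _ _ B3].
by rewrite /strict kB; apply: sub_sorted B3 => a b /eqP-> /=; lia.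
Qed.

Section Pairing.
Variables (t : lie_kind) (J : pred nat).

Lemma pairing_zero F A bs : (forall s, F s = 0) -> pairing t J F A bs = 0.
Proof.
elim: bs F A => [|B bs IH] F A F0 /=; first exact: F0.
case: ifP => _; last exact: IH.
apply: big1 => r _; rewrite IH ?mulr0 // => s.
by rewrite /Y big1 // => a _; rewrite big1 // => b _; rewrite F0 mulr0.
Qed.

Lemma pairing_stable F A bs : (forall m s, Y t m F s = 0) ->
  has (fun B => J (head 0%N B)) bs -> pairing t J F A bs = 0.
Proof.
move=> YF; elim: bs A => //= B bs IH A.
case: ifP => [_ _|_ /= hbs]; last exact: IH.
by apply: big1 => r _; rewrite pairing_zero ?mulr0.
Qed.

(** Every [Y] replaces a part by two letters with the same sum, so only values of F in one degree
    enter. *)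
Lemma pairing_homogeneous F A bs : (forall s, sumn s = sumn (A ++ flatten bs) -> F s = 0) ->
  pairing t J F A bs = 0.
Proof.
elim: bs F A => [|B bs IH] F A F0 /=; first by apply: F0; rewrite cats0.
case: ifP => _; last by apply: IH => s hs; apply: F0; rewrite hs /= catA.
apply: big1 => r _; rewrite IH ?mulr0 // => s hs; rewrite Y_single.
apply: big1 => a _; rewrite F0 ?mulr0 //.
rewrite -[RHS]/(sumn (A ++ B ++ flatten bs)) -[LHS]/(a + (nth 0%N B r - a + sumn s))%N hs.
have eB : sumn B = sumn (take r B ++ nth 0%N B r :: drop r.+1 B).
  by rewrite -drop_nth // cat_take_drop.
rewrite !sumn_cat eB sumn_cat -[sumn (_ :: _)]/(nth 0%N B r + sumn (drop r.+1 B))%N; have := ltn_ord a; lia.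
Qed.
End Pairing.

Section Xi.
Variables (k : nat) (t : lie_kind).
Hypothesis k1 : (1 <= k)%N.
Implicit Types (f : chain k) (p : seq nat * {fset nat}).

Lemma xi_pairing f p : nonsingular k p.1 ->
  inner f (xi k t p) = pairing t [in p.2] (cf f) (main_part k p.1) (blocks k p.1)
    / 2 ^+ size (marked [in p.2] (blocks k p.1)).
Proof. by move=> np; apply: pair_chain; apply: blocks_strict. Qed.

(** The form in which the spanning by xi-monomials is used: two chains with the same pairings are
    equal, so dual chains are unique. *)
Lemma xi_total f : (forall p, distinguished k p -> inner f (xi k t p) = 0) -> f = 0.
Proof.
move=> f0; apply: NNPP => fn.
have [D fD] := cf_bound f.
have [|p [dp /eqP]] := pairing_nonzero t k1 (alt_cf f) fD.
  apply: NNPP => h; apply: fn; apply: cf_inj => s; rewrite [RHS]inner0l.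
  by apply/eqP; apply: contraPT isT => cs _; apply: h; exists s.
case; have := f0 p dp; rewrite xi_pairing; last by case/andP: dp.
by move/eqP; rewrite mulf_eq0 invr_eq0 expf_eq0 /= andbF orbF => /eqP.
Qed.

Lemma stable_xi f p : (forall m s, Y t m (cf f) s = 0) -> distinguished k p ->
  p.2 != fset0 -> inner f (xi k t p) = 0.
Proof.
move=> Yf /andP[np /fsubsetP pl] /fset0Pn[x xp].
rewrite xi_pairing // pairing_stable ?mul0r //.
by have := pl x xp; rewrite inE /= => /mapP[B Bb xB]; apply/hasP; exists B; rewrite // -xB.
Qed.

Lemma xi_degree p s : nonsingular k p.1 -> cf (xi k t p) s != 0 -> sumn s = sumn p.1.
Proof.
move=> np; rewrite /cf innerC xi_pairing //.
apply: contraNeq => ss; rewrite pairing_homogeneous ?mul0r // => s' hs'.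
have [_ _ fp] := normal_formP k1 np; rewrite fp in hs'.
have ns : sumn s' != sumn s by rewrite hs' eq_sym.
rewrite /cf; have [h|h] := boolP (all (leq k) s && uniq s); last by rewrite e_zero ?inner0l.
have [h'|h'] := boolP (all (leq k) s' && uniq s'); last by rewrite (e_zero h') linear0.
rewrite {1 2}/e; case: insubP => [K _ eK|_]; last by rewrite inner0l.
case: insubP => [K' _ eK'|_]; last by rewrite linear0.
rewrite innerU mcoeffU; case: eqP => [KK|]; last by rewrite mulr0n mul0r.
have sortE r : sumn (sort leq r) = sumn r by apply: perm_sumn; rewrite perm_sort.
by case/eqP: ns; rewrite -(sortE s) -(sortE s') -eK -eK' KK.
Qed.

Lemma xi_nil I : nonsingular k I -> xi k t (I, fset0) = e k I.
Proof.
move=> nI; have [_ _ eI] := normal_formP k1 nI.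
have h (J : pred nat) s A bs : J =1 xpred0 -> pairing t J (cf (e k s)) A bs
    / 2 ^+ size (marked J bs) = inner (e k s) (e k (A ++ flatten bs)).
  move=> J0; elim: bs A => [|B bs IH] A; first by rewrite expr0 divr1 cats0.
  by rewrite /marked /= J0 -/(marked _ bs) IH catA.
apply: cf_inj => s; rewrite /cf innerC [RHS]innerC.
apply: etrans (xi_pairing (p := (I, fset0)) (e k s) nI) _.
by apply: etrans (h _ s _ _ _) _; [move=> x; exact: in_fset0 | rewrite eI].
Qed.
End Xi.

(** * Stability as orthogonality to the products with delta *)

Section Minors.
Variables (V : lmodType rat).

(** The signed sum of a Laplace expansion: one letter of I is moved to the front. [minor2] removes
    two letters, with the signs of [boundary]. *)
Definition minor1 (I : seq nat) (G : nat -> seq nat -> V) : V :=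
  \sum_(0 <= i < size I) (-1) ^+ i *: G (nth 0%N I i) (take i I ++ drop i.+1 I).

Definition minor2 (I : seq nat) (G : nat -> nat -> seq nat -> V) : V :=
  \sum_(0 <= s < size I) \sum_(0 <= r < s) (-1) ^+ (r + s).+1 *:
     G (nth 0%N I r) (nth 0%N I s) (take r I ++ drop r.+1 (take s I) ++ drop s.+1 I).

Lemma minor1_cons a I G : minor1 (a :: I) G = G a I - minor1 I (fun x R => G x (a :: R)).
Proof.
rewrite /minor1 /= big_nat_recl //= expr0 scale1r drop0; congr (_ + _).
by rewrite -sumrN; apply: eq_bigr => i _; rewrite exprS mulN1r scaleNr.
Qed.

Lemma eq_minor1 I G H : (forall x R, G x R = H x R) -> minor1 I G = minor1 I H.
Proof. by move=> GH; apply: eq_bigr => i _; rewrite GH. Qed.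

Lemma minor1B I G H : minor1 I (fun x R => G x R - H x R) = minor1 I G - minor1 I H.
Proof. by rewrite /minor1 -sumrB; apply: eq_bigr => i _; rewrite scalerBr. Qed.

Lemma minor1N I G : minor1 I (fun x R => - G x R) = - minor1 I G.
Proof. by rewrite /minor1 -sumrN; apply: eq_bigr => i _; rewrite scalerN. Qed.

Lemma minor2_cons a I G :
  minor2 (a :: I) G = minor1 I (G a) + minor2 I (fun x y R => G x y (a :: R)).
Proof.
rewrite /minor2 /= big_nat_recl //= big_nil add0r /minor1 -big_split /=.
apply: eq_bigr => s _; rewrite big_nat_recl //= add0n drop0 2!exprS !mulN1r opprK.
by congr (_ + _); apply: eq_bigr => r _; rewrite addSn addnS exprS exprS !mulN1r opprK.
Qed.

(** Removing x and y in the two orders leaves the same remainder with opposite signs, and the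
    antisymmetry of G makes the two contributions equal. *)
Lemma minor1_minor1 I G : (forall x y R, G x y R = - G y x R) ->
  minor1 I (fun x R => minor1 R (G x)) = 2 *: minor2 I G.
Proof.
elim: I G => [|a I IH] G aG; first by rewrite /minor1 /minor2 /= !big_nil scaler0.
rewrite minor1_cons minor2_cons.
have -> : minor1 I (fun x R => minor1 (a :: R) (G x)) =
    minor1 I (fun x R => G x a R - minor1 R (fun y R' => G x y (a :: R'))).
  by apply: eq_minor1 => x R; rewrite minor1_cons.
rewrite minor1B IH; last by move=> *; exact: aG.
have -> : minor1 I (fun x R => G x a R) = - minor1 I (G a).
  by rewrite -minor1N; apply: eq_minor1 => x R; exact: aG.
by rewrite scalerDr opprB addrA addrAC opprK; congr (_ + _); rewrite scaler_nat mulr2n.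
Qed.
End Minors.

Section Stable.
Variables (k : nat) (t : lie_kind).
Implicit Types (x y z : chain k) (I s : seq nat).

Lemma inner_e A B : inner (e k A) (e k B) =
  if [&& all (leq k) A, uniq A & perm_eq A B] then (-1) ^+ (inversions A + inversions B) else 0.
Proof.
have [h|h] := boolP (all (leq k) A && uniq A); last first.
  by rewrite e_zero // inner0l andbA (negbTE h).
rewrite andbA h /=; have [pAB|nAB] := boolP (perm_eq A B).
  have h' : all (leq k) B && uniq B by rewrite -(perm_all _ pAB) -(perm_uniq pAB).
  rewrite /e; case: insubP => [K _ eK|]; last by rewrite strict_sortP h.
  case: insubP => [K' _ eK'|]; last by rewrite strict_sortP h'.
  have -> : K = K'.
    by apply: val_inj; rewrite eK eK'; apply/(perm_sortP leq_total leq_trans anti_leq).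
  by rewrite innerU mcoeffUU exprD.
have [h'|h'] := boolP (all (leq k) B && uniq B); last by rewrite (e_zero h') linear0.
rewrite /e; case: insubP => [K _ eK|_]; last by rewrite inner0l.
case: insubP => [K' _ eK'|_]; last by rewrite linear0.
rewrite innerU mcoeffU; case: eqP => [KK|_]; last by rewrite mulr0n mul0r.
case/negP: nAB; apply/(perm_sortP leq_total leq_trans anti_leq).
by rewrite -eK -eK' KK.
Qed.

Lemma inner_e_cons a A B : (k <= a)%N -> a \notin A ->
  inner (e k (a :: A)) (e k (a :: B)) = inner (e k A) (e k B).
Proof.
move=> ka aA; apply: etrans (inner_e _ _) (esym (etrans (inner_e _ _) _)).
rewrite /= ka aA /= perm_cons; case: and3P => // -[_ _ pAB].
rewrite !inversions_cons -(permP pAB) addnACA addnn -mul2n [RHS]exprD exprM sqrrN !expr1n mul1r.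
by [].
Qed.

Lemma e_front A a B : e k (A ++ a :: B) = (-1) ^+ size A *: e k (a :: A ++ B).
Proof.
apply: cf_inj => r; apply: etrans (innerC _ _) _.
apply: etrans (alt_front _ _ _ (alt_cf _)) _.
by apply: esym; apply: etrans (innerC _ _) _; exact: linearZ.
Qed.

(** The pairing of two monomials is a determinant of Kronecker symbols, expanded here along the row
    of a. *)
Lemma laplace I a s : strict k I ->
  inner (e k I) (e k (a :: s)) =
  \sum_(0 <= i < size I) (-1) ^+ i * ((nth 0%N I i == a)%:R * inner (e k (take i I ++ drop i.+1 I)) (e k s)).
Proof.
move=> sI; have uI := strict_uniq sI.
have [aI|aI] := boolP (a \in I); last first.
  have nP : perm_eq I (a :: s) = false.
    by apply/negP => /perm_mem /(_ a); rewrite mem_head (negbTE aI).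
  apply: etrans (inner_e _ _) _; rewrite nP !andbF big1_seq // => i /andP[_].
  rewrite mem_index_iota => /andP[_ iI].
  case: eqP => [ai|_]; last by rewrite mul0r mulr0.
  by case/negP: aI; rewrite -ai mem_nth.
have iI : (index a I < size I)%N by rewrite index_mem.
rewrite (bigD1_seq (index a I)) ?mem_index_iota ?iota_uniq //= nth_index // eqxx mul1r.
rewrite big1_seq ?addr0; last first.
  move=> i /andP[ia]; rewrite mem_index_iota => /andP[_ iI'].
  case: eqP => [ai|_]; last by rewrite mul0r mulr0.
  by case/eqP: ia; rewrite -ai index_uniq.
have kI : (k <= a)%N by case/andP: sI => /allP /(_ a aI).
have eI : I = take (index a I) I ++ a :: drop (index a I).+1 I.
  by rewrite -[in X in X :: _](nth_index 0%N aI) -drop_nth // cat_take_drop.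
have -> : e k I = (-1) ^+ index a I *: e k (a :: take (index a I) I ++ drop (index a I).+1 I).
  by have := e_front (take (index a I) I) a (drop (index a I).+1 I); rewrite -eI size_takel // ltnW.
apply: etrans (innerZl ((-1) ^+ index a I) (e k (a :: take (index a I) I ++ drop (index a I).+1 I)) (e k (a :: s))) _.
have aR : a \notin take (index a I) I ++ drop (index a I).+1 I.
  by move: uI; rewrite {1}eI uniq_catC /= mem_cat orbC -mem_cat => /andP[].
exact: (f_equal (GRing.mul ((-1) ^+ index a I)) (inner_e_cons s kI aR)).
Qed.
End Stable.

Section MinorSums.
Variable V : lmodType rat.

Lemma minor_subseq i (I : seq nat) : subseq (take i I ++ drop i.+1 I) I.
Proof.
rewrite -{3}(cat_take_drop i I) cat_subseq // -add1n -drop_drop.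
by case: (drop i I) => [|a r]; [exact: subseq_refl | rewrite drop1; exact: subseq_cons].
Qed.

Lemma strict_subseq k I K : subseq K I -> strict k I -> strict k K.
Proof.
move=> sub /andP[/allP kI sI]; rewrite /strict (subseq_sorted ltn_trans sub sI) andbT.
by apply/allP => a /(mem_subseq sub) /kI.
Qed.

Lemma eq_minor1_strict k I (G H : nat -> seq nat -> V) : strict k I ->
  (forall x R, strict k R -> G x R = H x R) -> minor1 I G = minor1 I H.
Proof. by move=> sI GH; apply: eq_bigr => i _; rewrite GH //; apply: strict_subseq sI; apply: minor_subseq. Qed.

Lemma minor1_sum (T : Type) (r : seq T) (c : T -> rat) (G : T -> nat -> seq nat -> V) I :
  \sum_(j <- r) c j *: minor1 I (G j) = minor1 I (fun x R => \sum_(j <- r) c j *: G j x R).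
Proof.
rewrite /minor1; under eq_bigr do rewrite scaler_sumr.
rewrite exchange_big; apply: eq_bigr => i _; rewrite scaler_sumr; apply: eq_bigr => j _.
by rewrite !scalerA mulrC.
Qed.

Lemma minor2_sum (T : Type) (r : seq T) (c : T -> rat) (G : T -> nat -> nat -> seq nat -> V) I :
  \sum_(j <- r) c j *: minor2 I (G j) = minor2 I (fun x y R => \sum_(j <- r) c j *: G j x y R).
Proof.
rewrite /minor2; under eq_bigr do rewrite scaler_sumr.
rewrite exchange_big; apply: eq_bigr => s _; under eq_bigr do rewrite scaler_sumr.
rewrite exchange_big; apply: eq_bigr => q _; rewrite scaler_sumr; apply: eq_bigr => j _.
by rewrite !scalerA mulrC.
Qed.

Lemma eq_minor2 I (G H : nat -> nat -> seq nat -> V) :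
  (forall x y R, G x y R = H x y R) -> minor2 I G = minor2 I H.
Proof. by move=> GH; apply: eq_bigr => i _; apply: eq_bigr => j _; rewrite GH. Qed.

End MinorSums.

Section Stable.
Variables (k : nat) (t : lie_kind).
Implicit Types (z : chain k) (I s : seq nat).

Lemma cf_expand z s : cf z s = \sum_(I <- msupp z) z@_I * inner (e k (sval I)) (e k s).
Proof.
rewrite /cf {1}(monalgE z) inner_suml; apply: eq_bigr => I _.
apply: etrans (innerC _ _) _; apply: etrans (innerU _ _ _) _; apply: etrans (mulrC _ _) _.
by apply: (f_equal (GRing.mul z@_I)); apply: etrans (esym (cf_strict _ _)) (innerC _ _).
Qed.

Lemma laplace1 I a s : strict k I -> inner (e k I) (e k (a :: s)) =
  minor1 (V := rat^o) I (fun x R => (x == a)%:R * inner (e k R) (e k s)).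
Proof. by move=> sI; apply: etrans (laplace _ _ sI) _. Qed.

Lemma laplaceC K a s : strict k K -> inner (e k (a :: s)) (e k K) =
  \sum_(0 <= i < size K) (-1) ^+ i * ((nth 0%N K i == a)%:R * inner (e k s) (e k (take i K ++ drop i.+1 K))).
Proof.
move=> sK; apply: etrans (innerC _ _) _; apply: etrans (laplace _ _ sK) _; apply: eq_bigr => i _.
exact: (f_equal (fun q => _ * (_ * q)) (innerC _ _)).
Qed.

Lemma sum_iota_ind n i (H : nat -> rat) :
  \sum_(j <- iota 0 n) (i == j)%:R * H j = if (i < n)%N then H i else 0.
Proof.
case: ltnP => [ni|ni].
  rewrite (bigD1_seq i) ?iota_uniq ?mem_iota //= eqxx mul1r big1 ?addr0 // => j ji.
  by rewrite eq_sym (negbTE ji) mul0r.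
rewrite big1_seq // => j /andP[_]; rewrite mem_iota => /andP[_ jn].
by case: eqP => [ij|]; rewrite ?mul0r //; lia.
Qed.

(** Two Laplace expansions split off the letters a and b; the factor 2 comes from the two orders of
    removal. *)
Lemma Y_cf_e I m s : strict k I -> Y t m (cf (e k I)) s =
  2 * minor2 (V := rat^o) I (fun a b R => (a + b == m)%N%:R * mm t a b * inner (e k R) (e k s)).
Proof.
move=> sI; pose G a b R : rat^o := (a + b == m)%N%:R * mm t a b * inner (e k R) (e k s).
have GN a b R : G a b R = - G b a R by rewrite /G addnC mmC mulrN mulNr.
have := minor1_minor1 I GN; rewrite -[_ *: _]/(_ * _) => <-.
pose H (p : nat * nat) x R : rat^o := (x == p.1)%:R *
  minor1 (V := rat^o) R (fun y R' => (y == p.2)%:R * inner (e k R') (e k s)).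
have -> : Y t m (cf (e k I)) s = \sum_(p <- [seq (a, b) | a <- iota 0 m.+1, b <- iota 0 m.+1])
    ((p.1 + p.2 == m)%N%:R * mm t p.1 p.2) *: minor1 I (H p).
  rewrite big_allpairs /Y -(big_mkord xpredT (fun a => \sum_(b < m.+1) (a + b == m)%N%:R * mm t a b * cf (e k I) [:: a, (b : nat) & s])).
  apply: eq_bigr => a _.
  rewrite -(big_mkord xpredT (fun b => (a + b == m)%N%:R * mm t a b * cf (e k I) [:: a, b & s])).
  apply: eq_bigr => b _; congr (_ * _); apply: etrans (laplace1 _ _ sI) _.
  have E x R : strict k R -> (x == a)%:R * inner (e k R) (e k (b :: s)) = H (a, b) x R.
    by move=> sR; apply: (f_equal (GRing.mul _)); exact: laplace1.
  exact: (eq_minor1_strict (V := rat^o) sI E).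
rewrite minor1_sum; apply: (eq_minor1_strict (V := rat^o) sI) => x R sR.
have -> : \sum_(p <- [seq (a, b) | a <- iota 0 m.+1, b <- iota 0 m.+1])
    ((p.1 + p.2 == m)%N%:R * mm t p.1 p.2) *: H p x R =
  \sum_(p <- [seq (a, b) | a <- iota 0 m.+1, b <- iota 0 m.+1])
    ((p.1 + p.2 == m)%N%:R * mm t p.1 p.2 * (x == p.1)%:R) *:
     minor1 R (fun y R' => (y == p.2)%:R * inner (e k R') (e k s) : rat^o).
  by apply: eq_bigr => p _; exact: mulrA.
rewrite minor1_sum; apply: (eq_minor1 (V := rat^o)) => y R'.
rewrite big_allpairs /G /=.
have -> : \sum_(i <- iota 0 m.+1) \sum_(j <- iota 0 m.+1)
     (((i + j)%N == m)%:R * mm t i j * (x == i)%:R) *: ((y == j)%:R * inner (e k R') (e k s) : rat^o) =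
  \sum_(i <- iota 0 m.+1) (x == i)%:R * \sum_(j <- iota 0 m.+1) (y == j)%:R *
     (((i + j)%N == m)%:R * mm t i j * inner (e k R') (e k s)).
  apply: eq_bigr => i _; rewrite mulr_sumr; apply: eq_bigr => j _.
  by rewrite -[LHS]/(_ * _); ring.
rewrite sum_iota_ind; under eq_bigr do rewrite -mulrA.
case: ltnP => [xm|mx].
  rewrite (sum_iota_ind _ _ (fun j => (x + j == m)%N%:R * (mm t x j * inner (e k R') (e k s)))).
  by case: ltnP => ym; rewrite ?mulrA // (_ : (_ == _) = false) ?mul0r //; apply/eqP; lia.
by rewrite (_ : (_ == _) = false) ?mul0r //; apply/eqP; lia.
Qed.

(** The adjointness of d and delta in coefficients. Expanding the new letter e_(a+b) against K
    groups the pairs by the part of K they sum to; dividing by 2 undoes the double count in [Y]. *)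
Lemma boundary_cf z K : strict k K -> cf (boundary t z) K =
  minor1 (V := rat^o) K (fun m R => Y t m (cf z) R) / 2.
Proof.
move=> sK.
pose G I a b R : rat^o := mm t a b * inner (e k ((a + b)%N :: R)) (e k K).
have -> : cf (boundary t z) K = \sum_(I <- msupp z) z@_I *: minor2 (V := rat^o) (sval I) (G (sval I)).
  rewrite /cf /boundary /linear_extension inner_suml; apply: eq_bigr => I _.
  rewrite innerZl; congr (_ * _); rewrite inner_suml; apply: eq_bigr => s _.
  rewrite inner_suml; apply: eq_bigr => r _; rewrite innerZl -mulrA; congr (_ * _).
have -> : minor1 (V := rat^o) K (fun m R => Y t m (cf z) R) =
    \sum_(I <- msupp z) z@_I *: minor1 (V := rat^o) K (fun m R => Y t m (cf (e k (sval I))) R).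
  rewrite minor1_sum; apply: (eq_minor1 (V := rat^o)) => m R.
  rewrite -(Y_linear t _ (fun I : strict_part k => z@_I)); apply: Y_ext => s; exact: cf_expand.
rewrite mulr_suml; apply: eq_bigr => I _; rewrite -[_ *: _]/(_ * _) -[X in _ = X / _]/(_ * _) -mulrA; congr (_ * _).
have -> : minor1 (V := rat^o) K (fun m R => Y t m (cf (e k (sval I))) R) =
  minor1 (V := rat^o) K (fun m R => 2 *: minor2 (V := rat^o) (sval I) (fun a b S => (a + b == m)%N%:R * mm t a b * inner (e k S) (e k R))).
  by apply: eq_minor1 => m R; apply: Y_cf_e; exact: (valP I).
have E : minor2 (V := rat^o) (sval I) (G (sval I)) =
  minor2 (V := rat^o) (sval I) (fun a b R => \sum_(j <- index_iota 0 (size K)) (-1) ^+ j *: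
   ((a + b == nth 0%N K j)%N%:R * mm t a b * inner (e k R) (e k (take j K ++ drop j.+1 K)) : rat^o)).
  apply: eq_minor2 => a b R; rewrite /G.
  apply: etrans (f_equal (GRing.mul _) (laplaceC _ _ sK)) _.
  rewrite mulr_sumr; apply: eq_bigr => j _; rewrite eq_sym -[RHS]/(_ * _).
  by move: (inner _ _) => q; ring.
apply: etrans E _; rewrite -minor2_sum /minor1 mulr_suml; apply: eq_bigr => j _.
set q := minor2 _ _; rewrite -[LHS]/((-1) ^+ j * q) -[RHS]/((-1) ^+ j * (2 * q) / 2).
by field.
Qed.

End Stable.

Lemma inversions_succ s : inversions (map succn s) = inversions s.
Proof.
elim: s => // a s IH; rewrite map_cons !inversions_cons IH count_map; congr (_ + _)%N.
Qed.

Section Stable.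
Variables (k : nat) (t : lie_kind).
Implicit Types (z : chain k) (I s : seq nat).

Lemma cf_shift z s : cf (shift z) (map succn s) = cf z s.
Proof.
apply: esym; apply: etrans (cf_expand _ _) _.
rewrite /cf /shift /linear_extension inner_suml; apply: eq_bigr => I _.
apply: esym; apply: etrans (innerZl _ _ _) _; apply: (f_equal (GRing.mul z@_I)).
apply: etrans (inner_e _ _ _) _; apply: esym; apply: etrans (inner_e _ _ _) _.
have [kI _] := andP (valP I).
have kI' : all (leq k) (map succn (sval I)).
  by apply/allP => _ /mapP[a aI ->]; apply: leqW; exact: (allP kI).
have uI : uniq (map succn (sval I)) = uniq (sval I) by rewrite map_inj_uniq //; exact: succn_inj.
have pI : perm_eq (map succn (sval I)) (map succn s) = perm_eq (sval I) s.
  by apply/idP/idP => [/(perm_map_inj succn_inj)|/(perm_map succn)].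
by rewrite kI kI' uI pI !inversions_succ.
Qed.

Lemma cf_shift0 z s : 0%N \in s -> cf (shift z) s = 0.
Proof.
move=> s0; rewrite /cf /shift /linear_extension inner_suml big1 // => I _.
apply: etrans (innerZl _ _ _) _; rewrite (_ : inner _ _ = 0) ?mulr0 //.
apply: etrans (inner_e _ _ _) _.
have nP : perm_eq (map succn (sval I)) s = false.
  by apply/negP => /perm_mem /(_ 0%N); rewrite s0 => /mapP[].
by rewrite nP !andbF.
Qed.

Lemma cf_iter_shift r z s : cf (iter r (@shift k) z) (map (addn r) s) = cf z s.
Proof.
elim: r z s => [|r IH] z s; first by rewrite (eq_map (g := id)) ?map_id.
have -> : map (addn r.+1) s = map succn (map (addn r) s) by rewrite -map_comp; apply: eq_map.
by rewrite iterS cf_shift IH.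
Qed.

Lemma cf_iter_shift0 r z s : has (fun a => a < r)%N s -> cf (iter r (@shift k) z) s = 0.
Proof.
elim: r z s => [|r IH] z s; first by rewrite has_pred0.
move=> hs; have [s0|s0] := boolP (0%N \in s); first by rewrite iterS cf_shift0.
have es : s = map succn (map predn s).
  rewrite -map_comp -[LHS]map_id; apply/eq_in_map => a aS /=.
  by case: a aS => // a0; rewrite a0 in s0.
rewrite iterS es cf_shift IH // has_map.
move/hasP: hs => [[|a] aS ar]; first by rewrite aS in s0.
by apply/hasP; exists a.+1.
Qed.

Section Translate.
Variables (r : nat) (F F' : seq nat -> rat).
Hypothesis F0 : forall s, has (fun a => a < r)%N s -> F' s = 0.
Hypothesis FF : forall s, F' (map (addn r) s) = F s.

(** The structure constants depend on differences only, so translating all letters by r merely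
    raises the sum of a pair by 2r. *)
Lemma Y_translate m s : (2 * r <= m)%N -> Y t m F' (map (addn r) s) = Y t (m - 2 * r) F s.
Proof.
move=> rm; rewrite !Y_single.
pose H a := mm t a (m - a) * F' [:: a, (m - a)%N & map (addn r) s].
have H0 a : (a < r)%N || (m - a < r)%N -> H a = 0.
  by move=> h; rewrite /H F0 ?mulr0 //= orbA h.
rewrite -(big_mkord xpredT H) (@big_cat_nat _ _ _ r) //=; last by lia.
rewrite [X in X + _]big_nat_cond [X in X + _]big1 ?add0r; last first.
  by move=> a /andP[/andP[_ ar] _]; rewrite H0 ?ar.
rewrite (@big_cat_nat _ _ _ (m - r).+1) //=; try lia.
rewrite [X in _ + X]big_nat_cond [X in _ + X]big1 ?addr0; last first.
  by move=> a ha; rewrite H0 //; apply/orP; right; lia.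
rewrite -{1}[r]add0n big_addn -(big_mkord xpredT (fun a => mm t a (m - 2 * r - a) * F [:: a, (m - 2 * r - a)%N & s])).
rewrite (_ : ((m - r).+1 - r)%N = (m - 2 * r).+1); last by lia.
apply: eq_big_nat => a /andP[_ am]; rewrite /H.
have -> : (m - (a + r) = r + (m - 2 * r - a))%N by lia.
rewrite addnC -[[:: _, _ & _]]/(map (addn r) [:: a, (m - 2 * r - a)%N & s]) FF.
by congr (_ * _); rewrite /mm; congr (mu _ _); lia.
Qed.

Lemma Y_translate0 m s : (m < 2 * r)%N || has (fun a => a < r)%N s -> Y t m F' s = 0.
Proof.
move=> h; rewrite Y_single; apply: big1 => a _.
rewrite F0 ?mulr0 //=; case/orP: h => [h|->]; last by rewrite !orbT.
by rewrite orbA; apply/orP; left; lia.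
Qed.

Lemma Y_translate_stable : (forall m s, Y t m F s = 0) -> forall m s, Y t m F' s = 0.
Proof.
move=> YF m s.
have [h|h] := boolP ((m < 2 * r)%N || has (fun a => a < r)%N s); first exact: Y_translate0.
move: h; rewrite negb_or -leqNgt => /andP[rm /hasPn hs].
have -> : s = map (addn r) (map (subn^~ r) s).
  rewrite -map_comp -[LHS]map_id; apply/eq_in_map => a /hs /=; rewrite -leqNgt => ra.
  by rewrite subnKC.
by rewrite Y_translate.
Qed.
End Translate.

Lemma StabP z : Stab t z <-> forall m s, Y t m (cf z) s = 0.
Proof.
split=> [Sz m|Yz r].
  apply: (@alt_ext k _ (fun=> 0)); [exact: alt_Y (alt_cf _) | by split=> *; rewrite ?oppr0 |].
  (* For this r all parts of r + s are below 2r, while two letters of sigma^r z sum to at least 2r.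
     In the expansion of the boundary along K only the last part m + 2r therefore contributes. *)
  move=> s ss; pose r := (sumn s + k).+1.
  have sr a : a \in s -> (a < r)%N by move=> /leq_sumn; rewrite /r; lia.
  have kr : (k <= r)%N by rewrite /r; lia.
  clearbody r; pose R := map (addn r) s; pose K := rcons R (m + 2 * r)%N.
  have sK : strict k K.
    case/andP: ss => /allP ks so; apply/andP; split.
      rewrite all_rcons; apply/andP; split; last first.
        by apply/allP => _ /mapP[a /ks ka ->]; exact: leq_trans ka (leq_addl _ _).
      by lia.
    rewrite /K /R /=.
    have so' : sorted ltn (map (addn r) s).
      by rewrite sorted_map; apply: sub_sorted so => a b /=; rewrite ltn_add2l.
    rewrite (sorted_pairwise ltn_trans) pairwise_rcons -(sorted_pairwise ltn_trans) so' andbT.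
    by apply/allP => _ /mapP[b /sr br ->]; lia.
  have := boundary_cf t (iter r (@shift k) z) sK.
  rewrite {1}/cf Sz inner0l => /esym/eqP; rewrite mulf_eq0 invr_eq0 orbF => /eqP.
  rewrite /minor1 size_rcons big_nat_recr //= big_nat_cond big1 ?add0r; last first.
    move=> i /andP[/andP[_ iR] _].
    have iK : (nth 0%N K i < 2 * r)%N.
      rewrite /K nth_rcons iR; have : nth 0%N R i \in R by apply: mem_nth.
      by case/mapP => a /sr ar ->; lia.
    by rewrite (Y_translate0 (@cf_iter_shift0 r z)) ?iK ?scaler0.
  rewrite /K nth_rcons ltnn eqxx -cats1 take_size_cat // drop_oversize ?size_cat ?addn1 // cats0.
  rewrite (Y_translate (@cf_iter_shift0 r z) (@cf_iter_shift r z)) ?addnK; last by lia.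
  by move/eqP; rewrite -[_ *: _]/(_ * _) mulf_eq0 expf_eq0 oppr_eq0 oner_eq0 andbF => /eqP.
have Yr := Y_translate_stable (@cf_iter_shift0 r z) (@cf_iter_shift r z) Yz.
apply: cf_inj; apply: (@alt_ext k); [exact: alt_cf | exact: alt_cf |] => K sK.
rewrite (boundary_cf _ _ sK) [RHS]inner0l /minor1 big1 ?mul0r // => i _.
by rewrite Yr scaler0.
Qed.

End Stable.

(** * Stable chains from polynomials *)

Module StablePolynomials.
Import fingroup perm mpoly.

(** * Least exponents for dominance *)

Section Lead.
Variable n : nat.
Implicit Types (p q : mpoly n rat) (m a : 'X_{1..n}).

Definition psum m (r : nat) : nat := (\sum_(i < n | (i < r)%N) m i)%N.

Definition above m a : Prop :=
  (forall r, (psum m r <= psum a r)%N) /\ psum m n = psum a n.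

(** The value v may be 0, when m is only a lower bound for the exponents; this makes the notion
    stable under sums. *)
Definition lead p m (v : rat) : Prop :=
  mcoeff m p = v /\ forall a, mcoeff a p != 0 -> above m a.

Lemma psum_full m : psum m n = (\sum_(i < n) m i)%N.
Proof. by apply: eq_bigl => i; exact: ltn_ord. Qed.

Lemma psumD m a r : psum (m + a)%MM r = (psum m r + psum a r)%N.
Proof. by rewrite /psum -big_split /=; apply: eq_bigr => i _; rewrite mnmDE. Qed.

Lemma psum_inj m a : psum m =1 psum a -> m = a.
Proof.
move=> h; apply/mnmP => i.
have S b : psum b i.+1 = (psum b i + b i)%N.
  rewrite /psum (bigD1 i) ?ltnSn //= addnC; congr (_ + _)%N.
  by apply: eq_bigl => j; rewrite ltnS leq_eqVlt -val_eqE /=; case: ltngtP.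
by have := h i.+1; rewrite !S h => /addnI.
Qed.

Lemma lead0 m : lead 0 m 0.
Proof. by split=> [|a]; rewrite mcoeff0 ?eqxx. Qed.

Lemma leadD p q m v w : lead p m v -> lead q m w -> lead (p + q) m (v + w).
Proof.
move=> [pv pa] [qw qa]; split=> [|a]; rewrite mcoeffD ?pv ?qw //.
have [/pa //|/negbNE/eqP->] := boolP (mcoeff a p != 0).
by rewrite add0r => /qa.
Qed.

Lemma leadZX c m a : above m a -> lead (c *: 'X_[a]) m (c * (a == m)%:R).
Proof.
move=> ma; split=> [|b]; rewrite mcoeffZ mcoeffX //.
by case: (a =P b) => [<- //|_]; rewrite mulr0 eqxx.
Qed.

Lemma lead_sum (T : Type) (s : seq T) (P : pred T) (F : T -> mpoly n rat) m (v : T -> rat) :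
  (forall i, P i -> lead (F i) m (v i)) ->
  lead (\sum_(i <- s | P i) F i) m (\sum_(i <- s | P i) v i).
Proof.
move=> h; elim/big_rec2: _ => [|i y x Pi xy]; first exact: lead0.
by apply: leadD; first exact: h.
Qed.

Lemma lead1 : lead 1 0%MM 1.
Proof.
split=> [|a]; first by rewrite mcoeff1 eqxx.
rewrite mcoeff1; case: (a =P 0%MM) => [->|_]; last by rewrite eqxx.
by move=> _.
Qed.

Lemma mcoeffM_neq0 p q a : mcoeff a (p * q) != 0 ->
  exists b c, [/\ a = (b + c)%MM, mcoeff b p != 0 & mcoeff c q != 0].
Proof.
rewrite -mcoeff_msupp => /msuppM_le /allpairsP[[b c] /= [bp cq ->]].
by exists b, c; rewrite -!mcoeff_msupp.
Qed.

(** Partial sums are additive, so m + a arises only from the exponents m and a. Subtracting both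
    lead terms leaves products in which it does not occur. *)
Lemma leadM p q m a v w : lead p m v -> lead q a w -> lead (p * q) (m + a)%MM (v * w).
Proof.
move=> [pv pm] [qw qa]; split; last first.
  move=> b /mcoeffM_neq0[b1 [b2 [-> /pm[h1 e1] /qa[h2 e2]]]].
  by split=> [r|]; rewrite !psumD ?e1 ?e2 ?leq_add.
have E b c : mcoeff b p != 0 -> mcoeff c q != 0 -> (m + a = b + c)%MM -> b = m /\ c = a.
  move=> /pm[h1 _] /qa[h2 _] e.
  have bm : b = m.
    apply: psum_inj => r; have := h1 r; have := h2 r.
    by have := congr1 (psum^~ r) e; rewrite !psumD; lia.
  split=> //; apply: (@addmI _ m); by rewrite e bm.
have ez (p' q' : mpoly n rat) : (forall b, mcoeff b p' != 0 -> mcoeff b p != 0) ->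
    (forall b, mcoeff b q' != 0 -> mcoeff b q != 0) ->
    mcoeff m p' = 0 \/ mcoeff a q' = 0 -> mcoeff (m + a) (p' * q') = 0.
  move=> pp qq z; apply/eqP; apply: contraPT isT => /mcoeffM_neq0[b [c [ebc bp cq]]].
  have [eb ec] := E _ _ (pp _ bp) (qq _ cq) ebc.
  by move: bp cq; rewrite eb ec; case: z => ->; rewrite eqxx.
pose p' := p - v *: 'X_[m]; pose q' := q - w *: 'X_[a].
have -> : p * q = (v * w) *: 'X_[m + a] + (p' * q + (v *: 'X_[m]) * q').
  rewrite mpolyXD /p' /q' !mulrBl mulrBr -!scalerAl -!scalerAr scalerA; ring.
have p'0 : mcoeff m p' = 0 by rewrite mcoeffB mcoeffZ mcoeffX eqxx mulr1 pv subrr.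
have q'0 : mcoeff a q' = 0 by rewrite mcoeffB mcoeffZ mcoeffX eqxx mulr1 qw subrr.
rewrite !mcoeffD mcoeffZ mcoeffX eqxx mulr1 !ez ?addr0 //; try by [left | right].
- by move=> b; rewrite mcoeffZ mcoeffX; case: (_ =P b) => [<- | _]; rewrite ?mulr1 ?mulr0 ?eqxx ?pv.
- move=> b; rewrite mcoeffB mcoeffZ mcoeffX; case: (_ =P b) => [<- | _]; last by rewrite mulr0 subr0.
  by rewrite mulr1 qw subrr eqxx.
- move=> b; rewrite mcoeffB mcoeffZ mcoeffX; case: (_ =P b) => [<- | _]; last by rewrite mulr0 subr0.
  by rewrite mulr1 pv subrr eqxx.
Qed.

Lemma lead_prod (T : Type) (s : seq T) (P : pred T) (F : T -> mpoly n rat) (m : T -> 'X_{1..n}) :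
  (forall i, P i -> lead (F i) (m i) 1) ->
  lead (\prod_(i <- s | P i) F i) (\sum_(i <- s | P i) m i)%MM 1.
Proof.
move=> h; elim/big_rec2: _ => [|i y x Pi xy]; first exact: lead1.
by rewrite -[1]mulr1; apply: leadM xy; exact: h.
Qed.

Definition mperm (s : 'S_n) m : 'X_{1..n} := [multinom m (s i) | i < n].

(* Every prefix of a sorted exponent vector has the least sum among all
   subsets of its size; [T] separates the prefix from the rest. *)
Lemma above_mperm (s : 'S_n) m : (forall i j : 'I_n, (i <= j)%N -> (m i <= m j)%N) ->
  above m (mperm s m).
Proof.
move=> mono; split=> [r|]; last first.
  rewrite !psum_full [LHS](reindex_inj (@perm_inj _ s)).
  by apply: eq_bigr => i _; rewrite mnmE.
have [T Tlo Thi] : exists2 T : nat, (forall j : 'I_n, (j < r)%N -> (m j <= T)%N) &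
    (forall j : 'I_n, (r <= j)%N -> (T <= m j)%N).
  have [rn|nr] := ltnP r n.
    exists (m (Ordinal rn)) => j jr; apply: mono => //; exact: ltnW.
  exists (\sum_(j < n) m j)%N => j jr; last by have := ltn_ord j; lia.
  by rewrite (bigD1 j) //= leq_addr.
have card : (\sum_(j < n | (s^-1 j < r)%g%N) T = \sum_(j < n | (j < r)%N) T)%N.
  rewrite (reindex_inj (@perm_inj _ s)) /=; apply: eq_bigl => j; by rewrite permK.
have -> : psum (mperm s m) r = (\sum_(j < n | (s^-1 j < r)%g%N) m j)%N.
  rewrite (reindex_inj (@perm_inj _ s)) /=; apply: eq_big => j; first by rewrite permK.
  by rewrite mnmE.
rewrite -(leq_add2r (\sum_(j < n | (j < r)%N) T)%N) -{1}card /psum.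
rewrite ![(\sum_(j < n | _) _)%N]big_mkcond -!big_split /=; apply: leq_sum => j _.
by have := Tlo j; have := Thi j; case: (ltnP j r) => jr; case: ifP => _; lia.
Qed.

Definition orbit_sum m : mpoly n rat := \sum_(s : 'S_n) 'X_[mperm s m].

(** The coefficient v counts the permutations fixing m, among them the identity. *)
Lemma lead_orbit_sum m : (forall i j : 'I_n, (i <= j)%N -> (m i <= m j)%N) ->
  exists2 v, v != 0 & lead (orbit_sum m) m v.
Proof.
move=> mono; exists (\sum_(s : 'S_n) 1 * (mperm s m == m)%:R); last first.
  apply: lead_sum => s _; rewrite -['X_[_]]scale1r.
  by apply: leadZX; exact: above_mperm.
rewrite (bigD1 1%g) //= (_ : mperm 1%g m = m) ?eqxx ?mulr1; last first.
  by apply/mnmP => i; rewrite mnmE perm1.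
apply: lt0r_neq0; apply: ltr_wpDr => //; apply: sumr_ge0 => s _.
by rewrite mul1r ler0n.
Qed.

Lemma msym_orbit_sum (s : 'S_n) m : msym s (orbit_sum m) = orbit_sum m.
Proof.
rewrite /orbit_sum raddf_sum (reindex_inj (mulgI s)) /=; apply: eq_bigr => u _.
rewrite msymX; congr 'X_[_]; apply/mnmP => i; rewrite !mnmE permM permKV.
by [].
Qed.

End Lead.

Lemma vandermonde_perm (R : comNzRingType) n (a : 'I_n -> R) (s : 'S_n) :
  \prod_(i < n) \prod_(j < n | (i < j)%N) (a (s j) - a (s i)) =
  (-1) ^+ s * \prod_(i < n) \prod_(j < n | (i < j)%N) (a j - a i).
Proof.
pose r : 'rV[R]_n := \row_i a i; pose rs : 'rV[R]_n := \row_i a (s i).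
have -> : \prod_(i < n) \prod_(j < n | (i < j)%N) (a (s j) - a (s i)) = \det (Vandermonde n rs).
  by rewrite det_Vandermonde; do 2![apply: eq_bigr => ? _]; rewrite !mxE.
have -> : \prod_(i < n) \prod_(j < n | (i < j)%N) (a j - a i) = \det (Vandermonde n r).
  by rewrite det_Vandermonde; do 2![apply: eq_bigr => ? _]; rewrite !mxE.
have -> : Vandermonde n rs = col_perm s (Vandermonde n r).
  by apply/matrixP => i j; rewrite !mxE.
by rewrite col_permE det_mulmx det_perm odd_permV mulrC.
Qed.

(* Both are divisible by (y - x) (x^2 + quad_coef x y + y^2); the quadratic factor
   makes the coefficients stable, see [mm_quad]. *)
Definition factor (t : lie_kind) (R : pzRingType) (x y : R) : R :=
  match t with Lwitt => (y - x) ^+ 3 | Lmod3 => y ^+ 3 - x ^+ 3 end.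

Definition skew n (t : lie_kind) : mpoly n rat :=
  \prod_(i < n) \prod_(j < n | (i < j)%N) factor t ('X_i : mpoly n rat) 'X_j.

Lemma msymXU n (s : 'S_n) (i : 'I_n) : msym s ('X_i : mpoly n rat) = 'X_(s i).
Proof.
rewrite msymX; congr 'X_[_]; apply/mnmP => j; rewrite mnmE !mnm1E.
by rewrite -(inj_eq (@perm_inj _ s)) permKV.
Qed.

Lemma msym_skew n t (s : 'S_n) : msym s (skew n t) = (-1) ^+ s * skew n t.
Proof.
rewrite /skew rmorph_prod.
under eq_bigr do rewrite rmorph_prod.
case: t; rewrite /factor.
  under eq_bigr do under eq_bigr do rewrite rmorphXn rmorphB /= !msymXU.
  under eq_bigr do rewrite prodrXl.
  under [in RHS]eq_bigr do rewrite prodrXl.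
  rewrite !prodrXl.
  rewrite (vandermonde_perm (fun i : 'I_n => 'X_i : mpoly n rat)) exprMn.
  (* The cube of the sign of a permutation is the sign itself. *)
  by rewrite -exprM -[in LHS]signr_odd oddM oddb andbT.
under eq_bigr do under eq_bigr do rewrite rmorphB !rmorphXn /= !msymXU.
exact: (vandermonde_perm (fun i : 'I_n => ('X_i : mpoly n rat) ^+ 3)).
Qed.

(** Among the monomials of degree 3 in the variables i < j, the cube of the later variable has the
    smallest partial sums; its coefficient is 1 for both kinds. *)
Lemma lead_factor n t (i j : 'I_n) : (i < j)%N ->
  lead (factor t ('X_i : mpoly n rat) 'X_j) (U_(j) *+ 3)%MM 1.
Proof.
move=> ij.
have ab (b c : nat) : (b + c = 3)%N -> above (U_(j) *+ 3)%MM (U_(i) *+ b + U_(j) *+ c)%MM.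
  move=> bc.
  have P (u : 'I_n) d r : psum (U_(u) *+ d)%MM r = if (u < r)%N then d else 0%N.
    rewrite /psum; case: ifP => ur.
      rewrite (bigD1 u) //= mulmnE mnm1E eqxx mul1n big1 ?addn0 // => v /andP[_ vu].
      by rewrite mulmnE mnm1E eq_sym (negbTE vu) mul0n.
    rewrite big1 // => v vr; rewrite mulmnE mnm1E; case: eqP => [uv|]; last by rewrite mul0n.
    by rewrite uv vr in ur.
  split=> [r|]; rewrite psumD !P ?ltn_ord; last by lia.
  by case: (ltnP j r) => jr; case: (ltnP i r) => ir; lia.
have ne (b c : nat) : (0 < b)%N -> ((U_(i) *+ b + U_(j) *+ c)%MM == (U_(j) *+ 3)%MM) = false.
  move=> b0; apply/negP => /eqP/mnmP/(_ i); rewrite mnmDE !mulmnE !mnm1E eqxx.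
  by rewrite -val_eqE /= (gtn_eqF ij); lia.
have XX (b c : nat) : 'X_[U_(i) *+ b + U_(j) *+ c] = 'X_i ^+ b * 'X_j ^+ c :> mpoly n rat.
  by rewrite mpolyXD !mpolyXn.
have L (d : rat) b c : (b + c = 3)%N -> lead (d *: ('X_i ^+ b * 'X_j ^+ c)) (U_(j) *+ 3)%MM (d * (b == 0)%N%:R).
  move=> bc; rewrite -XX; have -> : (b == 0)%N = ((U_(i) *+ b + U_(j) *+ c)%MM == (U_(j) *+ 3)%MM).
    case: b bc => [|b _]; last by rewrite ne.
    rewrite add0n => ->; symmetry; apply/eqP/mnmP => u; by rewrite mnmDE !mulmnE muln0.
  by apply: leadZX; exact: ab.
case: t; rewrite /factor.
  have -> : ('X_j - 'X_i : mpoly n rat) ^+ 3 =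
     1 *: ('X_i ^+ 0 * 'X_j ^+ 3) + ((- 3%:R) *: ('X_i ^+ 1 * 'X_j ^+ 2)
      + (3%:R *: ('X_i ^+ 2 * 'X_j ^+ 1) + (-1) *: ('X_i ^+ 3 * 'X_j ^+ 0))).
    by rewrite !scaleNr !scaler_nat !scale1r; ring.
  rewrite (_ : (1 : rat) = 1 * (0 == 0)%N%:R + (- 3%:R * (1 == 0)%N%:R + (3%:R * (2 == 0)%N%:R + -1 * (3 == 0)%N%:R))) //.
  by do !apply: leadD; exact: L.
have -> : 'X_j ^+ 3 - 'X_i ^+ 3 = 1 *: ('X_i ^+ 0 * 'X_j ^+ 3) + (-1) *: ('X_i ^+ 3 * 'X_j ^+ 0) :> mpoly n rat.
  by rewrite scaleN1r scale1r; ring.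
rewrite (_ : (1 : rat) = 1 * (0 == 0)%N%:R + -1 * (3 == 0)%N%:R) //.
by apply: leadD; exact: L.
Qed.

(** Variable j is the later one in j pairs and receives the exponent 3 from each. *)
Lemma lead_skew n t : lead (skew n t) [multinom 3 * i | i < n] 1.
Proof.
have -> : [multinom (3 * i)%N | i < n] = (\sum_(i < n) \sum_(j < n | (i < j)%N) U_(j) *+ 3)%MM.
  apply/mnmP => l; rewrite mnmE mnm_sumE.
  under eq_bigr do rewrite mnm_sumE.
  rewrite (eq_bigr (fun i : 'I_n => if (i < l)%N then 3 else 0)%N); last first.
    move=> i _; case: ifP => il.
      rewrite (bigD1 l) //= mulmnE mnm1E eqxx mul1n big1 // => v /andP[_ vl].
      by rewrite mulmnE mnm1E (negbTE vl) mul0n.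
    rewrite big1 // => v iv; rewrite mulmnE mnm1E; case: eqP => [vl|]; last by rewrite mul0n.
    by rewrite -vl iv in il.
  rewrite -big_mkcond -(big_ord_widen n (fun=> 3%N)) ?sum_nat_const ?card_ord 1?mulnC //.
  exact: ltnW.
apply: lead_prod => i _; apply: lead_prod => j ij; exact: lead_factor.
Qed.

Definition stable_poly n t (m : 'X_{1..n}) : mpoly n rat := skew n t * orbit_sum m.

Lemma lead_stable_poly n t (m : 'X_{1..n}) : (forall i j : 'I_n, (i <= j)%N -> (m i <= m j)%N) ->
  exists2 v, v != 0 & lead (stable_poly t m) ([multinom 3 * i | i < n] + m)%MM v.
Proof.
move=> mono; have [v v0 lv] := lead_orbit_sum mono; exists v => //.
by rewrite -[v]mul1r; apply: leadM lv; exact: lead_skew.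
Qed.

Lemma msym_stable_poly n t (m : 'X_{1..n}) (s : 'S_n) :
  msym s (stable_poly t m) = (-1) ^+ s * stable_poly t m.
Proof. by rewrite /stable_poly msymM msym_skew msym_orbit_sum mulrA. Qed.

Definition exps n (s : seq nat) : 'X_{1..n} := [multinom nth 0%N s i | i < n].

Definition coefs n (p : mpoly n rat) (s : seq nat) : rat :=
  if size s == n then mcoeff (exps n s) p else 0.

Lemma alt_coefs n (p : mpoly n rat) : (forall s : 'S_n, msym s p = (-1) ^+ s * p) ->
  alt 0 (coefs p).
Proof.
move=> ap; split=> [A x y B|s]; last by rewrite has_pred0.
rewrite /coefs !size_cat /=; case: eqP => [sn|_]; last by rewrite oppr0.
have An : (size A < n)%N by lia.
have An' : ((size A).+1 < n)%N by lia.
pose i : 'I_n := Ordinal An; pose j : 'I_n := Ordinal An'.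
have ij : i != j by rewrite -val_eqE /= ltn_eqF.
have := congr1 (mcoeff (exps n (A ++ x :: y :: B))) (ap (tperm i j)).
rewrite mcoeff_sym odd_tperm ij expr1 mulN1r mcoeffN => /(congr1 (@GRing.opp _)).
rewrite opprK => <-; congr (- mcoeff _ p); apply/mnmP => l; rewrite !mnmE !nth_cat.
case: tpermP => [->|->|/eqP li /eqP lj] /=.
- by rewrite ltnn subnn ltnNge leqnSn subSnn.
- by rewrite ltnn subnn ltnNge leqnSn subSnn.
have := li; have := lj; rewrite -!val_eqE /=.
by case: ltnP => // Al; case: (l - size A)%N (subnKC Al) => [|[|d]] //=; lia.
Qed.

Definition quad_coef (t : lie_kind) : rat := match t with Lwitt => - 2%:R | Lmod3 => 1 end.

(** A second difference of a linear function for [Lwitt]; the sum of eps over three distinct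
    residues for [Lmod3]. *)
Lemma mm_quad t x y :
  mm t x.+2 y + quad_coef t * mm t x.+1 y.+1 + mm t x y.+2 = 0.
Proof.
case: t.
  by rewrite !mm_witt /= -[x.+2]addn2 -[y.+2]addn2 -[x.+1]addn1 -[y.+1]addn1 !natrD; ring.
have S1 z : (z.+1 %% 3 = (z %% 3).+1 %% 3)%N by lia.
have S2 z : (z.+2 %% 3 = (z %% 3).+2 %% 3)%N by lia.
by rewrite !mm_mod3 /= (S2 x) (S2 y) (S1 x) (S1 y); case: (mod3P x) => ->; case: (mod3P y) => ->; rewrite /=; ring.
Qed.

(** * Stability of the coefficients *)

Section Stability.
Variables (t : lie_kind) (n : nat).
Let o0 : 'I_n.+2 := ord0.
Let o1 : 'I_n.+2 := lift ord0 ord0.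

Definition quad : mpoly n.+2 rat :=
  'X_o0 ^+ 2 + quad_coef t *: ('X_o0 * 'X_o1) + 'X_o1 ^+ 2.

Lemma skew_quad : exists h, skew n.+2 t = quad * h.
Proof.
have fq : exists g, factor t ('X_o0 : mpoly n.+2 rat) 'X_o1 = quad * g.
  exists ('X_o1 - 'X_o0); rewrite /quad; case: t; rewrite /factor /quad_coef.
    by rewrite scaleNr scaler_nat; ring.
  by rewrite scale1r; ring.
have [g fg] := fq; rewrite /skew (bigD1 o0) //= (bigD1 o1) //= fg.
by rewrite -!mulrA; eexists.
Qed.

Definition rest_eq m (s : seq nat) (v : 'X_{1..n.+2}) : bool :=
  (v o0 + v o1 == m)%N && [forall i : 'I_n, v (lift ord0 (lift ord0 i)) == nth 0%N s i].

Lemma Y_coefsX m s v : size s = n ->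
  Y t m (coefs ('X_[v] : mpoly n.+2 rat)) s = (rest_eq m s v)%:R * mm t (v o0) (v o1).
Proof.
move=> sn; rewrite Y_single.
have ee a : (v == exps n.+2 [:: a, (m - a)%N & s]) =
    [&& v o0 == a, v o1 == (m - a)%N & [forall i : 'I_n, v (lift ord0 (lift ord0 i)) == nth 0%N s i]].
  apply/eqP/and3P => [->|[/eqP e0 /eqP e1 /forallP e2]].
    by rewrite !mnmE; split=> //; apply/forallP => i; rewrite mnmE.
  apply/mnmP => i; rewrite mnmE; case: (unliftP ord0 i) => [j ->|->] //.
  case: (unliftP ord0 j) => [l ->|->] //=.
  by apply/eqP; exact: e2.
pose H a := mm t a (m - a) * coefs ('X_[v] : mpoly n.+2 rat) [:: a, (m - a)%N & s].
have HE a : H a = (mm t a (m - a)) * (v == exps n.+2 [:: a, (m - a)%N & s])%:R.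
  by rewrite /H /coefs /= sn eqxx mcoeffX.
rewrite /rest_eq; case: andP => [[/eqP vm vs]|nv].
  have v0 : (v o0 < m.+1)%N by lia.
  rewrite mul1r -/(H _) (@sum_ind _ m.+1 (v o0) H) //.
    by rewrite HE ee eqxx vs (_ : (m - v o0)%N = v o1) ?eqxx ?mulr1 //; lia.
  by move=> a _ av; rewrite HE ee eq_sym (negbTE av) mulr0.
rewrite mul0r big1 // => a _; rewrite -/(H _) HE ee.
case: and3P => [[/eqP e0 /eqP e1 e2]|_]; last by rewrite mulr0.
by case: nv; split=> //; rewrite e0 e1 subnKC // -ltnS.
Qed.

Lemma Y_coefs_sum (T : Type) (r : seq T) (c : T -> rat) (F : T -> mpoly n.+2 rat) m s :
  Y t m (coefs (\sum_(i <- r) c i *: F i)) s = \sum_(i <- r) c i * Y t m (coefs (F i)) s.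
Proof.
rewrite -Y_linear; apply: Y_ext => s'; rewrite /coefs; case: ifP => _.
  by rewrite raddf_sum /=; apply: eq_bigr => i _; exact: mcoeffZ.
by rewrite big1 // => i _; rewrite mulr0.
Qed.

(** For a monomial of h, the three terms of [quad] contribute under one and the same condition on m
    and s, with exponents (x + 2, y), (x + 1, y + 1), (x, y + 2) in the first two variables;
    [mm_quad] sums them to 0. *)
Lemma Y_coefs_quad h m s : Y t m (coefs (quad * h)) s = 0.
Proof.
have [sn|sn] := eqVneq (size s) n; last first.
  rewrite Y_single big1 // => a _; rewrite /coefs /= !eqSS (negbTE sn); exact: mulr0.
rewrite (mpolyE h) mulr_sumr.
under [X in coefs X]eq_bigr do rewrite -scalerAr.
rewrite Y_coefs_sum big1 // => u _; apply/eqP; rewrite mulf_eq0; apply/orP; right.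
have val (a b : nat) i : (U_(o0) *+ a + U_(o1) *+ b + u)%MM i = ((o0 == i) * a + (o1 == i) * b + u i)%N.
  by rewrite !mnmDE !mulmnE !mnm1E.
have XE (a b : nat) : 'X_[U_(o0) *+ a + U_(o1) *+ b + u] = 'X_o0 ^+ a * 'X_o1 ^+ b * 'X_[u] :> mpoly n.+2 rat.
  by rewrite !mpolyXD !mpolyXn.
have qE : quad * 'X_[u] = \sum_(p <- [:: (1 : rat, (2, 0)%N); (quad_coef t, (1, 1)%N); (1 : rat, (0, 2)%N)])
    p.1 *: 'X_[U_(o0) *+ p.2.1 + U_(o1) *+ p.2.2 + u].
  rewrite !big_cons big_nil !XE /= !scale1r addr0 /quad !mulrDl -scalerAl !expr0 !expr1 mulr1 mul1r.
  by rewrite addrA.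
rewrite qE Y_coefs_sum.
have rE (a b : nat) : (a + b = 2)%N -> rest_eq m s (U_(o0) *+ a + U_(o1) *+ b + u)%MM =
   ((u o0 + u o1 + 2 == m)%N && [forall i : 'I_n, u (lift ord0 (lift ord0 i)) == nth 0%N s i]).
  move=> ab; rewrite /rest_eq !val // eqxx /=; congr (_ && _).
    by congr (_ == _); rewrite /o0 /o1 /=; lia.
  by apply: eq_forallb => i; rewrite val.
rewrite !big_cons big_nil /= !Y_coefsX // !rE // !val //=.
have := mm_quad t (u o0) (u o1).
rewrite ?eqxx ?mul1n ?mul0n ?add0n ?addn0 ?add2n ?add1n.
move: (_ && _) => b hq; apply/eqP; transitivity (b%:R * (0 : rat)); last by rewrite mulr0.
by rewrite -[in RHS]hq; ring.
Qed.

End Stability.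

Lemma Y_stable_poly n t (u : 'X_{1..n}) m s : Y t m (coefs (stable_poly t u)) s = 0.
Proof.
case: n u => [|[|n]] u.
- by rewrite Y_single big1 // => a _; rewrite /coefs mulr0.
- by rewrite Y_single big1 // => a _; rewrite /coefs mulr0.
have [h sh] := skew_quad t n.
by rewrite /stable_poly sh -mulrA Y_coefs_quad.
Qed.

Lemma psum_exps n (s : seq nat) r : size s = n -> psum (exps n s) r = sumn (take r s).
Proof.
move=> sn; rewrite /psum sumnE (big_nth 0%N) big_mkord size_take sn.
under eq_bigr do rewrite mnmE.
case: ltnP => rn.
  rewrite -(big_ord_widen n (fun i => nth 0%N s i) (ltnW rn)).
  by apply: eq_bigr => i _; rewrite nth_take.
rewrite take_oversize ?sn //; apply: eq_bigl => i.
exact: leq_trans (ltn_ord i) rn.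
Qed.

Lemma sumn_take_translate k s r : all (leq k) s ->
  sumn (take r s) = (sumn (take r (map (subn^~ k) s)) + k * minn r (size s))%N.
Proof.
elim: s r => [|a s IH] [|r] //=; rewrite ?minn0 ?min0n ?muln0 //.
by move=> /andP[ka ks]; rewrite (IH r ks) minnSS mulnS; lia.
Qed.

Lemma translateK k s : all (leq k) s -> map (addn k) (map (subn^~ k) s) = s.
Proof.
move=> /allP ks; rewrite -map_comp -[RHS]map_id; apply/eq_in_map => a /ks /= ka.
by rewrite subnKC.
Qed.

(* The shift by [k] accounts for the letters starting at [k], the exponents at
   [0]. *)
Lemma stable_function k t (I : seq nat) : nonsingular k I ->
  exists F : seq nat -> rat, [/\ alt k F, forall m s, Y t m F s = 0, F I = 1 &
    forall s, F s != 0 -> [/\ size s = size I, sumn s = sumn I &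
      forall r, (sumn (take r I) <= sumn (take r s))%N]].
Proof.
move=> /andP[/andP[kI _] I3]; pose n := size I; pose I' := map (subn^~ k) I.
have gap i j : (i <= j)%N -> (j < n)%N -> (nth 0%N I i + 3 * (j - i) <= nth 0%N I j)%N.
  by move=> ij jn; have := gap3_nth I3 (i := i) (j := (j - i)%N); rewrite subnKC //; apply.
(* What I - k leaves after the exponent 3i of the skew factor. It is nondecreasing because the gaps
   of I are at least 3, and the subtraction is not truncated because I starts at k or later. *)
pose u : 'X_{1..n} := [multinom (nth 0%N I' i - 3 * i)%N | i < n].
have nthI i : (i < n)%N -> nth 0%N I' i = (nth 0%N I i - k)%N.
  by move=> iN; rewrite (nth_map 0%N).
have kn i : (i < n)%N -> (k + 3 * i <= nth 0%N I i)%N.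
  move=> iN; have := gap 0%N i (leq0n _) iN.
  have : (k <= nth 0%N I 0)%N by apply: (allP kI); apply: mem_nth; exact: leq_ltn_trans iN.
  lia.
have mono (i j : 'I_n) : (i <= j)%N -> (u i <= u j)%N.
  move=> ij; rewrite !mnmE !nthI //.
  have := gap _ _ ij (ltn_ord j); have := kn _ (ltn_ord i); lia.
have [v v0 [pv pl]] := lead_stable_poly t mono.
have uE : ([multinom 3 * i | i < n] + u)%MM = exps n I'.
  by apply/mnmP => i; rewrite mnmDE !mnmE nthI //; have := kn _ (ltn_ord i); lia.
rewrite uE in pv pl.
have sI' : size I' = n by rewrite size_map.
pose G s := v^-1 * coefs (stable_poly t u) s.
pose F s := if all (leq k) s then G (map (subn^~ k) s) else 0.
have aG : alt 0 G.
  have [aC _] := alt_coefs (msym_stable_poly t u).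
  by split=> [A x y B|s]; [rewrite /G aC mulrN | rewrite has_pred0].
have F0 s : has (fun a => a < k)%N s -> F s = 0.
  move=> h; rewrite /F ifF //; apply/negbTE; rewrite -has_predC.
  by apply: sub_has h => a /=; rewrite ltnNge.
have FF s : F (map (addn k) s) = G s.
  rewrite /F ifT; last by apply/allP => _ /mapP[a _ ->]; exact: leq_addr.
  by congr G; rewrite -map_comp -[RHS]map_id; apply: eq_map => a /=; rewrite addKn.
exists F; split.
- split=> // A x y B; have [h|h] := boolP (all (leq k) (A ++ x :: y :: B)).
    rewrite -(translateK h) FF.
    have h' : all (leq k) (A ++ y :: x :: B).
      by move: h; rewrite !all_cat /= => /and4P[-> -> -> ->].
    by rewrite -(translateK h') FF !map_cat /= (proj1 aG).
  rewrite /F (negbTE h) ifF ?oppr0 //; apply: contraNF h.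
  by rewrite !all_cat /= => /and4P[-> -> -> ->].
- apply: (Y_translate_stable F0 FF) => m s.
  rewrite Y_single; under eq_bigr do rewrite /G mulrCA.
  by rewrite -mulr_sumr -Y_single Y_stable_poly mulr0.
- by rewrite /F kI /G /coefs sI' eqxx pv mulVf.
move=> s; rewrite /F; case: ifP => [ks|_]; last by rewrite eqxx.
rewrite /G /coefs; case: ifP => [/eqP sn|_]; last by rewrite mulr0 eqxx.
rewrite mulf_eq0 negb_or => /andP[_ /pl[ab ae]].
rewrite size_map in sn; move: ae; rewrite !psum_exps ?size_map // -/I' => ae.
have tk (w : seq nat) : size w = n -> sumn (take n w) = sumn w by move=> <-; rewrite take_size.
split=> // [|r].
  by rewrite -(tk s sn) -(tk I erefl) (sumn_take_translate n ks) (sumn_take_translate n kI) ae sn.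
by have := ab r; rewrite !psum_exps ?size_map // (sumn_take_translate r ks) (sumn_take_translate r kI) sn leq_add2r.
Qed.

End StablePolynomials.

(** * The dual basis and the decomposition *)

Definition parts (D : nat) : seq (seq nat) :=
  undup [seq mask (m : D.+1.-tuple bool) (iota 0 D.+1) | m : D.+1.-tuple bool].

Lemma mem_parts D s : sorted ltn s -> (sumn s <= D)%N -> s \in parts D.
Proof.
move=> ss sD; rewrite mem_undup.
have sub : subseq s (iota 0 D.+1).
  have -> : s = [seq a <- iota 0 D.+1 | a \in s].
    apply: (irr_sorted_eq ltn_trans ltnn) => //.
      by apply: sorted_filter; [exact: ltn_trans | exact: iota_ltn_sorted].
    move=> a; rewrite mem_filter mem_iota add0n ltnS.
    by case as' : (a \in s) => //=; rewrite (leq_trans (leq_sumn as') sD).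
  exact: filter_subseq.
have /subseqP[m sm ->] := sub; rewrite size_iota in sm.
by apply/mapP; exists (tcast sm (in_tuple m)); rewrite ?mem_enum ?val_tcast.
Qed.

Lemma nonsingular_strict k s : nonsingular k s -> strict k s.
Proof.
move=> /andP[/andP[ks _] s3]; rewrite /strict ks /=.
by apply: sub_sorted s3 => a b /=; lia.
Qed.

Lemma strict_kpartition k s : strict k s -> kpartition k s.
Proof.
move=> /andP[ks ss]; rewrite /kpartition ks /=.
by apply: sub_sorted ss => a b; exact: ltnW.
Qed.

Lemma cf_e k K s : strict k K -> strict k s -> cf (e k K) s = (K == s)%:R.
Proof.
move=> sK ss.
have := cf_strict (e k K) (exist (fun s => strict k s) s ss); rewrite /= => ->.
rewrite -[K in e k K]/(sval (exist (fun s => strict k s) K sK)) e_strict mcoeffU.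
by congr (_%:R); rewrite -val_eqE.
Qed.

Lemma cfP k a (x y : chain k) s : cf (a *: x + y) s = a * cf x s + cf y s.
Proof. exact: innerPl. Qed.

Lemma cf_sum k (T : Type) (r : seq T) (c : T -> rat) (v : T -> chain k) s :
  cf (\sum_(i <- r) c i *: v i) s = \sum_(i <- r) c i * cf (v i) s.
Proof. by rewrite /cf inner_suml; apply: eq_bigr => i _; exact: innerZl. Qed.

Lemma sum_indicator (r : seq (seq nat)) (G : seq nat -> rat) s : uniq r ->
  \sum_(K <- r) G K * (K == s)%:R = if s \in r then G s else 0.
Proof.
move=> ur; case: ifP => sr.
  rewrite (bigD1_seq s) //= eqxx mulr1 big1 ?addr0 // => K Ks.
  by rewrite (negbTE Ks) mulr0.
rewrite big1_seq // => K /andP[_ Kr]; case: eqP => [Ks|]; last by rewrite mulr0.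
by rewrite -Ks Kr in sr.
Qed.

(** The inverse of [cf] on antisymmetric functions that vanish in degrees above [D]. *)
Definition chain_of k D (F : seq nat -> rat) : chain k :=
  \sum_(K <- [seq K <- parts D | strict k K]) F K *: e k K.

Lemma cf_chain_of k F D : alt k F -> (forall s, F s != 0 -> (sumn s <= D)%N) ->
  forall s, cf (chain_of k D F) s = F s.
Proof.
move=> aF FD.
apply: (@alt_ext k) => //; first exact: alt_cf.
move=> s ss; rewrite cf_sum.
have -> : \sum_(K <- [seq K <- parts D | strict k K]) F K * cf (e k K) s =
    \sum_(K <- [seq K <- parts D | strict k K]) F K * (K == s)%:R.
  by apply: eq_big_seq => K; rewrite mem_filter => /andP[sK _]; rewrite cf_e.
rewrite sum_indicator ?filter_uniq ?undup_uniq // mem_filter ss /=.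
case: ifP => // sD; apply/esym/eqP; apply: contraFT sD => /FD h.
by apply: mem_parts => //; case/andP: ss.
Qed.

(** * Stable chains with a prescribed nonsingular monomial *)

Section Assembly.
Variables (k : nat) (t : lie_kind).
Hypothesis k1 : (1 <= k)%N.
Implicit Types (f : chain k) (I : seq nat) (p : seq nat * {fset nat}).

(** The properties that identify e_hat_I: I is the only nonsingular monomial of f, which makes f
    dual to the unmarked xi-monomials. *)
Definition stable_lift I f : Prop :=
  [/\ Stab t f, cf f I = 1 & forall s, strict k s -> cf f s != 0 ->
    s = I \/ dominates s I /\ ~~ nonsingular k s].

Lemma Stab_subspace : subspace (Stab (k := k) t).
Proof.
split=> [|a x y /StabP Yx /StabP Yy].
  by apply/StabP => m s; rewrite Y_single big1 // => a _; rewrite /cf inner0l mulr0.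
apply/StabP => m s; rewrite Y_single; under eq_bigr do rewrite cfP mulrDr mulrCA.
by rewrite big_split /= -mulr_sumr -!Y_single Yx Yy mulr0 addr0.
Qed.

Lemma subspace_sum (V : lmodType rat) (W : V -> Prop) (T : eqType) (r : seq T) (c : T -> rat) (v : T -> V) :
  subspace W -> (forall i, i \in r -> W (v i)) -> W (\sum_(i <- r) c i *: v i).
Proof.
move=> [W0 WP]; elim: r => [|i r IH] h; first by rewrite big_nil.
by rewrite big_cons; apply: WP; [apply: h; rewrite mem_head | apply: IH => j jr; apply: h; rewrite inE jr orbT].
Qed.

(** A measure that increases strictly along dominance and is bounded in a fixed dimension and
    degree. *)
Definition depth I : nat := (\sum_(r < size I) sumn (take r I))%N.

Lemma sumn_take r I : (sumn (take r I) <= sumn I)%N.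
Proof. by rewrite -{2}(cat_take_drop r I) sumn_cat leq_addr. Qed.

Lemma depth_bound I : (depth I <= size I * sumn I)%N.
Proof.
rewrite -[X in (_ <= X * _)%N]card_ord -sum_nat_const.
by apply: leq_sum => r _; exact: sumn_take.
Qed.

Lemma dominates_depth I J : dominates J I -> (depth I < depth J)%N.
Proof.
move=> [JI sz sm le].
have le' r : (r < size I)%N -> (sumn (take r I) <= sumn (take r J))%N.
  by case: r => [|r] rI; [rewrite !take0 | apply: le].
rewrite /depth sz ltn_neqAle; apply/andP; split; last by apply: leq_sum => r _; exact: le'.
apply: contraNN JI => /eqP E; apply/eqP.
have eq_r r : sumn (take r J) = sumn (take r I).
  have [rI|Ir] := ltnP r (size I); last by rewrite !take_oversize ?sz.
  apply/eqP; rewrite eqn_leq le' // andbT leqNgt; apply/negP => lt.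
  suff : (\sum_(r < size I) sumn (take r I) < \sum_(r < size I) sumn (take r J))%N by rewrite E ltnn.
  rewrite (bigD1 (Ordinal rI)) //= [X in (_ < X)%N](bigD1 (Ordinal rI)) //= -addSn.
  by apply: leq_add => //; apply: leq_sum => u _; exact: le'.
apply: (@eq_from_nth _ 0%N) => // r rJ.
have rI : (r < size I)%N by rewrite -sz.
have := eq_r r.+1; rewrite (take_nth 0%N rJ) (take_nth 0%N rI) -!cats1 !sumn_cat /= eq_r; lia.
Qed.

Lemma dominates_trans I J K : dominates J I -> dominates K J -> K != I -> dominates K I.
Proof.
move=> [_ s1 m1 l1] [_ s2 m2 l2] KI; split; rewrite ?s2 ?m2 // => r r0 rI.
by apply: leq_trans (l1 r r0 rI) _; apply: l2; rewrite ?s1.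
Qed.

(* The other nonsingular monomials of [stable_function] dominate [I], so they
   can be eliminated by descending induction on [depth]. *)
Lemma stable_lift_exists I : nonsingular k I -> exists f, stable_lift I f.
Proof.
have [N] := ubnP (size I * sumn I - depth I)%N; elim: N I => // N IH I IN nI.
have [F [aF YF FI Fd]] := StablePolynomials.stable_function t nI.
have FD s : F s != 0 -> (sumn s <= sumn I)%N by case/Fd => _ ->.
have fE := cf_chain_of aF FD; set f := chain_of _ _ _ in fE; clearbody f.
pose L := [seq J <- parts (sumn I) | [&& nonsingular k J, J != I & F J != 0]].
have LP J : J \in L -> [/\ nonsingular k J, J != I, F J != 0 & dominates J I].
  rewrite mem_filter => /andP[/and3P[nJ JI FJ] _]; split=> //.
  by have [sz sm le] := Fd _ FJ; split.
pose C J := epsilon (inhabits (0 : chain k)) (stable_lift J).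
have CP J : J \in L -> stable_lift J (C J).
  move=> /LP[nJ _ _ dJ]; apply: epsilon_spec; apply: IH => //.
  have := dominates_depth dJ; have := depth_bound J; case: dJ => _ sz sm _.
  by move: IN; rewrite sz sm; lia.
pose c := (-1) *: (\sum_(J <- L) F J *: C J) + f.
have cE s : cf c s = F s - \sum_(J <- L) F J * cf (C J) s.
  apply: etrans (cfP _ _ _ _) _; rewrite fE mulN1r addrC; congr (_ - _); exact: cf_sum.
have uL : uniq L by rewrite filter_uniq ?undup_uniq.
have cN s : nonsingular k s -> cf c s = F s - (if s \in L then F s else 0).
  move=> ns; rewrite cE; congr (_ - _).
  have -> : \sum_(J <- L) F J * cf (C J) s = \sum_(J <- L) F J * (J == s)%:R.
    apply: eq_big_seq => J JL; congr (_ * _); have [_ CJ Cs] := CP J JL.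
    case: eqP => [<- //|Js]; apply/eqP; apply: contraPT isT => /(Cs _ (nonsingular_strict ns)) [sJ|[_]].
      by case: Js.
    by rewrite ns.
  by rewrite sum_indicator.
exists c; split.
- apply: (proj2 Stab_subspace); last by apply/StabP => m s; rewrite (Y_ext _ _ _ fE).
  by apply: subspace_sum; [exact: Stab_subspace | move=> J /CP[]].
- rewrite cN // FI ifF ?subr0 //; apply/negP => /LP[_]; by rewrite eqxx.
move=> s ss cs; have [->|sI] := eqVneq s I; [by left | right].
have ns : ~~ nonsingular k s.
  apply: contraNN cs => ns; rewrite cN // mem_filter ns sI /=.
  case: ifP => [_|]; first by rewrite subrr.
  rewrite subr0; have [//|Fs] := boolP (F s == 0); rewrite /= mem_parts ?FD //.
  by case/andP: ss.
split=> //; rewrite cE in cs.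
have [Fs|/negbNE/eqP Fs] := boolP (F s != 0); first by have [sz sm le] := Fd _ Fs; split.
(* Here s can only come from the lift of some J in L, and dominance passes from s through J to I. *)
move: cs; rewrite Fs sub0r oppr_eq0 => /negP nz; apply: NNPP => nd; apply: nz.
rewrite big1_seq // => J /andP[_ JL]; have [nJ _ _ dJ] := LP J JL; have [_ _ Cs] := CP J JL.
have [/(Cs _ ss) [sJ|[dsJ _]]|/negbNE/eqP ->] := boolP (cf (C J) s != 0); last by rewrite mulr0.
  by rewrite sJ nJ in ns.
by case: nd; exact: dominates_trans dsJ sI.
Qed.

End Assembly.

Section Span.
Variables (V : lmodType rat) (T : choiceType) (D : T -> Prop) (v : T -> V).

(** Repetitions become multiplicities, which brings two combinations to a common list without
    repetition. *)
Lemma span_wide (s u : seq T) (c : T -> rat) : uniq u -> {subset s <= u} ->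
  \sum_(i <- s) c i *: v i = \sum_(i <- u) (c i *+ count_mem i s) *: v i.
Proof.
move=> uu; elim: s => [|a s IH] su.
  by rewrite big_nil big1 // => i _; rewrite mulr0n scale0r.
rewrite big_cons IH; last by move=> i si; apply: su; rewrite inE si orbT.
have au : a \in u by apply: su; rewrite mem_head.
rewrite (bigD1_seq a) //= [RHS](bigD1_seq a) //= eqxx addrA; congr (_ + _).
  by rewrite -scalerDl mulrS.
by apply: eq_bigr => i ia; rewrite eq_sym (negbTE ia) add0n.
Qed.

Lemma in_span_subspace : subspace (in_span D v).
Proof.
split; first by exists [::], (fun=> 0); rewrite big_nil.
move=> a x y [s1 [c1 [D1 ->]]] [s2 [c2 [D2 ->]]]; pose u := undup (s1 ++ s2).
have uu : uniq u by exact: undup_uniq.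
exists u, (fun i => a * (c1 i *+ count_mem i s1) + c2 i *+ count_mem i s2); split.
  by move=> i; rewrite mem_undup mem_cat => /orP[/D1|/D2].
rewrite (span_wide c1 uu); last by move=> i si; rewrite mem_undup mem_cat si.
rewrite (span_wide c2 uu); last by move=> i si; rewrite mem_undup mem_cat si orbT.
rewrite scaler_sumr -big_split; apply: eq_bigr => i _.
by rewrite scalerDl scalerA.
Qed.

Lemma in_span_gen i : D i -> in_span D v (v i).
Proof.
move=> Di; exists [:: i], (fun=> 1); split; last by rewrite big_seq1 scale1r.
by move=> j; rewrite inE => /eqP ->.
Qed.
End Span.

(** * Duality and orthogonal projection *)

Section Assembly.
Variables (k : nat) (t : lie_kind).
Hypothesis k1 : (1 <= k)%N.
Implicit Types (f w : chain k) (I : seq nat) (p : seq nat * {fset nat}).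

(** Gram-Schmidt: the new vector v is reduced to its part w' orthogonal to s. The last clause, that
    u is in the double orthogonal complement of s, lets the induction replace v by w' in pairings.
    For w' = 0 the quotient has the value 0. *)
Lemma orthogonal_decomposition (W : chain k -> Prop) (s : seq (chain k)) f :
  subspace W -> (forall x, x \in s -> W x) ->
  exists u w, [/\ W u, f = u + w, forall x, x \in s -> inner w x = 0 &
    forall y, (forall x, x \in s -> inner y x = 0) -> inner y u = 0].
Proof.
move=> sW; have [W0 WP] := sW; elim: s f => [|v s IH] f Ws.
  by exists 0, f; split; rewrite ?add0r // => y _; rewrite linear0.
have Ws' x : x \in s -> W x by move=> xs; apply: Ws; rewrite inE xs orbT.
have [u [w [Wu fE ow ou]]] := IH f Ws'; have [u' [w' [Wu' vE ow' ou']]] := IH v Ws'.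
have Wv : W v by apply: Ws; rewrite mem_head.
have w'E : w' = (-1) *: u' + v by rewrite vE scaleN1r addKr.
have Ww' : W w' by rewrite w'E; exact: WP.
have vI y : (forall x, x \in s -> inner y x = 0) -> inner y v = inner y w'.
  by move=> /ou' yu; rewrite vE linearD /= yu add0r.
exists (inner w w' / inner w' w' *: w' + u), (w - inner w w' / inner w' w' *: w'); split.
- exact: WP.
- by rewrite fE [_ *: _ + u]addrC -addrA; congr (_ + _); rewrite addrC subrK.
- move=> x; rewrite inE => /orP[/eqP->|xs]; last first.
    by rewrite innerBl innerZl (ow x xs) (ow' x xs) mulr0 subrr.
  rewrite innerBl innerZl vI // (vI w') //.
  have [w0|w0] := eqVneq (inner w' w') 0; last by rewrite divfK // subrr.
  by rewrite (inner_eq0 w0) !linear0 mulr0 subrr.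
move=> y oy; have oys x : x \in s -> inner y x = 0 by move=> xs; apply: oy; rewrite inE xs orbT.
have yw : inner y w' = 0 by rewrite -(vI y oys); apply: oy; rewrite mem_head.
by rewrite linearP /= ou // yw mulr0 addr0.
Qed.

Lemma inner_xi_nil f p : distinguished k p -> p.2 = fset0 -> inner f (xi k t p) = cf f p.1.
Proof. by case: p => I J /andP[/= nI _] ->; rewrite xi_nil. Qed.

Lemma stable_lift_dual I f : nonsingular k I -> stable_lift t I f -> is_dual t (I, fset0) f.
Proof.
move=> nI [Sf fI fs] [I' J'] dp; have [/= nI' _] := andP dp.
have [J0|J0] := eqVneq J' fset0; last first.
  rewrite (stable_xi k1 _ dp) //; last by apply/StabP.
  by rewrite xpair_eqE [fset0 == _]eq_sym (negbTE J0) andbF.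
rewrite inner_xi_nil // J0 xpair_eqE eqxx andbT /=.
have [<- //|II] := eqVneq I I'; apply/eqP; apply: contraPT isT => /(fs _ (nonsingular_strict nI')).
by case=> [e|[_]]; [rewrite e eqxx in II | rewrite nI'].
Qed.

(** A lift is a dual chain, so the choice in [xi_dual] succeeds; by [xi_total] it can only return
    that lift. *)
Lemma e_hat_stable_lift I : nonsingular k I -> stable_lift t I (e_hat k t I).
Proof.
move=> nI; have [f lf] := stable_lift_exists t k1 nI.
have df := stable_lift_dual nI lf.
have dh : is_dual t (I, fset0) (e_hat k t I) by apply: epsilon_spec; exists f.
suff -> : e_hat k t I = f by [].
apply/eqP; rewrite -subr_eq0; apply/eqP; apply: (xi_total (t := t) k1) => p dp.
by rewrite innerBl dh // df // subrr.
Qed.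

(** Serves twice: the e_hat_I span the stable chains, and, as they are stable, everything orthogonal
    to the marked xi-monomials is stable. *)
Lemma Pos_orthogonal_span f : (forall p, distinguished k p -> p.2 != fset0 -> inner f (xi k t p) = 0) ->
  exists2 L : seq (seq nat), (forall I, I \in L -> nonsingular k I) &
    f = \sum_(I <- L) cf f I *: e_hat k t I.
Proof.
move=> of0; have [D fD] := cf_bound f.
pose L := [seq I <- parts D | nonsingular k I].
have uL : uniq L by rewrite filter_uniq ?undup_uniq.
exists L; first by move=> I; rewrite mem_filter => /andP[].
apply/eqP; rewrite -subr_eq0; apply/eqP; apply: (xi_total (t := t) k1) => p dp.
have [np _] := andP dp.
have dual I : I \in L -> is_dual t (I, fset0) (e_hat k t I).
  by rewrite mem_filter => /andP[nI _]; apply: stable_lift_dual => //; exact: e_hat_stable_lift.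
rewrite innerBl inner_suml.
have [J0|J0] := eqVneq p.2 fset0.
  rewrite inner_xi_nil //.
  have -> : \sum_(I <- L) inner (cf f I *: e_hat k t I) (xi k t p) = \sum_(I <- L) cf f I * (I == p.1)%:R.
    apply: eq_big_seq => I IL; apply: etrans (innerZl _ _ _) _; rewrite (dual I IL p dp).
    by case: (p) J0 => I' J' /= ->; rewrite xpair_eqE eqxx andbT.
  rewrite sum_indicator // mem_filter np /=; case: ifP => [_|nD]; first by rewrite subrr.
  rewrite subr0; apply/eqP; apply: contraFT nD => /fD[_ h]; apply: mem_parts => //.
  by have /andP[] := nonsingular_strict np.
rewrite of0 // big1_seq ?subr0 // => I /andP[_ IL]; apply: etrans (innerZl _ _ _) _.
rewrite (dual I IL p dp); case: (p) J0 => I' J' /= J0.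
by rewrite xpair_eqE [fset0 == _]eq_sym (negbTE J0) andbF mulr0.
Qed.

Lemma e_hat_Stab (L : seq (seq nat)) (c : seq nat -> rat) :
  (forall I, I \in L -> nonsingular k I) -> Stab t (\sum_(I <- L) c I *: e_hat k t I).
Proof.
move=> nL; apply: subspace_sum; first exact: Stab_subspace.
by move=> I /nL nI; have [] := e_hat_stable_lift nI.
Qed.

Lemma Stab_xi f p : Stab t f -> distinguished k p -> p.2 != fset0 -> inner f (xi k t p) = 0.
Proof. by move=> /StabP Sf dp J0; apply: stable_xi. Qed.

Lemma Stab_Pos_orthogonal : orthogonal_subspaces (Stab (k := k) t) (Pos t).
Proof.
move=> u w Su [s [c [sD ->]]]; rewrite linear_sum big1_seq // => p /andP[_ /sD /andP[dp J0]].
by rewrite linearZ /= Stab_xi ?mulr0.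
Qed.

Definition marked_parts D : seq (seq nat * {fset nat}) :=
  [seq p <- [seq (K, [fset i in (J : seq nat)]%fset) | K <- parts D, J <- parts D] | [&& distinguished k p, p.2 != fset0 & (sumn p.1 <= D)%N]].

Lemma mem_marked_parts D p : distinguished k p -> p.2 != fset0 -> (sumn p.1 <= D)%N ->
  p \in marked_parts D.
Proof.
case: p => I J dp J0 /= ID; have [/= nI /fsubsetP JI] := andP dp.
rewrite mem_filter dp J0 ID /=.
(* Leading parts are parts of I, so J is a subsequence of I and its sum is also at most D. *)
pose J' := [seq i <- I | i \in J].
have eJ : J = [fset i in J']%fset.
  apply/fsetP => i; rewrite !inE mem_filter; case iJ : (i \in J) => //=.
  have := JI i iJ; rewrite inE /= => il; apply/esym.
  have [_ _ eI] := normal_formP k1 nI; rewrite -eI mem_cat; apply/orP; right.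
  case/mapP: il => B Bb ->; apply/flattenP; exists B => //.
  have [_ /allP /(_ B Bb) /andP[B0 _] _] := runs3P (drop (main_size k I) I).
  by case: (B) B0 => // a B' _; rewrite mem_head.
have sI : sorted ltn I by have /andP[] := nonsingular_strict nI.
rewrite eJ; apply/allpairsP; exists (I, J'); split=> //=; apply: mem_parts => //.
  by apply: sorted_filter => //; exact: ltn_trans.
apply: leq_trans ID; rewrite /J'; elim: (I) => //= a r IH.
by case: ifP => _ /=; lia.
Qed.

Lemma decomposition f : exists u w, [/\ Stab t u, Pos t w & f = u + w].
Proof.
have [D fD] := cf_bound f.
pose W := in_span (fun p => p \in marked_parts D) (xi k t).
have [|u [w [[r [c [rD uE]]] fE ow _]]] := @orthogonal_decomposition W [seq xi k t p | p <- marked_parts D] f (in_span_subspace _ _).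
  by move=> x /mapP[p pD ->]; exact: in_span_gen.
have mP p : p \in marked_parts D -> [/\ distinguished k p, p.2 != fset0 & (sumn p.1 <= D)%N].
  by rewrite mem_filter => /andP[/and3P[]].
have xD p s : p \in marked_parts D -> cf (xi k t p) s != 0 -> (sumn s <= D)%N.
  by move=> /mP[/andP[np _] _ pD] /(xi_degree k1 np) ->.
(* The projection u involves only degrees up to D, hence so does w, and xi-monomials of larger
   degree are orthogonal to it automatically. *)
have wD s : cf w s != 0 -> (sumn s <= D)%N.
  have wE : w = (-1) *: u + f by rewrite fE scaleN1r addKr.
  rewrite wE cfP; have [/fD[]//|/negbNE/eqP ->] := boolP (cf f s != 0).
  rewrite addr0 mulN1r oppr_eq0 uE cf_sum => h; rewrite leqNgt; apply/negP => Ds.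
  move/negP: h; apply; rewrite big1_seq // => p /andP[_ /rD pD].
  by apply/eqP; rewrite mulf_eq0; apply/orP; right; apply: contraTT Ds => /(xD _ _ pD); rewrite -leqNgt.
exists w, u; split; last by rewrite addrC.
  have [|L nL ->] := @Pos_orthogonal_span w; last exact: e_hat_Stab.
  move=> p dp J0; have [pD|Dp] := leqP (sumn p.1) D.
    by apply: ow; apply: map_f; exact: mem_marked_parts.
  rewrite /inner big1_seq // => K _; rewrite -!cf_strict.
  apply/eqP; rewrite mulf_eq0; case: eqVneq => //= /wD KD.
  apply: contraTT Dp => /(xi_degree k1) <-; first by rewrite -leqNgt.
  by case/andP: dp.
by rewrite uE; exists r, c; split=> // p /rD /mP[dp J0 _]; rewrite dp J0.
Qed.
End Assembly.

Theorem theorem6p1 (k : nat) (t : lie_kind) (hk : (1 <= k)%N) :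
  [/\ direct_sum (Stab (k := k) t) (Pos t)
      /\ orthogonal_subspaces (Stab (k := k) t) (Pos t),
      family_basis (nonsingular k) (e_hat k t) (Stab (k := k) t),
      forall I : seq nat, nonsingular k I ->
        exists x : chain k,
          in_span (fun I' => [/\ strict k I', singular k I' & dominates I' I])
            (e k) x
          /\ e_hat k t I = e k I + x
    & forall c : chain k, Stab t c ->
        in_span (fun I => strict k I && singular k I) (e k) c -> c = 0].
Proof.
have orth := @Stab_Pos_orthogonal k t hk.
split.
- split; last exact: orth.
  split.
  + exact: Stab_subspace.
  + exact: in_span_subspace.
  + by move=> x; have [u [w []]] := decomposition t hk x; exists u, w.
  + by move=> x Sx Px; apply: inner_eq0; exact: orth.
- split.
    move=> s c us sn s0 I Is.
    (* At a nonsingular I only e_hat_I itself has a nonzero coefficient, so c I can be read off. *)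
    have := congr1 (fun x => cf x I) s0; rewrite cf_sum [RHS]inner0l.
    have -> : \sum_(J <- s) c J * cf (e_hat k t J) I = \sum_(J <- s) c J * (J == I)%:R.
      apply: eq_big_seq => J Js; congr (_ * _).
      have [_ JJ Js'] := e_hat_stable_lift t hk (sn J Js).
      have [<- //|JI] := eqVneq J I; apply/eqP; apply: contraPT isT.
      move=> /(Js' _ (nonsingular_strict (sn I Is))) [IJ|[_]]; last by rewrite (sn I Is).
      by rewrite IJ eqxx in JI.
    by rewrite sum_indicator // Is.
  move=> x; split=> [Sx|[s [c [sn ->]]]]; last exact: e_hat_Stab.
  have [L nL xE] := @Pos_orthogonal_span k t hk x (fun p => Stab_xi hk Sx).
  by exists L, (cf x).
- move=> I nI; have [Sh hI hs] := e_hat_stable_lift t hk nI.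
  have [D hD] := cf_bound (e_hat k t I).
  pose L := [seq K <- [seq K <- parts D | strict k K] | (K != I) && (cf (e_hat k t I) K != 0)].
  exists (\sum_(K <- L) cf (e_hat k t I) K *: e k K); split.
    exists L, (cf (e_hat k t I)); split=> // K; rewrite !mem_filter => /and3P[/andP[KI K0] sK _].
    have [eK|[dK nK]] := hs K sK K0; first by rewrite eK eqxx in KI.
    by split=> //; rewrite /singular nK strict_kpartition.
  apply: cf_inj; apply: (@alt_ext k); try exact: alt_cf.
  move=> s ss; rewrite -[e k I]scale1r cfP mul1r cf_e // ?nonsingular_strict // cf_sum.
  have -> : \sum_(K <- L) cf (e_hat k t I) K * cf (e k K) s = \sum_(K <- L) cf (e_hat k t I) K * (K == s)%:R.
    by apply: eq_big_seq => K; rewrite !mem_filter => /and3P[_ sK _]; rewrite cf_e.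
  rewrite sum_indicator ?filter_uniq ?undup_uniq // !mem_filter ss /=.
  have [<-|Is] := eqVneq I s; first by rewrite ?eqxx /= hI addr0.
  rewrite /= add0r; case: (eqVneq (cf (e_hat k t I) s) 0) => [->|s0] //=.
  by rewrite mem_parts //; [case/andP: ss | case: (hD s s0)].
(* Marked xi-monomials are orthogonal to c by stability; unmarked ones are the nonsingular
   monomials, which do not occur in c. *)
move=> c Sc [s [a [sD cE]]]; apply: (xi_total (t := t) hk) => p dp.
have [J0|J0] := eqVneq p.2 fset0; last exact: Stab_xi.
rewrite inner_xi_nil // cE cf_sum big1_seq // => K /andP[_ /sD /andP[sK /andP[_ nK]]].
have [np _] := andP dp; rewrite (cf_e sK (nonsingular_strict np)).
by case: eqP => [Kp|]; [rewrite Kp np in nK | rewrite mulr0].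
Qed.
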